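(* Let $(X_t)_{t\ge0}$ be as in the context, satisfying assumption $(\mathcal A)$ with killing rate $\lambda>0$, and assume $\gamma^*>0$ and $\lambda<\lambda_c$. Let $\theta^*:=\sup\{\theta>0:\ \mathbb{E}_0[e^{\theta T_\delta}]<\infty\}$. Then $\theta^*$ is the unique solution in $(0,\theta_+)$ of $\psi(\theta)=\lambda$, and for all $i,j\in\mathbb{N}$ the limit \[\nu^*(i):=\lim_{t\to\infty}\mathbb{P}_j(X_t=i\mid t<T_\delta)\] exists and does not depend on $j$. The probability measure $\nu^*$ on $\mathbb{N}$ is a quasi-stationary distribution of $(X_t)$, i.e. $\mathbb{P}_{\nu^*}(X_t=i\mid t<T_\delta)=\nu^*(i)$ for all $t\ge0$, $i\in\mathbb{N}$, and it is given by \[\nu^*(0)=\frac{\theta^*}{\lambda},\qquad \nu^*(i)=-\bar q_{0,0}\,\frac{\theta^*}{\lambda}\int_0^\infty\int_{(v,\infty)}\mathbb{P}\big(e^{x}(v)=i\big)\,e^{\theta^* v}\,\eta(\mathrm{d}x)\,\mathrm{d}v\quad (i\ge1).\]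
   Context: $(X_t)_{t\ge0}$ is a (non-explosive) continuous-time Markov chain on $\mathbb{N}\cup\{\delta\}$, $\mathbb{N}=\{0,1,2,\dots\}$, with rate matrix $Q=(q_{i,j})$, $\delta$ absorbing, irreducible on $\mathbb{N}$; $T_\delta=\inf\{t\ge0: X_t=\delta\}$ and $\mathbb{P}_\mu(T_\delta<\infty)=1$ for every initial law $\mu$. Assumption $(\mathcal A)$: $q_{i,\delta}=\lambda\mathbf 1_{\{i=0\}}$ for all $i\in\mathbb{N}$, with $\lambda>0$. $\gamma^*:=\sup\{\gamma>0:\ \exists i\in\mathbb{N},\ \mathbb{E}_i[e^{\gamma T_\delta}]<\infty\}$. The non-killed chain $(\bar X_t)$ is the Markov chain on $\mathbb{N}$ with rates $\bar q_{i,j}=q_{i,j}$ for $i\neq j$ in $\mathbb{N}$ and $\bar q_{0,0}=q_{0,0}+\lambda$ (so $-\bar q_{0,0}$ is the rate of jumping from $0$ to other states of $\mathbb{N}$). Started from $0$, let $g_1=\inf\{t>0:\bar X_t\ne0\}$ and for $n\ge1$, $d_n=\inf\{t>g_n:\bar X_t=0\}$, $g_{n+1}=\inf\{t>d_n:\bar X_t\neq0\}$; the $n$-th excursion is $e_n(r)=\bar X_{g_n+r}\mathbf 1_{\{r<d_n-g_n\}}$, $r\ge0$, with length $L(e_n)=d_n-g_n$. The $e_n$ are i.i.d.; a canonical excursion $e$ is a process with their common law, $\eta$ is the law of $L(e)$, and for $\ell>0$, $e^{\ell}$ denotes a process with the law of $e$ conditioned on $L(e)=\ell$. Let $\Psi_\eta(\theta)=\int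 e^{\theta x}\eta(\mathrm dx)$, $\theta_+=\sup\{\theta>0:\Psi_\eta(\theta)<\infty\}$, $\psi(\theta)=\theta-\bar q_{0,0}(\Psi_\eta(\theta)-1)$ for $\theta<\theta_+$, and $\lambda_c:=\lim_{\theta\uparrow\theta_+}\psi(\theta)\in(0,\infty]$. *)

(* Defs.v *)
From HB Require Import structures.
From mathcomp Require Import all_boot all_order all_algebra.
From mathcomp Require Import all_classical all_reals all_analysis.
From mathcomp Require Import measurable_realfun.
Set Implicit Arguments. Unset Strict Implicit. Unset Printing Implicit Defensive.
Import Order.TTheory GRing.Theory Num.Theory.
Import numFieldNormedType.Exports.
Local Open Scope classical_set_scope.
Local Open Scope ring_scope.

(* State space N u {delta}: [Some i] is the state i of N, [None] is delta. *)
Definition state := option nat.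

Definition qrate (R : realType) (Q : state -> state -> R) (x : state) : R :=
  - Q x x.

Definition jprob (R : realType) (Q : state -> state -> R) (x y : state) : R :=
  if qrate Q x == 0 then (x == y)%:R
  else if x == y then 0 else Q x y / qrate Q x.

Definition is_Qmatrix (R : realType) (Q : state -> state -> R) : Prop :=
  (forall x y, x != y -> 0 <= Q x y) /\
  (forall x, (fun n : nat => \sum_(k < n) Q x (Some (k : nat))) @ \oo --> - Q x None).

Definition irreducible_on_N (R : realType) (Q : state -> state -> R) : Prop :=
  forall i j : nat, exists s : seq nat,
    path (fun a b : nat => (a != b) && (0 < Q (Some a) (Some b))) i s
    && (last i s == j).

Definition hold (Omega : Type) (R : realType) (J : nat -> Omega -> \bar R)
  (n : nat) (w : Omega) : \bar R :=
  if J n w == +oo%E then +oo%E else (J n.+1 w - J n w)%E.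

(* [X] is a non-explosive continuous-time Markov chain with rate matrix Q,
   started at [x0] under [P] (jump chain / holding time description,
   Norris, Markov Chains, Sect. 2.6): there are jump times J_n and a jump
   chain Y_n with X_t = Y_n on [J_n, J_{n+1}), J_n -> +oo, and the joint law
   of (Y_0..Y_n, S_1..S_n) is the one of a discrete Markov chain with
   matrix Pi started at x0 together with independent exponential holding
   times of parameters q_{Y_0}, ..., q_{Y_{n-1}}. *)
Definition is_ctmc d (Omega : measurableType d) (R : realType)
  (P : probability Omega R) (Q : state -> state -> R) (x0 : state)
  (X : R -> Omega -> state) : Prop :=
  exists (Y : nat -> Omega -> state) (J : nat -> Omega -> \bar R),
  [/\ (forall n y, measurable (Y n @^-1` [set y])) /\
      (forall n, measurable_fun [set: Omega] (J n : Omega -> \bar R)),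
      (forall w, J 0%N w = 0%E) /\ (forall n w, (J n w <= J n.+1 w)%E),
      (forall w (t : R), exists n, (t%:E < J n w)%E),
      (forall w n (t : R), (J n w <= t%:E)%E -> (t%:E < J n.+1 w)%E ->
          X t w = Y n w) &
      (forall n (y : nat -> state) (s : nat -> R), (forall k, 0 <= s k) ->
         P [set w | (forall k, (k <= n)%N -> Y k w = y k) /\
                    (forall k, (k < n)%N -> ((s k)%:E < hold J k w)%E)]
         = ((y 0%N == x0)%:R *
            \prod_(k < n) (jprob Q (y k) (y k.+1) *
                           expR (- qrate Q (y k) * s k)))%:E)].

Definition Tdelta (Omega : Type) (R : realType) (X : R -> Omega -> state)
  (w : Omega) : \bar R :=
  ereal_inf [set t%:E | t in [set t : R | 0 <= t /\ X t w = None]].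

Definition EexpT d (Omega : measurableType d) (R : realType)
  (P : probability Omega R) (X : R -> Omega -> state) (g : R) : \bar R :=
  (\int[P]_w expeR (g%:E * Tdelta X w))%E.

Definition gamma_star d (Omega : measurableType d) (R : realType)
  (P : nat -> probability Omega R) (X : nat -> R -> Omega -> state) : \bar R :=
  ereal_sup [set g%:E | g in
    [set g : R | 0 < g /\ exists i, (EexpT (P i) (X i) g < +oo)%E]].

Definition theta_star d (Omega : measurableType d) (R : realType)
  (P : nat -> probability Omega R) (X : nat -> R -> Omega -> state) : \bar R :=
  ereal_sup [set g%:E | g in
    [set g : R | 0 < g /\ (EexpT (P 0%N) (X 0%N) g < +oo)%E]].

(* P_mu(A) = sum_j mu(j) P_j(A), for an initial law mu on N; the event may
   depend on j because the chain started at j is [X j] under [P j]. *)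
Definition Pmix d (Omega : measurableType d) (R : realType)
  (P : nat -> probability Omega R) (mu : nat -> R) (A : nat -> set Omega)
  : \bar R :=
  (\sum_(j <oo) ((mu j)%:E * P j (A j)))%E.

Definition is_prob_vector (R : realType) (mu : nat -> R) : Prop :=
  (forall i, 0 <= mu i) /\ series mu @ \oo --> (1 : R).

Definition cond_mix d (Omega : measurableType d) (R : realType)
  (P : nat -> probability Omega R) (X : nat -> R -> Omega -> state)
  (mu : nat -> R) (t : R) (i : nat) : R :=
  fine (Pmix P mu (fun j => [set w | X j t w = Some i /\ (t%:E < Tdelta (X j) w)%E]))
  / fine (Pmix P mu (fun j => [set w | (t%:E < Tdelta (X j) w)%E])).

Definition cond_prob d (Omega : measurableType d) (R : realType)
  (P : probability Omega R) (X : R -> Omega -> state) (t : R) (i : nat) : R :=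
  fine (P [set w | X t w = Some i /\ (t%:E < Tdelta X w)%E])
  / fine (P [set w | (t%:E < Tdelta X w)%E]).

(* rates of the non-killed chain: the killing rate is put back on the
   diagonal (qbar_{0,0} = q_{0,0} + lambda under (A)), no jump to delta. *)
Definition Qbar (R : realType) (Q : state -> state -> R) (x y : state) : R :=
  match y with
  | None => if x is None then Q None None else 0
  | Some _ => if x == y then Q x x + Q x None else Q x y
  end.

Definition qbar00 (R : realType) (Q : state -> state -> R) : R :=
  Qbar Q (Some 0%N) (Some 0%N).

Definition exc_g1 (Omega : Type) (R : realType) (Xbar : R -> Omega -> state)
  (w : Omega) : \bar R :=
  ereal_inf [set t%:E | t in [set t : R | 0 < t /\ Xbar t w <> Some 0%N]].

Definition exc_d1 (Omega : Type) (R : realType) (Xbar : R -> Omega -> state)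
  (w : Omega) : \bar R :=
  ereal_inf [set t%:E | t in
     [set t : R | (exc_g1 Xbar w < t%:E)%E /\ Xbar t w = Some 0%N]].

Definition exc_len (Omega : Type) (R : realType) (Xbar : R -> Omega -> state)
  (w : Omega) : \bar R :=
  (exc_d1 Xbar w - exc_g1 Xbar w)%E.

(* the event {e_1(v) = i} for i >= 1, i.e. {Xbar_{g_1+v} = i, v < L(e_1)} *)
Definition exc_event (Omega : Type) (R : realType) (Xbar : R -> Omega -> state)
  (v : R) (i : nat) : set Omega :=
  [set w | exists g : R, exc_g1 Xbar w = g%:E /\
           Xbar (g + v) w = Some i /\ (v%:E < exc_len Xbar w)%E].

(* Psi_eta(theta) = int e^{theta x} eta(dx), eta = law of L(e) *)
Definition Psi_eta d (Omega : measurableType d) (R : realType)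
  (Pbar : probability Omega R) (Xbar : R -> Omega -> state) (th : R) : \bar R :=
  (\int[Pbar]_w expeR (th%:E * exc_len Xbar w))%E.

Definition theta_plus d (Omega : measurableType d) (R : realType)
  (Pbar : probability Omega R) (Xbar : R -> Omega -> state) : \bar R :=
  ereal_sup [set th%:E | th in
     [set th : R | 0 < th /\ (Psi_eta Pbar Xbar th < +oo)%E]].

(* psi(theta) = theta - qbar_{0,0} (Psi_eta(theta) - 1)  (theta < theta_+) *)
Definition psi d (Omega : measurableType d) (R : realType)
  (Q : state -> state -> R)
  (Pbar : probability Omega R) (Xbar : R -> Omega -> state) (th : R) : R :=
  th - qbar00 Q * (fine (Psi_eta Pbar Xbar th) - 1).

Definition is_lambda_c d (Omega : measurableType d) (R : realType)
  (Q : state -> state -> R)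
  (Pbar : probability Omega R) (Xbar : R -> Omega -> state) (l : \bar R)
  : Prop :=
  (theta_plus Pbar Xbar = +oo%E /\
     ((psi Q Pbar Xbar x)%:E @[x --> +oo] --> l)) \/
  (exists tp : R, theta_plus Pbar Xbar = tp%:E /\
     ((psi Q Pbar Xbar x)%:E @[x --> tp^'-] --> l)).

(* int_0^oo P(e(v) = i, v < L(e)) e^{theta v} dv
   = int_0^oo int_{(v,oo)} P(e^x(v) = i) e^{theta v} eta(dx) dv *)
Definition exc_int d (Omega : measurableType d) (R : realType)
  (Pbar : probability Omega R) (Xbar : R -> Omega -> state) (th : R) (i : nat)
  : \bar R :=
  (\int[@lebesgue_measure R]_(v in `[0%R, +oo[%classic)
      (Pbar (exc_event Xbar v i) * (expR (th * v))%:E))%E.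

(* Main.v *)
(* Let A be the off-diagonal part of Q on N and, for a tilt theta, let m j be
   q_0 - lam times the expected e^{theta v}-weighted time spent in j during an
   excursion (Green function of the chain tabooed at 0) and h i the expected
   value of e^{theta x}, x the hitting time of 0 from i.  Normalised by
   m 0 = h 0 = 1, both always solve the eigenvalue equations m Q = - theta m and
   Q h = - theta h off the state 0; at 0 these read
   (q_0 - lam) Psi_eta(theta) = q_0 - theta, which is psi(theta) = lam.
   Since Psi_eta is still finite slightly above theta = ts, sum_j m j h j is
   finite, so e^{ts t} p_t(i, j) h j / h i is a stochastic semigroup with
   invariant law m h / Z and converges in l^1.  Certain absorption gives
   h >= ts / lam, so one may divide by h under the sum: this yields the Yaglom
   limit, proportional to m, and the exact decay rate ts of P_i(t < T_delta).
   Probability enters only through the law of the jump chain and its holding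
   times, which identifies p_t with a sum over the number of jumps of iterated
   convolutions with exponential kernels. *)
Require Import Defs.
From HB Require Import structures.
From mathcomp Require Import all_boot all_order all_algebra.
From mathcomp Require Import all_classical all_reals all_analysis.
From mathcomp Require Import measurable_realfun.
From mathcomp Require Import ring lra.
Import Order.TTheory GRing.Theory Num.Theory.
Import numFieldNormedType.Exports.
Local Open Scope classical_set_scope.
Local Open Scope ring_scope.
Set Implicit Arguments. Unset Strict Implicit. Unset Printing Implicit Defensive.

(** * Series, convolution and the exponential kernel *)

(** Two obstacles shape the argument. The semigroup is available only as a minimal solution, a sum
    over jump counts, so an eigenvector of the rates need not be one of the semigroup: comparison
    gives the inequalities [m_ph_le] and [ph_superharmonic] only. Equality for [m] comes from mass
    conservation. Killing acts at 0 alone, so by time t the measure [m] loses at most [lam] times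
    the integral of exp(- ts s) over [0, t]; since its total mass is [lam / ts], what remains
    already exhausts the upper bound. Harmonicity of [h] follows by pairing with [m]. The second
    obstacle is that a tilted rate [q j - theta] has no sign a priori. Kernels with rates of either
    sign are therefore integrated in [\bar R], and positivity of the rate off 0 is deduced from
    finiteness of the Green function. The lower bound on [h] acts three times: it makes the total
    mass of [m] finite, it removes the boundary term in the computation of that mass, and it makes 1
    / h a bounded test function. Convergence itself needs no coupling: the positive part of the
    difference to the invariant law loses a fixed amount per unit time through cancellation at state
    0. *)

Section ereal_series.
Local Open Scope ereal_scope.
Variable R : realType.
Implicit Types (f g : nat -> \bar R) (x : \bar R).

Lemma nneseries_ge0T f : (forall k, 0 <= f k) -> 0 <= \sum_(k <oo) f k.
Proof. by move=> f0; apply: nneseries_ge0 => n _ _; exact: f0. Qed.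

Lemma nneseries_term f k : (forall k, 0 <= f k) -> f k <= \sum_(k <oo) f k.
Proof.
move=> f0; rewrite (@nneseriesD1 _ f k)//; apply: leeDl.
by apply: nneseries_ge0 => n _ _; exact: f0.
Qed.

Lemma lee_nneseriesT f g : (forall k, 0 <= f k) -> (forall k, f k <= g k) ->
  \sum_(k <oo) f k <= \sum_(k <oo) g k.
Proof. by move=> f0 fg; apply: lee_nneseries. Qed.

Lemma nneseriesDT f g : (forall k, 0 <= f k) -> (forall k, 0 <= g k) ->
  \sum_(k <oo) (f k + g k) = \sum_(k <oo) f k + \sum_(k <oo) g k.
Proof. by move=> f0 g0; rewrite nneseriesD. Qed.

Lemma nneseries_eq0 f : (forall k, 0 <= f k) -> \sum_(k <oo) f k = 0 ->
  forall k, f k = 0.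
Proof.
move=> f0 S0 k; apply/eqP; rewrite eq_le f0 andbT -S0.
exact: nneseries_term.
Qed.

(** The factor may be [+oo]: then either all terms vanish and both sides are 0, by the convention 0
    * +oo = 0, or some term is positive and both sides are [+oo]. *)
Lemma nneseriesZle f x : 0 <= x -> (forall k, 0 <= f k) ->
  \sum_(k <oo) (x * f k) = x * \sum_(k <oo) f k.
Proof.
move=> + f0; case: x => [x x0|_|//]; first by rewrite nneseriesZl.
have := nneseries_ge0T f0; rewrite le_eqVlt => /predU1P[/esym S0|S0].
  rewrite S0 mule0 eseries0// => i _ _.
  by rewrite (nneseries_eq0 f0 S0 i) mule0.
rewrite gt0_mulye//.
have [k fk] : exists k, 0 < f k.
  apply: contrapT => /forallNP nf; move: S0; rewrite eseries0 ?ltxx// => i _ _.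
  by apply/eqP; rewrite eq_le f0 andbT leNgt; exact/negP/nf.
apply: (@nneseries_pinfty _ _ _ k) => // [n _|].
  by rewrite mule_ge0 ?leey.
by rewrite gt0_mulye.
Qed.

Lemma nneseriesZre f x : 0 <= x -> (forall k, 0 <= f k) ->
  \sum_(k <oo) (f k * x) = (\sum_(k <oo) f k) * x.
Proof.
move=> x0 f0; rewrite muleC -nneseriesZle//.
by apply: eq_eseriesr => i _; rewrite muleC.
Qed.

Lemma nneseries_delta f i : (forall k, 0 <= f k) ->
  \sum_(k <oo) ((k == i)%:R%:E * f k) = f i.
Proof.
move=> f0; rewrite (@nneseriesD1 _ _ i)//.
  rewrite eqxx mul1e [X in _ + X](_ : _ = 0) ?adde0//.
  by apply: eseries0 => k _ /andP[_ /negPf ->]; rewrite mul0e.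
by move=> k _; rewrite mule_ge0// lee_fin.
Qed.

Lemma nneseries_recl0 f : (forall k, 0 <= f k) ->
  \sum_(k <oo) f k = f 0%N + \sum_(k <oo) f k.+1.
Proof.
move=> f0; rewrite (@nneseries_split _ _ 0%N 1%N)// add0n big_nat1.
rewrite -(@nneseries_addn R f 1)//; congr (_ + _).
by apply: eq_eseriesr => i _; rewrite addn1.
Qed.

Lemma nneseries_le_fin f x : (forall k, 0 <= f k) ->
  (forall N, \sum_(0 <= k < N) f k <= x) -> \sum_(k <oo) f k <= x.
Proof.
move=> f0 fx; apply: lime_le; last exact: nearW.
by apply: is_cvg_nneseries => n _ _; exact: f0.
Qed.

Lemma nneseries_interchangeT (a : nat -> nat -> \bar R) :
  (forall i j, 0 <= a i j) ->
  \sum_(i <oo) \sum_(j <oo) a i j = \sum_(j <oo) \sum_(i <oo) a i j.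
Proof. by move=> a0; rewrite nneseries_interchange. Qed.

(** Tonelli after padding the triangular array with zeros. It turns a jump count split as [m] before
    and [n - m] after a given time into two independent counts, which yields the semigroup
    property. *)
Lemma nneseries_cauchy (a : nat -> nat -> \bar R) :
  (forall i j, 0 <= a i j) ->
  \sum_(n <oo) \sum_(0 <= m < n.+1) a m (n - m)%N =
  \sum_(m <oo) \sum_(k <oo) a m k.
Proof.
move=> a0.
transitivity (\sum_(n <oo) \sum_(m <oo)
    (if (m <= n)%N then a m (n - m)%N else 0)).
  apply: eq_eseriesr => n _.
  rewrite (@nneseries_split _ _ 0%N n.+1); last by move=> k _; case: ifP.
  rewrite add0n [X in _ = _ + X]eseries0 ?adde0; last first.
    by move=> i ni _; rewrite leqNgt ni.
  by apply: eq_big_nat => i /= ni; rewrite -ltnS ni.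
rewrite nneseries_interchangeT; last by move=> i j; case: ifP.
apply: eq_eseriesr => m _.
rewrite (@nneseries_split _ _ 0%N m); last by move=> k _; case: ifP.
rewrite add0n big1_seq ?add0e; last first.
  by move=> i; rewrite mem_index_iota => /andP[_ /andP[_]]; rewrite ltnNge => /negbTE->.
rewrite -(@nneseries_addn R); last by move=> k; case: ifP.
by apply: eq_eseriesr => i _; rewrite leq_addl addnK.
Qed.

Lemma mule_ge0_eq_pinfty x (y : \bar R) : 0 < x -> 0 <= y -> x * y < +oo -> y < +oo.
Proof.
move=> x0; case: y => [r _ _||//]; first exact: ltry.
by move=> _; rewrite gt0_muley// ltxx.
Qed.

End ereal_series.

(** * Translation invariance of Lebesgue integrals and Tonelli on the plane *)

Section lebesgue_shift.
Local Open Scope ereal_scope.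
Variable R : realType.
Notation leb := (@lebesgue_measure R).

Lemma lebesgue_measure_shift (a : R) (A : set (measurableTypeR R)) : measurable A ->
  leb A = pushforward leb (fun x : measurableTypeR R => (x + a)%R : measurableTypeR R) A.
Proof.
have mf : measurable_fun setT (fun x : measurableTypeR R => (x + a)%R : measurableTypeR R).
  exact: measurable_funD.
move=> mA; apply: (@lebesgue_measure_unique R (pushforward leb _)) => //=.
move=> _ [[x y] _ <-] /=.
rewrite /pushforward (_ : _ @^-1` _ = `](x - a)%R, (y - a)%R]%classic); last first.
  by apply/seteqP; split => z /=; rewrite !in_itv/= ltrBlDr lerBrDr.
rewrite !lebesgue_measure_itv/= !lte_fin ltrD2r.
by case: ifP => // _; rewrite !EFinN -!EFinB; congr _%:E; ring.
Qed.

Lemma integral_shift (f : R -> \bar R) (a : R) :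
  measurable_fun setT f -> (forall x, 0 <= f x) ->
  \int[leb]_x f (x + a)%R = \int[leb]_x f x.
Proof.
move=> mf f0.
have ms : measurable_fun setT (fun x : measurableTypeR R => (x + a)%R : measurableTypeR R).
  exact: measurable_funD.
transitivity (\int[pushforward leb (fun x : measurableTypeR R => (x + a)%R : measurableTypeR R)]_x f x).
  by rewrite ge0_integral_pushforward//.
apply: eq_measure_integral => A mA _.
exact: esym (lebesgue_measure_shift a mA).
Qed.

Lemma tonelliRR (f : R -> R -> \bar R) :
  measurable_fun setT (fun p : R * R => f p.1 p.2) ->
  (forall x y, 0 <= f x y) ->
  \int[leb]_x \int[leb]_y f x y = \int[leb]_y \int[leb]_x f x y.
Proof.
move=> mf f0.
exact: (@fubini_tonelli _ _ _ _ R leb leb (fun p : R * R => f p.1 p.2)).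
Qed.

Lemma measurable_int1 (f : R -> R -> \bar R) :
  measurable_fun setT (fun p : R * R => f p.1 p.2) ->
  (forall x y, 0 <= f x y) ->
  measurable_fun setT (fun x => \int[leb]_y f x y).
Proof.
move=> mf f0.
exact: (@measurable_fun_fubini_tonelli_F _ _ _ _ R leb (fun p : R * R => f p.1 p.2)).
Qed.

Lemma integral_seriesT d (T : measurableType d) (mu : {measure set T -> \bar R})
    (f : nat -> T -> \bar R) :
  (forall n, measurable_fun setT (f n)) -> (forall n x, 0 <= f n x) ->
  \int[mu]_x (\sum_(n <oo) f n x) = \sum_(n <oo) \int[mu]_x f n x.
Proof. by move=> mf f0; apply: integral_nneseries. Qed.

Lemma measurable_seriesT d (T : measurableType d) (f : nat -> T -> \bar R) :
  (forall n, measurable_fun setT (f n)) -> (forall n x, 0 <= f n x) ->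
  measurable_fun setT (fun x => \sum_(n <oo) f n x).
Proof. by move=> mf f0; apply: ge0_emeasurable_sum. Qed.

Lemma le_integralT d (T : measurableType d) (mu : {measure set T -> \bar R})
    (f g : T -> \bar R) :
  (forall x, 0 <= f x) -> measurable_fun setT f -> measurable_fun setT g ->
  (forall x, f x <= g x) -> \int[mu]_x f x <= \int[mu]_x g x.
Proof. by move=> f0 mf mg fg; apply: ge0_le_integral. Qed.

End lebesgue_shift.

(** * Exponential holding kernels with a rate of arbitrary sign *)

Section expk.
Local Open Scope ereal_scope.
Variable R : realType.
Notation leb := (@lebesgue_measure R).

(** Vanishing at negative times lets every convolution be an integral over the whole line, with no
    bounds of integration to carry along. *)
Definition expk (q t : R) : R := if (0 <= t)%R then expR (- (q * t)) else 0%R.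

Lemma expk_ge0 q t : (0 <= expk q t)%R.
Proof. by rewrite /expk; case: ifP => // _; exact: expR_ge0. Qed.

Lemma expkE_ge0 q t : 0 <= (expk q t)%:E.
Proof. by rewrite lee_fin expk_ge0. Qed.

Lemma measurable_expk q : measurable_fun setT (expk q).
Proof.
apply: measurable_fun_ifT => //.
  apply: measurable_fun_ler => //.
apply: measurableT_comp => //.
apply: measurableT_comp => //.
Qed.

Lemma expk_tilt (th q t : R) : (expR (th * t) * expk q t = expk (q - th) t)%R.
Proof.
rewrite /expk; case: ifP => _; last by rewrite mulr0.
by rewrite -expRD; congr expR; ring.
Qed.

Lemma expkD q t s : (0 <= t)%R -> (0 <= s)%R -> (expk q (t + s) = expk q t * expk q s)%R.
Proof.
move=> t0 s0; rewrite /expk t0 s0 addr_ge0// -expRD; congr expR; ring.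
Qed.

(** Left by time x plus still present at time x makes 1. Keeping the factor [c] outside, instead of
    dividing by it, makes the identity valid for zero and negative rates too. *)
Lemma expk_int_itv (c x : R) : (0 <= x)%R ->
  c%:E * \int[leb]_s ((s <= x)%R%:R * expk c s)%:E + (expk c x)%:E = 1.
Proof.
move=> x0.
have ms : measurable_fun [set: measurableTypeR R] (fun s : R => ((s <= x)%R%:R * expk c s)%:E).
  apply/measurable_EFinP; apply: measurable_funM; last exact: measurable_expk.
  by apply: measurableT_comp => //; apply: measurable_fun_ler.
have -> : \int[leb]_s ((s <= x)%R%:R * expk c s)%:E =
          \int[leb]_(s in `[0%R, x]) (expR (- (c * s)))%:E.
  rewrite [RHS]integral_mkcond; apply: eq_integral => s _.
  rewrite patchE mem_setE in_itv/= /expk; case: (leP 0%R s) => s0; case: (leP s x) => sx /=;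
    by rewrite ?mul1r ?mul0r ?mulr0.
move: x0; rewrite le_eqVlt => /predU1P[<-|x0].
  rewrite set_itv1 integral_set1 mule0 add0e /expk lexx mulr0 oppr0 expR0//.
rewrite -integralZl//; last first.
  apply: continuous_compact_integrable; first exact: segment_compact.
  apply: continuous_subspaceT => z.
  apply: continuous_comp; last exact: continuous_expR.
  apply: continuousN; apply: continuousM => //; exact: cst_continuous.
have := exponential_prob_itv0c c x0; rewrite /exponential_prob.
rewrite (_ : \int[leb]_(s in _) _ = \int[leb]_(s in `[0%R, x]) (c%:E * (expR (- (c * s)))%:E)).
  by move=> ->; rewrite /expk ltW// mulNr -EFinN -!EFinD; congr _%:E; ring.
apply: eq_integral => s; rewrite inE/= in_itv/= => /andP[s0 _].
by rewrite exponential_pdfE// EFinM mulNr.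
Qed.

Lemma measurable_expkB q : measurable_fun setT (fun p : R * R => (expk q (p.2 - p.1))%:E).
Proof.
apply/measurable_EFinP; apply: measurableT_comp; first exact: measurable_expk.
exact: measurable_funB.
Qed.

Lemma expk_int_shift (c r t : R) :
  c%:E * \int[leb]_s ((s <= t)%R%:R * expk c (s - r))%:E + (expk c (t - r))%:E
  = ((r <= t)%R%:R)%:E.
Proof.
have ms : measurable_fun [set: measurableTypeR R] (fun s : R => ((s <= t - r)%R%:R * expk c s)%:E).
  apply/measurable_EFinP; apply: measurable_funM; last exact: measurable_expk.
  by apply: measurableT_comp => //; apply: measurable_fun_ler.
have -> : \int[leb]_s ((s <= t)%R%:R * expk c (s - r))%:E =
          \int[leb]_s ((s <= t - r)%R%:R * expk c s)%:E.
  rewrite -[RHS](@integral_shift R _ (- r)%R)//.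
    by apply: eq_integral => s _; rewrite lerD2r.
  by move=> s; rewrite lee_fin mulr_ge0// expk_ge0.
have [rt|tr] := leP r t.
  by rewrite expk_int_itv ?subr_ge0.
rewrite {2}/expk subr_ge0 leNgt tr/= adde0.
rewrite integral0_eq ?mule0// => s _.
rewrite /expk; case: (leP s (t - r)%R) => str; last by rewrite mul0r.
by rewrite ifF ?mulr0//; apply/negbTE; rewrite -ltNge (le_lt_trans str)// subr_lt0.
Qed.

Lemma expk_int_pos (c : R) : (0 < c)%R ->
  \int[leb]_s (expk c s)%:E = (c^-1)%:E.
Proof.
move=> c0; have := integral_exponential_pdf c0.
rewrite (_ : \int[leb]_x _ = c%:E * \int[leb]_s (expk c s)%:E).
  move=> H; rewrite -[LHS]mul1e -(mulVf (lt0r_neq0 c0)) EFinM -muleA H mule1//.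
rewrite -ge0_integralZl//.
- apply: eq_integral => s _; rewrite /expk /exponential_pdf patchE.
  rewrite mem_setE in_itv/= andbT; case: ifP => _; rewrite ?mule0//.
  by rewrite EFinM mulNr.
- by apply/measurable_EFinP; exact: measurable_expk.
- by move=> s _; exact: expkE_ge0.
- by rewrite lee_fin ltW.
Qed.

(** The kernel is at least 1 on the half-line. This infinite mass is what later excludes nonpositive
    tilted rates. *)
Lemma expk_int_neg (c : R) : (c <= 0)%R ->
  \int[leb]_s (expk c s)%:E = +oo.
Proof.
move=> c0; apply/eqP; rewrite -leye_eq.
have <- : leb `[0%R, +oo[%classic = +oo.
  by rewrite lebesgue_measure_itv/= ltry oppr0 adde0.
rewrite -[leLHS]mul1e -integral_cst//= integral_mkcond.
apply: le_integralT => //=.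
- by move=> x; apply: erestrict_ge0 => y _; rewrite lee_fin.
- by apply/(measurable_restrictT _ _).1 => //; exact: measurable_cst.
- by apply/measurable_EFinP; exact: measurable_expk.
- move=> x; rewrite patchE mem_setE in_itv/= andbT; case: ifPn => [x0|_]; last exact: expkE_ge0.
  by rewrite lee_fin /expk x0 -expR0 ler_expR; nra.
Qed.

End expk.

(** * The minimal semigroup as a sum over the number of jumps *)

Section jump_kernel.
Local Open Scope ereal_scope.
Variable R : realType.
Notation leb := (@lebesgue_measure R).
Variable A : nat -> nat -> R.
Hypothesis A0 : forall i j, (0 <= A i j)%R.

Definition flux (f : nat -> R -> \bar R) j s : \bar R := \sum_(k <oo) (f k s * (A k j)%:E).

(** Mass at [j] at time [t] after exactly [n] jumps from the initial measure [a], decomposed at the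
    last jump time [s]: arrival by [flux], then no departure before [t]. The holding rates [q] are
    independent of the jump rates [A], so that a tilt changes [q] alone. *)
Fixpoint jker (q : nat -> R) (a : nat -> \bar R) (n : nat) (j : nat) (t : R) : \bar R :=
  if n is n'.+1 then
    \int[leb]_s (flux (jker q a n') j s * (expk (q j) (t - s))%:E)
  else a j * (expk (q j) t)%:E.

Lemma jkerS q a n j t : jker q a n.+1 j t =
  \int[leb]_s (flux (jker q a n) j s * (expk (q j) (t - s))%:E).
Proof. by []. Qed.

Lemma flux_ge0 f j s : (forall k t, 0 <= f k t) -> 0 <= flux f j s.
Proof. by move=> f0; apply: nneseries_ge0T => k; rewrite mule_ge0// lee_fin. Qed.

Lemma jker_ge0 q a n j t : (forall k, 0 <= a k) -> 0 <= jker q a n j t.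
Proof.
move=> a0; elim: n j t => [|n IH] j t; first by rewrite mule_ge0// expkE_ge0.
by apply: integral_ge0 => s _; rewrite mule_ge0 ?flux_ge0// expkE_ge0.
Qed.

Lemma measurable_flux f j : (forall k t, 0 <= f k t) -> (forall k, measurable_fun setT (f k)) ->
  measurable_fun setT (flux f j).
Proof.
move=> f0 mf; apply: measurable_seriesT => [k|k x].
  by apply: emeasurable_funM.
by rewrite mule_ge0// lee_fin.
Qed.

Lemma measurable_conv (f : R -> \bar R) (c : R) :
  measurable_fun setT f ->
  measurable_fun setT (fun p : R * R => f p.2 * (expk c (p.1 - p.2))%:E).
Proof.
move=> mf; apply: emeasurable_funM; first exact: measurableT_comp.
apply/measurable_EFinP; apply: measurableT_comp; first exact: measurable_expk.
exact: measurable_funB.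
Qed.

Lemma measurable_conv_fix (f : R -> \bar R) (c t : R) :
  measurable_fun setT f ->
  measurable_fun setT (fun s : R => f s * (expk c (t - s))%:E).
Proof.
move=> mf; apply: emeasurable_funM => //.
apply/measurable_EFinP; apply: measurableT_comp; first exact: measurable_expk.
exact: measurable_funB.
Qed.

Lemma measurable_jker q a n j : (forall k, 0 <= a k) -> measurable_fun setT (jker q a n j).
Proof.
move=> a0; elim: n j => [|n IH] j /=.
  apply: emeasurable_funM => //; apply/measurable_EFinP; exact: measurable_expk.
apply: (@measurable_int1 R (fun t s => flux (jker q a n) j s * (expk (q j) (t - s))%:E)).
  apply: (@measurable_conv (flux (jker q a n) j)).
  by apply: measurable_flux => // k t; exact: jker_ge0.
by move=> t s; rewrite mule_ge0 ?expkE_ge0// flux_ge0// => k u; exact: jker_ge0.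
Qed.

Lemma measurable_flux_jker q a n j : (forall k, 0 <= a k) ->
  measurable_fun setT (flux (jker q a n) j).
Proof.
move=> a0; apply: measurable_flux => [k t|k]; first exact: jker_ge0.
exact: measurable_jker.
Qed.

Lemma flux_jker_ge0 q a n j t : (forall k, 0 <= a k) -> 0 <= flux (jker q a n) j t.
Proof. by move=> a0; apply: flux_ge0 => k s; exact: jker_ge0. Qed.

Lemma jker_lt0 q a n j t : (t < 0)%R -> jker q a n j t = 0.
Proof.
elim: n j t => [|n IH] j t t0 /=.
  by rewrite /expk leNgt t0 mule0.
apply: integral0_eq => s _.
have [s0|s0] := ltP s 0%R.
  by rewrite /flux eseries0 ?mul0e// => k _ _; rewrite IH// mul0e.
rewrite /expk ifF ?mule0//; apply/negbTE; rewrite -ltNge subr_lt0.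
exact: lt_le_trans s0.
Qed.

Lemma flux_jker_lt0 q a n j t : (t < 0)%R -> flux (jker q a n) j t = 0.
Proof.
move=> t0; rewrite /flux eseries0// => k _ _; by rewrite jker_lt0// mul0e.
Qed.

Lemma flux_series (w : nat -> \bar R) (f : nat -> nat -> R -> \bar R) j s :
  (forall l, 0 <= w l) -> (forall l k t, 0 <= f l k t) ->
  flux (fun k t => \sum_(l <oo) (w l * f l k t)) j s =
  \sum_(l <oo) (w l * flux (f l) j s).
Proof.
move=> w0 f0; rewrite /flux.
under eq_eseriesr => k _.
  rewrite -nneseriesZre ?lee_fin//; last by move=> l; rewrite mule_ge0.
  over.
rewrite nneseries_interchangeT; last by move=> k l; rewrite !mule_ge0// lee_fin.
apply: eq_eseriesr => l _; rewrite -nneseriesZle//.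
  by apply: eq_eseriesr => k _; rewrite muleA.
by move=> k; rewrite mule_ge0// lee_fin.
Qed.

Lemma jker_series q (w : nat -> \bar R) (b : nat -> nat -> \bar R) n j t :
  (forall l, 0 <= w l) -> (forall l k, 0 <= b l k) ->
  jker q (fun k => \sum_(l <oo) (w l * b l k)) n j t =
  \sum_(l <oo) (w l * jker q (b l) n j t).
Proof.
move=> w0 b0; elim: n j t => [|n IH] j t.
  rewrite /= -nneseriesZre ?expkE_ge0//; last by move=> l; rewrite mule_ge0.
  by apply: eq_eseriesr => l _; rewrite muleA.
rewrite jkerS.
have fx0 l k u : 0 <= jker q (b l) n k u by exact: jker_ge0.
transitivity (\int[leb]_s \sum_(l <oo)
    (w l * (flux (jker q (b l) n) j s * (expk (q j) (t - s))%:E))).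
  apply: eq_integral => s _; rewrite /flux.
  under eq_eseriesr => k _ do rewrite IH.
  rewrite -/(flux (fun k s => \sum_(l <oo) (w l * jker q (b l) n k s)) j s).
  rewrite flux_series// -nneseriesZre ?expkE_ge0//; last first.
    by move=> l; rewrite mule_ge0// flux_ge0.
  by apply: eq_eseriesr => l _; rewrite muleA.
have mc l : measurable_fun setT (fun s : measurableTypeR R =>
    flux (jker q (b l) n) j s * (expk (q j) (t - s))%:E).
  by apply: measurable_conv_fix; exact: measurable_flux_jker.
rewrite integral_seriesT.
- apply: eq_eseriesr => l _; rewrite ge0_integralZl// => s _.
  by rewrite mule_ge0 ?expkE_ge0// flux_ge0.
- by move=> l; apply: emeasurable_funM.
- by move=> l s; rewrite !mule_ge0 ?expkE_ge0// flux_ge0.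
Qed.

Definition delta (i k : nat) : \bar R := (k == i)%:R%:E.

Lemma delta_ge0 i k : 0 <= delta i k.
Proof. by rewrite lee_fin. Qed.

Lemma jker_delta q a n j t : (forall k, 0 <= a k) ->
  jker q a n j t = \sum_(l <oo) (a l * jker q (delta l) n j t).
Proof.
move=> a0; rewrite -jker_series//; last by move=> l k; exact: delta_ge0.
congr jker; apply/funext => k; under eq_eseriesr => l _ do rewrite muleC /delta eq_sym.
by rewrite nneseries_delta.
Qed.

Lemma jker_sum q (b : nat -> nat -> \bar R) n j t : (forall l k, 0 <= b l k) ->
  jker q (fun k => \sum_(l <oo) b l k) n j t = \sum_(l <oo) jker q (b l) n j t.
Proof.
move=> b0; have := @jker_series q (fun=> 1) b n j t (fun=> lee01) b0.
under eq_fun => k do under eq_eseriesr => l _ do rewrite mul1e.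
by move=> ->; apply: eq_eseriesr => l _; rewrite mul1e.
Qed.

(** Splitting an integral at [t < r] and shifting leaves the open half-line, whereas the induction
    hypothesis of [chapman_kolmogorov_jumps] covers the closed one; the endpoint is a null set. *)
Lemma integral_gt0_ge0 (f : R -> \bar R) :
  measurable_fun setT f -> (forall x, 0 <= f x) ->
  \int[leb]_r (((0 < r)%R%:R : R)%:E * f r) = \int[leb]_r (((0 <= r)%R%:R : R)%:E * f r).
Proof.
move=> mf f0; apply: ae_eq_integral => //.
- apply: emeasurable_funM => //; apply/measurable_EFinP; apply: measurableT_comp => //.
  exact: measurable_fun_ltr.
- apply: emeasurable_funM => //; apply/measurable_EFinP; apply: measurableT_comp => //.
  exact: measurable_fun_ler.
exists [set 0%R]; split => //; first exact: lebesgue_measure_set1.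
move=> x /= /not_implyP[_]; rewrite le_eqVlt eq_sym.
by have [//|] := eqVneq x 0%R.
Qed.

(** Split the last jump time [r] at [t]. If [r <= t], all jumps precede [t] and the kernel
    factorises, which is the term [m = n]. If [t < r], shifting by [t] and the induction hypothesis
    give the other terms. *)
Lemma chapman_kolmogorov_jumps q a n j (t s : R) : (forall k, 0 <= a k) ->
  (0 <= t)%R -> (0 <= s)%R ->
  jker q a n j (t + s) =
  \sum_(0 <= m < n.+1) jker q (fun k => jker q a m k t) (n - m) j s.
Proof.
move=> a0 t0; elim: n j s => [|n IH] j s s0.
  by rewrite big_nat1 /= expkD// EFinM muleA.
pose b m k := jker q a m k t.
have b0 m k : 0 <= b m k by exact: jker_ge0.
have m1 u : measurable_fun setT (fun s : measurableTypeR R => 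
    flux (jker q a n) j s * (expk (q j) (u - s))%:E).
  by apply: measurable_conv_fix; exact: measurable_flux_jker.
have mle : measurable_fun setT (fun r : measurableTypeR R => ((r <= t)%R%:R : R)%:E).
  apply/measurable_EFinP; apply: measurableT_comp => //.
  exact: measurable_fun_ler.
have mlt : measurable_fun setT (fun r : measurableTypeR R => ((t < r)%R%:R : R)%:E).
  apply/measurable_EFinP; apply: measurableT_comp => //.
  exact: measurable_fun_ltr.
have fx0 u r : 0 <= flux (jker q a n) j r * (expk (q j) (u - r))%:E.
  by rewrite mule_ge0 ?expkE_ge0// flux_jker_ge0.
rewrite jkerS.
transitivity (\int[leb]_r ((flux (jker q a n) j r * (expk (q j) (t - r))%:E) * (expk (q j) s)%:E
   + ((t < r)%R%:R : R)%:E * (flux (jker q a n) j r * (expk (q j) (t + s - r))%:E))).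
  apply: eq_integral => r _; have [rt|tr] := leP r t.
    rewrite mul0e adde0 (_ : (t + s - r = (t - r) + s)%R); last by ring.
    rewrite expkD// ?subr_ge0// EFinM muleA//.
  by rewrite mul1e [in X in X + _]/expk subr_ge0 leNgt tr mule0 mul0e add0e.
rewrite ge0_integralD//; last 4 first.
- by move=> r _; rewrite mule_ge0// expkE_ge0.
- exact: emeasurable_funM.
- by move=> r _; rewrite mule_ge0// lee_fin.
- exact: emeasurable_funM.
rewrite ge0_integralZr ?expkE_ge0// -jkerS.
rewrite [RHS]big_nat_recr//= subnn addeC; congr (_ + _).
transitivity (\int[leb]_r (((0 < r)%R%:R : R)%:E *
    (flux (jker q a n) j (r + t) * (expk (q j) (s - r))%:E))).
  rewrite -[LHS](@integral_shift R _ t).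
  - apply: eq_integral => r _ /=; rewrite ltrDr; congr (_ * (_ * (expk _ _)%:E)).
    by ring.
  - by apply: (emeasurable_funM mlt); exact: m1.
  - by move=> r; rewrite mule_ge0// lee_fin.
rewrite (@integral_gt0_ge0 (fun r => flux (jker q a n) j (r + t) * (expk (q j) (s - r))%:E)); last 2 first.
- apply: measurable_conv_fix; apply: measurableT_comp; last exact: measurable_funD.
  exact: measurable_flux_jker.
- by move=> r; rewrite mule_ge0 ?expkE_ge0// flux_jker_ge0.
transitivity (\int[leb]_r \sum_(0 <= m < n.+1)
    (flux (jker q (b m) (n - m)) j r * (expk (q j) (s - r))%:E)).
  apply: eq_integral => r _; have [r0|r0] := leP 0%R r; last first.
    rewrite mul0e big1// => m _.
    by rewrite flux_jker_lt0// mul0e.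
  rewrite mul1e -ge0_sume_distrl; last by move=> m _; apply: flux_jker_ge0 => k; exact: b0.
  congr (_ * _); rewrite /flux.
  under eq_eseriesr => k _.
    rewrite addrC IH// ge0_sume_distrl; last by move=> m _; apply: jker_ge0 => l; exact: b0.
    over.
  rewrite nneseries_sum_nat//; last first.
    by move=> m k; rewrite mule_ge0 ?lee_fin//; apply: jker_ge0 => l; exact: b0.


rewrite ge0_integral_sum//.
- by apply: eq_big_nat => m /= mn; rewrite subSn// -ltnS.
- by move=> m; apply: measurable_conv_fix; apply: measurable_flux_jker.
- by move=> m r _; rewrite mule_ge0 ?expkE_ge0// flux_jker_ge0.
Qed.

Definition tker q a j t : \bar R := \sum_(n <oo) jker q a n j t.

Lemma tker_ge0 q a j t : (forall k, 0 <= a k) -> 0 <= tker q a j t.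
Proof. by move=> a0; apply: nneseries_ge0T => n; exact: jker_ge0. Qed.

Lemma measurable_tker q a j : (forall k, 0 <= a k) -> measurable_fun setT (tker q a j).
Proof.
move=> a0; apply: measurable_seriesT => [n|n x]; [exact: measurable_jker|exact: jker_ge0].
Qed.

Lemma tker_delta q a j t : (forall k, 0 <= a k) ->
  tker q a j t = \sum_(l <oo) (a l * tker q (delta l) j t).
Proof.
move=> a0; rewrite /tker.
under eq_eseriesr => n _ do rewrite jker_delta//.
rewrite nneseries_interchangeT; last first.
  by move=> n l; rewrite mule_ge0// jker_ge0// => k; exact: delta_ge0.
apply: eq_eseriesr => l _; rewrite nneseriesZle// => n.
by rewrite jker_ge0// => k; exact: delta_ge0.
Qed.

Lemma tker_semigroup q a j (t s : R) : (forall k, 0 <= a k) -> (0 <= t)%R -> (0 <= s)%R ->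
  tker q a j (t + s) = tker q (fun k => tker q a k t) j s.
Proof.
move=> a0 t0 s0; rewrite /tker.
under eq_eseriesr => n _ do rewrite chapman_kolmogorov_jumps//.
rewrite (@nneseries_cauchy R (fun m k => jker q (fun k => jker q a m k t) k j s)); last first.
  by move=> m k; apply: jker_ge0 => l; exact: jker_ge0.
rewrite nneseries_interchangeT; last first.
  by move=> m k; apply: jker_ge0 => l; exact: jker_ge0.
apply: eq_eseriesr => k _; rewrite jker_sum// => m l.
exact: jker_ge0.
Qed.

Lemma chapman_kolmogorov q i j (t s : R) : (0 <= t)%R -> (0 <= s)%R ->
  tker q (delta i) j (t + s) =
  \sum_(l <oo) (tker q (delta i) l t * tker q (delta l) j s).
Proof.
move=> t0 s0; rewrite tker_semigroup//; last by move=> k; exact: delta_ge0.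
rewrite tker_delta// => k; apply: tker_ge0 => l; exact: delta_ge0.
Qed.

(** The weight exp(th t) is multiplicative over the successive holding intervals, so each kernel
    absorbs its share and only the holding rates move. *)
Lemma jker_tilt q (th : R) a n j t : (forall k, 0 <= a k) ->
  (expR (th * t))%:E * jker q a n j t = jker (fun k => q k - th)%R a n j t.
Proof.
move=> a0; elim: n j t => [|n IH] j t.
  by rewrite /= muleCA -EFinM expk_tilt.
rewrite !jkerS -ge0_integralZl ?lee_fin ?expR_ge0//.
- apply: eq_integral => s _.
  rewrite (_ : (expR (th * t))%:E = (expR (th * s))%:E * (expR (th * (t - s)))%:E); last first.
    by rewrite -EFinM -expRD; congr (expR _)%:E; ring.
  rewrite muleACA -EFinM expk_tilt; congr (_ * _).
  rewrite /flux -nneseriesZle ?lee_fin ?expR_ge0//.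
    by apply: eq_eseriesr => k _; rewrite muleA IH.
  by move=> k; rewrite mule_ge0 ?jker_ge0// lee_fin.
- by apply: measurable_conv_fix; exact: measurable_flux_jker.
- by move=> s _; rewrite mule_ge0 ?expkE_ge0// flux_jker_ge0.
Qed.

Lemma tker_tilt q (th : R) a j t : (forall k, 0 <= a k) ->
  (expR (th * t))%:E * tker q a j t = tker (fun k => q k - th)%R a j t.
Proof.
move=> a0; rewrite /tker -nneseriesZle ?lee_fin ?expR_ge0//; last first.
  by move=> n; exact: jker_ge0.
by apply: eq_eseriesr => n _; rewrite jker_tilt.
Qed.

End jump_kernel.

(** * Balance equations for the jump kernels, and comparison with super- and subinvariant vectors *)

Section jump_kernel_bounds.
Local Open Scope ereal_scope.
Variable R : realType.
Notation leb := (@lebesgue_measure R).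

Lemma integral_reflect (f : R -> \bar R) (a : R) :
  measurable_fun setT f -> (forall x, 0 <= f x) ->
  \int[leb]_x f (a - x)%R = \int[leb]_x f x.
Proof.
move=> mf f0.
have mg : measurable_fun setT (fun x : measurableTypeR R => f (a + x)%R).
  by apply: measurableT_comp => //; exact: measurable_funD.
transitivity (\int[leb]_x f (a + x)%R).
  transitivity (\int[pushforward leb (-%R : measurableTypeR R -> measurableTypeR R)]_x f (a + x)%R).
    by rewrite ge0_integral_pushforward.
  by apply: eq_measure_integral => B mB _; exact: lebesgue_measureN.
rewrite -[RHS](@integral_shift R f a)//.
by apply: eq_integral => x _; rewrite addrC.
Qed.

Lemma measurable_le_cst (t : R) :
  measurable_fun setT (fun s : measurableTypeR R => ((s <= t)%R%:R : R)%:E).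
Proof.
apply/measurable_EFinP; apply: measurableT_comp => //.
exact: measurable_fun_ler.
Qed.

Lemma expk_int_reflect (c t : R) : (0 <= t)%R ->
  c%:E * \int[leb]_s ((0 <= s)%R%:R * expk c (t - s))%:E + (expk c t)%:E = 1.
Proof.
move=> t0; rewrite [X in _ * X + _](_ : _ = \int[leb]_s ((s <= t)%R%:R * expk c s)%:E).
  exact: expk_int_itv.
rewrite -[RHS](@integral_reflect _ t).
- by apply: eq_integral => s _; rewrite gerBl.
- apply/measurable_EFinP; apply: measurable_funM; last exact: measurable_expk.
  by apply/measurable_EFinP; exact: measurable_le_cst.
- by move=> x; rewrite lee_fin mulr_ge0// expk_ge0.
Qed.

Variable A : nat -> nat -> R.
Hypothesis A0 : forall i j, (0 <= A i j)%R.
Variable q : nat -> R.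
Hypothesis q0 : forall j, (0 <= q j)%R.

(** Time spent up to [t]: no lower bound is imposed because the kernels vanish at negative times. *)
Definition occup (f : R -> \bar R) t := \int[leb]_s (((s <= t)%R%:R : R)%:E * f s).

Lemma occup_ge0 f t : (forall s, 0 <= f s) -> 0 <= occup f t.
Proof. by move=> f0; apply: integral_ge0 => s _; rewrite mule_ge0// lee_fin. Qed.

Lemma le_occup f g t : (forall s, 0 <= f s) -> measurable_fun setT f -> measurable_fun setT g ->
  (forall s, f s <= g s) -> occup f t <= occup g t.
Proof.
move=> f0 mf mg fg; apply: le_integralT.
- by move=> s; rewrite mule_ge0// lee_fin.
- by apply: emeasurable_funM => //; exact: measurable_le_cst.
- by apply: emeasurable_funM => //; exact: measurable_le_cst.
- by move=> s; rewrite lee_pmul// lee_fin.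
Qed.

Lemma occup_series (w : nat -> \bar R) (f : nat -> R -> \bar R) t :
  (forall k, 0 <= w k) -> (forall k s, 0 <= f k s) -> (forall k, measurable_fun setT (f k)) ->
  occup (fun s => \sum_(k <oo) (w k * f k s)) t = \sum_(k <oo) (w k * occup (f k) t).
Proof.
move=> w0 f0 mf; rewrite /occup.
have m1 k : measurable_fun setT (fun s : measurableTypeR R => ((s <= t)%R%:R : R)%:E * f k s).
  apply: emeasurable_funM; [exact: measurable_le_cst|exact: mf].
transitivity (\int[leb]_s \sum_(k <oo) (w k * (((s <= t)%R%:R : R)%:E * f k s))).
  apply: eq_integral => s _; rewrite -nneseriesZle ?lee_fin//.
    by apply: eq_eseriesr => k _; rewrite muleCA.
  by move=> k; rewrite mule_ge0.
rewrite integral_seriesT.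
- apply: eq_eseriesr => k _; rewrite ge0_integralZl// => s _.
  by rewrite mule_ge0// lee_fin.
- by move=> k; apply: emeasurable_funM => //; exact: m1.
- by move=> k s; rewrite !mule_ge0// lee_fin.
Qed.

Lemma jker0_balance a j t : (forall k, 0 <= a k) -> (0 <= t)%R ->
  jker A q a 0 j t + (q j)%:E * occup (jker A q a 0 j) t = a j.
Proof.
move=> a0 t0; rewrite /occup /=.
have m1 : measurable_fun setT (fun s : measurableTypeR R => ((s <= t)%R%:R * expk (q j) s)%:E).
  apply/measurable_EFinP; apply: measurable_funM; last exact: measurable_expk.
  by apply/measurable_EFinP; exact: measurable_le_cst.
under eq_integral => s _ do rewrite muleCA -EFinM.
rewrite ge0_integralZl//; last first.
  by move=> s _; rewrite lee_fin mulr_ge0// expk_ge0.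
rewrite muleCA -ge0_muleDr ?expkE_ge0//.
  by rewrite addeC expk_int_itv// mule1.
by rewrite mule_ge0 ?lee_fin// integral_ge0// => s _; rewrite lee_fin mulr_ge0// expk_ge0.
Qed.

(** Integrated forward equation, one jump count at a time: present at [t] plus departed by [t]
    equals arrived by [t]. The integrated form needs only Tonelli and [expk_int_shift], no
    differentiability of the kernels. *)
Lemma jkerS_balance a n j t : (forall k, 0 <= a k) ->
  jker A q a n.+1 j t + (q j)%:E * occup (jker A q a n.+1 j) t =
  occup (flux A (jker A q a n) j) t.
Proof.
move=> a0; pose f := flux A (jker A q a n) j.
have f0 s : 0 <= f s by exact: flux_jker_ge0.
have mf : measurable_fun setT f by exact: measurable_flux_jker.
have E : occup (jker A q a n.+1 j) t =
    \int[leb]_r (f r * \int[leb]_s ((s <= t)%R%:R * expk (q j) (s - r))%:E).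
  rewrite /occup.
  transitivity (\int[leb]_s \int[leb]_r
      (((s <= t)%R%:R : R)%:E * (f r * (expk (q j) (s - r))%:E))).
    apply: eq_integral => s _; rewrite jkerS ge0_integralZl ?lee_fin//.
    - exact: measurable_conv_fix.
    - by move=> r _; rewrite mule_ge0 ?expkE_ge0.
  rewrite (@tonelliRR R (fun s r => ((s <= t)%R%:R : R)%:E * (f r * (expk (q j) (s - r))%:E))).
  - apply: eq_integral => r _; rewrite -ge0_integralZl//.
    + by apply: eq_integral => s _; rewrite muleCA -EFinM.
    + apply/measurable_EFinP; apply: measurable_funM.
        by apply/measurable_EFinP; exact: measurable_le_cst.
      apply: measurableT_comp; first exact: measurable_expk.
      exact: measurable_funB.
    + by move=> s _; rewrite lee_fin mulr_ge0// expk_ge0.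
  - apply: emeasurable_funM; first by apply: (measurableT_comp (@measurable_le_cst t)).
    exact: measurable_conv.
  - by move=> s r; rewrite !mule_ge0 ?expkE_ge0// lee_fin.
have mi : measurable_fun setT (fun r : measurableTypeR R =>
    f r * \int[leb]_s ((s <= t)%R%:R * expk (q j) (s - r))%:E).
  apply: emeasurable_funM => //.
  apply: (@measurable_int1 R (fun r s => ((s <= t)%R%:R * expk (q j) (s - r))%:E)).
    apply/measurable_EFinP; apply: measurable_funM.
      by apply: measurableT_comp => //; apply: measurable_fun_ler.
    by apply/measurable_EFinP; exact: measurable_expkB.
  by move=> r s; rewrite lee_fin mulr_ge0// expk_ge0.
have ii0 r : 0 <= \int[leb]_s ((s <= t)%R%:R * expk (q j) (s - r))%:E.
  by apply: integral_ge0 => s _; rewrite lee_fin; apply: mulr_ge0; [exact: ler0n|exact: expk_ge0].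
have i0 r : 0 <= f r * \int[leb]_s ((s <= t)%R%:R * expk (q j) (s - r))%:E.
  by apply: mule_ge0; [exact: f0|exact: ii0].
rewrite jkerS E -/f -ge0_integralZl ?lee_fin// -ge0_integralD//; last 4 first.
- by move=> r _; rewrite mule_ge0 ?expkE_ge0.
- exact: measurable_conv_fix.
- by move=> r _; rewrite mule_ge0 ?lee_fin.
- exact: measurable_funeM.
apply: eq_integral => r _; rewrite muleCA -ge0_muleDr ?expkE_ge0//; last first.
  by apply: mule_ge0; [rewrite lee_fin|exact: ii0].
by rewrite addeC expk_int_shift muleC.
Qed.

(** Let [Bn n] be the outflow of generation [n] weighted by [h]. Superharmonicity bounds the
    weighted arrivals of generation [n.+1] by [Bn n], and [jkerS_balance] splits these arrivals into
    [Mn n.+1] and [Bn n.+1]; the sum of the [Mn] telescopes. *)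
Lemma tker_superharmonic (a : nat -> \bar R) (h : nat -> R) t :
  (forall k, 0 <= a k) -> (forall k, (0 <= h k)%R) -> (0 <= t)%R ->
  (forall j, \sum_(k <oo) (A j k * h k)%:E <= (q j * h j)%:E) ->
  \sum_(j <oo) (tker A q a j t * (h j)%:E) <= \sum_(j <oo) (a j * (h j)%:E).
Proof.
move=> a0 h0 t0 Hh.
pose u n j := jker A q a n j.
have u0 n j s : 0 <= u n j s by exact: jker_ge0.
have mu n j : measurable_fun setT (u n j) by exact: measurable_jker.
pose Mn n := \sum_(j <oo) (u n j t * (h j)%:E).
pose Bn n := \sum_(j <oo) ((q j * h j)%:E * occup (u n j) t).
have Mn0 n : 0 <= Mn n.
  by apply: nneseries_ge0T => j; rewrite mule_ge0 ?lee_fin.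
have Bn0 n : 0 <= Bn n.
  by apply: nneseries_ge0T => j; rewrite mule_ge0 ?occup_ge0// lee_fin mulr_ge0.
have MB n : Mn n + Bn n = \sum_(j <oo) ((u n j t + (q j)%:E * occup (u n j) t) * (h j)%:E).
  rewrite -nneseriesDT.
  - apply: eq_eseriesr => j _; rewrite ge0_muleDl//.
      by congr (_ + _); rewrite EFinM muleAC.
    by rewrite mule_ge0 ?occup_ge0// lee_fin.
  - by move=> j; rewrite mule_ge0 ?lee_fin.
  - by move=> j; rewrite mule_ge0 ?occup_ge0// lee_fin mulr_ge0.
have M00 : Mn 0%N + Bn 0%N = \sum_(j <oo) (a j * (h j)%:E).
  by rewrite MB; apply: eq_eseriesr => j _; rewrite jker0_balance.
have MS n : Mn n.+1 + Bn n.+1 <= Bn n.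
  rewrite MB.
  under eq_eseriesr => j _.
    rewrite jkerS_balance// /flux.
    under eq_fun => s do under eq_eseriesr => k _ do rewrite muleC.
    rewrite occup_series//; last by move=> k; rewrite lee_fin.
    rewrite -nneseriesZre ?lee_fin//; last by move=> k; rewrite mule_ge0 ?occup_ge0// lee_fin.
    over.
  rewrite nneseries_interchangeT; last first.
    by move=> j k; rewrite !mule_ge0 ?occup_ge0 ?lee_fin.
  apply: lee_nneseriesT => k.
    by apply: nneseries_ge0T => j; rewrite !mule_ge0 ?occup_ge0 ?lee_fin.
  under eq_eseriesr => j _ do rewrite muleAC -EFinM.
  rewrite nneseriesZre ?occup_ge0//; last by move=> j; rewrite lee_fin mulr_ge0.
  by rewrite lee_pmul ?occup_ge0// nneseries_ge0T// => j; rewrite lee_fin mulr_ge0.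
(* The outflow of the last generation counted stays on the left, so nothing is subtracted in
   [\bar R]. *)
have part N : \sum_(0 <= n < N) Mn n + Bn N.-1 <= Mn 0%N + Bn 0%N.
  elim: N => [|[|N] IH]; first by rewrite big_nil add0e/= leeDr.
    by rewrite big_nat1.
  rewrite big_nat_recr//= -addeA; apply: le_trans IH => /=.
  by rewrite leeD2l.
rewrite -M00.
have -> : \sum_(j <oo) (tker A q a j t * (h j)%:E) = \sum_(n <oo) Mn n.
  have E j : tker A q a j t * (h j)%:E = \sum_(n <oo) (u n j t * (h j)%:E).
    by rewrite nneseriesZre ?lee_fin// => n; exact: u0.
  rewrite (eq_eseriesr (fun j _ => E j)).
  by rewrite nneseries_interchangeT// => j n; rewrite mule_ge0 ?lee_fin//; exact: u0.
apply: nneseries_le_fin => // N; apply: le_trans (part N).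
by rewrite leeDl.
Qed.

(** Minimality of the jump-count construction: by induction on [N], the mass carried by fewer than
    [N] jumps stays below [m], simultaneously for all states and times. *)
Lemma tker_subinvariant (m : nat -> R) j t :
  (forall k, (0 <= m k)%R) -> (0 <= t)%R ->
  (forall j, \sum_(k <oo) (m k * A k j)%:E <= (q j * m j)%:E) ->
  tker A q (EFin \o m) j t <= (m j)%:E.
Proof.
move=> m0 t0 Hm.
have a0 k : 0 <= (EFin \o m) k by rewrite lee_fin.
pose u n j := jker A q (EFin \o m) n j.
have u0 n k s : 0 <= u n k s by exact: jker_ge0.
have key N : forall k s, \sum_(0 <= n < N) u n k s <= (m k)%:E.
  elim: N => [k s|N IH k s]; first by rewrite big_nil lee_fin.
  have [s0|s0] := ltP s 0%R.
    by rewrite big1 ?lee_fin// => n _; exact: jker_lt0.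
  rewrite big_nat_recl//= -ge0_integral_sum//; last 2 first.
  - by move=> n; apply: measurable_conv_fix; exact: measurable_flux_jker.
  - by move=> n x _; rewrite mule_ge0 ?expkE_ge0// flux_jker_ge0.
  (* By induction and subinvariance the total flux into [k] is at most [q k * m k] at times
     [r >= 0], and it is 0 before. [expk_int_reflect] then evaluates this bound to exactly [m k]. *)
  apply: (@le_trans _ _ ((m k)%:E * (expk (q k) s)%:E +
     \int[leb]_r ((q k * m k)%:E * ((0 <= r)%R%:R * expk (q k) (s - r))%:E))).
    rewrite leeD2l//; apply: le_integralT.
    - move=> r; apply: sume_ge0 => n _.
      by rewrite mule_ge0 ?expkE_ge0// flux_jker_ge0.
    - apply: emeasurable_sum => n.
      by apply: measurable_conv_fix; exact: measurable_flux_jker.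
    - apply: emeasurable_funM => //; apply/measurable_EFinP; apply: measurable_funM.
        by apply: measurableT_comp => //; exact: measurable_fun_ler.
      by apply: measurableT_comp; [exact: measurable_expk|exact: measurable_funB].
    - move=> r; rewrite -ge0_sume_distrl; last by move=> n _; exact: flux_jker_ge0.
      have [r0|r0] := leP 0%R r; last first.
        rewrite big1 ?mul0e ?mul0r ?mule0// => n _; exact: flux_jker_lt0.
      rewrite mul1r lee_pmul ?expkE_ge0//.
        by apply: sume_ge0 => n _; exact: flux_jker_ge0.
      rewrite /flux -nneseries_sum_nat; last by move=> n l; rewrite mule_ge0 ?lee_fin//; exact: u0.
      apply: le_trans (Hm k); apply: lee_nneseriesT => l.
        by apply: sume_ge0 => n _; rewrite mule_ge0 ?lee_fin//; exact: u0.
      rewrite -ge0_sume_distrl; last by move=> n _; exact: u0.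
      by rewrite EFinM lee_pmul ?lee_fin// ?sume_ge0// => n _; exact: u0.
  have mm : measurable_fun setT (fun r : measurableTypeR R =>
      ((0 <= r)%R%:R * expk (q k) (s - r))%:E).
    apply/measurable_EFinP; apply: measurable_funM.
      by apply: measurableT_comp => //; exact: measurable_fun_ler.
    by apply: measurableT_comp; [exact: measurable_expk|exact: measurable_funB].
  rewrite ge0_integralZl//; last 2 first.
  - by move=> r _; rewrite lee_fin mulr_ge0// expk_ge0.
  - by rewrite lee_fin mulr_ge0.
  rewrite mulrC EFinM -muleA -ge0_muleDr ?expkE_ge0//; last first.
    by rewrite mule_ge0 ?lee_fin// integral_ge0// => r _; rewrite lee_fin mulr_ge0// expk_ge0.
  by rewrite addeC expk_int_reflect// mule1.
apply: nneseries_le_fin => [n|N]; [exact: u0|exact: key].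
Qed.

End jump_kernel_bounds.

(** * Convergence of positive recurrent stochastic semigroups *)

Section stochastic_semigroup.
Local Open Scope ereal_scope.
Variable R : realType.
Variables (K : R -> nat -> nat -> R) (pi : nat -> R) (i : nat).
Hypothesis K0 : forall t l j, (0 <= t)%R -> (0 <= K t l j)%R.
Hypothesis K1 : forall t l, (0 <= t)%R -> \sum_(j <oo) (K t l j)%:E = 1.
Hypothesis KD : forall t s l j, (0 <= t)%R -> (0 <= s)%R ->
  (K (t + s) l j)%:E = \sum_(m <oo) (K t l m * K s m j)%:E.
Hypothesis Kpos : forall l, (0 < K 1 l 0%N)%R.
Hypothesis pi0 : forall j, (0 <= pi j)%R.
Hypothesis pi1 : \sum_(j <oo) (pi j)%:E = 1.
Hypothesis piK : forall t j, (0 <= t)%R -> \sum_(l <oo) (pi l * K t l j)%:E = (pi j)%:E.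
Hypothesis pii : (0 < pi i)%R.

(** [w] is the overlap of the law at time t with [pi]; [fp] and [fm] are the positive and negative
    parts of their difference. Going through the minimum keeps every series nonnegative. Both laws
    have mass 1, so [fp] and [fm] have the same mass [excess], half the l^1 distance. *)
Let w t j := Num.min (K t i j) (pi j).
Let fp t j := (K t i j - w t j)%R.
Let fm t j := (pi j - w t j)%R.

Let w0 t j : (0 <= t)%R -> (0 <= w t j)%R.
Proof. by move=> t0; rewrite le_min K0//=. Qed.

Let fp0 t j : (0 <= fp t j)%R.
Proof. by rewrite subr_ge0 ge_min lexx. Qed.

Let fm0 t j : (0 <= fm t j)%R.
Proof. by rewrite subr_ge0 ge_min lexx orbT. Qed.

Definition excess t := \sum_(j <oo) (fp t j)%:E.

Let excess0 t : 0 <= excess t.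
Proof. by apply: nneseries_ge0T => j; rewrite lee_fin. Qed.

Let W1 t : (0 <= t)%R -> \sum_(j <oo) (w t j)%:E + excess t = 1.
Proof.
move=> t0; rewrite -nneseriesDT; [|by move=> j; rewrite lee_fin ?w0..].
by rewrite -(K1 i t0); apply: eq_eseriesr => j _; rewrite -EFinD addrC subrK.
Qed.

Let W2 t : (0 <= t)%R -> \sum_(j <oo) (w t j)%:E + \sum_(j <oo) (fm t j)%:E = 1.
Proof.
move=> t0; rewrite -nneseriesDT; [|by move=> j; rewrite lee_fin ?w0..].
by rewrite -pi1; apply: eq_eseriesr => j _; rewrite -EFinD addrC subrK.
Qed.

Let Wfin t : (0 <= t)%R -> \sum_(j <oo) (w t j)%:E \is a fin_num.
Proof.
move=> t0; rewrite ge0_fin_numE; last by apply: nneseries_ge0T => j; rewrite lee_fin w0.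
by apply: (@le_lt_trans _ _ 1); rewrite ?ltry// -(W1 t0) leeDl.
Qed.

Let excess_fm t : (0 <= t)%R -> \sum_(j <oo) (fm t j)%:E = excess t.
Proof.
move=> t0; have := W2 t0; rewrite -(W1 t0); have := Wfin t0.
set a := \sum_(j <oo) (w t j)%:E => afin E.
by rewrite -[LHS](addeK _ afin) [X in X - a]addeC E [X in X - a]addeC addeK.
Qed.

Let excess_fin t : (0 <= t)%R -> excess t \is a fin_num.
Proof.
move=> t0; rewrite ge0_fin_numE//.
apply: (@le_lt_trans _ _ 1); rewrite ?ltry// -(W1 t0) leeDr//.
by apply: nneseries_ge0T => j; rewrite lee_fin w0.
Qed.

(** One term of the invariance equation. This domination makes the tails of the law at time t small
    uniformly in t. *)
Let K_le_pi t j : (0 <= t)%R -> (K t i j <= pi j / pi i)%R.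
Proof.
move=> t0; rewrite ler_pdivlMr// -lee_fin -(piK j t0) mulrC.
apply: (@nneseries_term _ (fun l => (pi l * K t l j)%:E)) => l.
by rewrite lee_fin mulr_ge0// K0.
Qed.

Let sumfin (f : nat -> R) (c : R) : (forall l, (0 <= f l)%R) ->
  \sum_(l <oo) (f l)%:E <= c%:E -> exists r : R, (0 <= r)%R /\ \sum_(l <oo) (f l)%:E = r%:E.
Proof.
move=> f0 fc; have S0 : 0 <= \sum_(l <oo) (f l)%:E.
  by apply: nneseries_ge0T => l; rewrite lee_fin.
exists (fine (\sum_(l <oo) (f l)%:E)); split; first exact: fine_ge0.
by rewrite fineK// ge0_fin_numE// (le_lt_trans fc)// ltry.
Qed.

(** Push [fp] and [fm] through the kernel to get [F] and [G]. The overlap part contributes equally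
    to both laws, so the new positive part is [F - min(F, G)]; of the total cancellation only the
    share at state 0 is kept. *)
Lemma excess_step t s : (0 <= t)%R -> (0 <= s)%R ->
  excess (t + s) + mine (\sum_(l <oo) (fp t l * K s l 0%N)%:E) (\sum_(l <oo) (fm t l * K s l 0%N)%:E)
  <= excess t.
Proof.
move=> t0 s0.
have [F [F0 FE]] : exists F : nat -> R, (forall j, 0 <= F j)%R /\
    forall j, \sum_(l <oo) (fp t l * K s l j)%:E = (F j)%:E.
  have H j : exists r : R, (0 <= r)%R /\ \sum_(l <oo) (fp t l * K s l j)%:E = r%:E.
    apply: (@sumfin _ (K (t + s) i j)) => [l|]; first by rewrite mulr_ge0// K0.
    rewrite KD//; apply: lee_nneseriesT => l; first by rewrite lee_fin mulr_ge0// K0.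
    by rewrite lee_fin ler_wpM2r ?K0// gerBl w0.
  by have [F HF] := choice H; exists F; split => j; have [] := HF j.
have [G [G0 GE]] : exists F : nat -> R, (forall j, 0 <= F j)%R /\
    forall j, \sum_(l <oo) (fm t l * K s l j)%:E = (F j)%:E.
  have H j : exists r : R, (0 <= r)%R /\ \sum_(l <oo) (fm t l * K s l j)%:E = r%:E.
    apply: (@sumfin _ (pi j)) => [l|]; first by rewrite mulr_ge0// K0.
    rewrite -(piK j s0); apply: lee_nneseriesT => l; first by rewrite lee_fin mulr_ge0// K0.
    by rewrite lee_fin ler_wpM2r ?K0// gerBl w0.
  by have [F' HF] := choice H; exists F'; split => j; have [] := HF j.
have [V [V0 VE]] : exists F : nat -> R, (forall j, 0 <= F j)%R /\
    forall j, \sum_(l <oo) (w t l * K s l j)%:E = (F j)%:E.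
  have H j : exists r : R, (0 <= r)%R /\ \sum_(l <oo) (w t l * K s l j)%:E = r%:E.
    apply: (@sumfin _ (pi j)) => [l|]; first by rewrite mulr_ge0 ?K0 ?w0.
    rewrite -(piK j s0); apply: lee_nneseriesT => l; first by rewrite lee_fin mulr_ge0 ?K0 ?w0.
    by rewrite lee_fin ler_wpM2r ?K0// ge_min lexx orbT.
  by have [F' HF] := choice H; exists F'; split => j; have [] := HF j.
have EK j : (K (t + s) i j = V j + F j)%R.
  apply: EFin_inj; rewrite KD// EFinD -VE -FE -nneseriesDT; last 2 first.
  - by move=> l; rewrite lee_fin mulr_ge0 ?K0 ?w0.
  - by move=> l; rewrite lee_fin mulr_ge0 ?K0.
  by apply: eq_eseriesr => l _; rewrite -EFinD -mulrDl addrC subrK.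
have Epi j : (pi j = V j + G j)%R.
  apply: EFin_inj; rewrite -(piK j s0) EFinD -VE -GE -nneseriesDT; last 2 first.
  - by move=> l; rewrite lee_fin mulr_ge0 ?K0 ?w0.
  - by move=> l; rewrite lee_fin mulr_ge0 ?K0.
  by apply: eq_eseriesr => l _; rewrite -EFinD -mulrDl addrC subrK.
have Efp j : (fp (t + s) j = F j - Num.min (F j) (G j))%R.
  by rewrite /fp /w EK Epi -addr_minr opprD addrACA subrr add0r.
have SF : \sum_(j <oo) (F j)%:E = excess t.
  under eq_eseriesr => j _ do rewrite -FE.
  rewrite nneseries_interchangeT; last by move=> j l; rewrite lee_fin mulr_ge0 ?K0.
  apply: eq_eseriesr => l _; under eq_eseriesr => j _ do rewrite EFinM.
  by rewrite nneseriesZle ?lee_fin ?fp0// ?K1 ?mule1// => j; rewrite lee_fin K0.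
rewrite FE GE -SF -EFin_min.
have E (j : nat) : (F j)%:E = (fp (t + s) j)%:E + (Num.min (F j) (G j))%:E.
  by rewrite -EFinD Efp subrK.
rewrite (eq_eseriesr (fun j _ => E j)) nneseriesDT.
- rewrite leeD2l//; apply: (@nneseries_term _ (fun j => (Num.min (F j) (G j))%:E) 0%N) => j.
  by rewrite lee_fin le_min F0 G0.
- by move=> j; rewrite lee_fin.
- by move=> j; rewrite lee_fin le_min F0 G0.
Qed.

Lemma excess_nonincreasing t s : (0 <= t)%R -> (0 <= s)%R -> excess (t + s) <= excess t.
Proof.
move=> t0 s0; apply: le_trans (excess_step t0 s0); apply: leeDl.
by rewrite le_min; apply/andP; split; apply: nneseries_ge0T => l; rewrite lee_fin mulr_ge0 ?K0.
Qed.

Let minK N : exists2 d : R, (0 < d)%R & forall l, (l < N)%N -> (d <= K 1 l 0%N)%R.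
Proof.
elim: N => [|N [d d0 dN]]; first by exists 1%R.
exists (Num.min d (K 1 N 0%N)); first by rewrite lt_min d0 Kpos.
move=> l; rewrite ltnS leq_eqVlt => /predU1P[->|/dN]; first by rewrite ge_min lexx orbT.
by rewrite ge_min => ->.
Qed.

(** Below [N] at least the fraction [d] of the mass reaches 0 in unit time; mass beyond [N] may
    never do so, at a cost of at most [d * c]. *)
Let lower (f : nat -> R) N (d c : R) : (0 < d)%R ->
  (forall l, (l < N)%N -> (d <= K 1 l 0%N)%R) ->
  (forall l, (0 <= f l)%R) ->
  \sum_(N <= l <oo) (f l)%:E <= c%:E ->
  d%:E * (\sum_(l <oo) (f l)%:E) <= \sum_(l <oo) (f l * K 1 l 0%N)%:E + (d * c)%:E.
Proof.
move=> d0 dN f0 fc.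
have S0 : 0 <= \sum_(N <= l <oo) (f l)%:E.
  by apply: nneseries_ge0 => l _ _; rewrite lee_fin.
rewrite (@nneseries_split _ (fun l => (f l)%:E) 0%N N); last by move=> l _; rewrite lee_fin.
rewrite add0n ge0_muleDr//; last by apply: sume_ge0 => l _; rewrite lee_fin.
apply: leeD; last by rewrite EFinM lee_pmul// lee_fin ltW.
rewrite [leRHS](@nneseries_split _ (fun l => (f l * K 1 l 0%N)%:E) 0%N N); last first.
  by move=> l _; rewrite lee_fin mulr_ge0// K0.
rewrite add0n; apply: (@le_trans _ _ (\sum_(0 <= l < N) (f l * K 1 l 0%N)%:E)); last first.
  by apply: leeDl; apply: nneseries_ge0 => l _ _; rewrite lee_fin mulr_ge0// K0.
rewrite !sumEFin -EFinM lee_fin mulr_sumr !big_nat.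
by apply: ler_sum => l /andP[_ lN]; rewrite mulrC ler_wpM2l// dN.
Qed.

(** With [c = e / 2], a unit of time lowers the excess by at least [d * (excess - c)], hence by
    [d * c] as long as it exceeds [e]. It therefore drops to [e] or below at some integer time and
    stays there by monotonicity. *)
Lemma excess_cvg0 (e : R) : (0 < e)%R ->
  exists2 t0 : R, (0 <= t0)%R & forall t, (t0 <= t)%R -> excess t <= e%:E.
Proof.
move=> e0.
(* [C * pi] dominates both [fm], with factor 1, and [fp], with factor [(pi i)^-1] by [K_le_pi]. *)
pose C := (Num.max 1 (pi i)^-1)%R.
have C1 : (1 <= C)%R by rewrite le_max lexx.
have C0 : (0 < C)%R by rewrite (lt_le_trans _ C1).
pose c := (e / 2)%R.
have c0 : (0 < c)%R by rewrite divr_gt0.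
have [N HN] : exists N, \sum_(N <= l <oo) (pi l)%:E <= (c / C)%:E.
  have H : \sum_(0 <= k <oo | xpredT k) (pi k)%:E < +oo by rewrite pi1 ltry.
  have := nneseries_tail_cvg H (fun k _ => pi0 k : 0 <= (pi k)%:E).
  move/fine_cvgP => [finN /cvgrPdist_le /(_ (c / C)%R)].
  rewrite divr_gt0// => /(_ isT) cN.
  near \oo => N; exists N.
  have fN : \sum_(N <= l <oo) (pi l)%:E \is a fin_num by near: N.
  have : (`|0 - fine (\sum_(N <= l <oo) (pi l)%:E)| <= c / C)%R by near: N.
  rewrite sub0r normrN ger0_norm -?lee_fin ?fineK//.
  by apply: nneseries_ge0 => l _ _; rewrite lee_fin.
have tail : \sum_(N <= l <oo) (C * pi l)%:E <= c%:E.
  under eq_eseriesr => l _ do rewrite EFinM.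
  rewrite nneseriesZl; last by move=> l _; rewrite lee_fin.
  rewrite -[leRHS](_ : C%:E * (c / C)%:E = _); last by rewrite -EFinM mulrCA divff ?mulr1// gt_eqF.
  rewrite lee_pmul//; first by rewrite lee_fin ltW.
  by apply: nneseries_ge0 => l _ _; rewrite lee_fin.
have [d d0 dN] := minK N.
have step t : (0 <= t)%R -> excess (t + 1) + d%:E * excess t <= excess t + (d * c)%:E.
  move=> t0; have := excess_step t0 ler01; set a := \sum_(l <oo) _; set b := \sum_(l <oo) _ => ab.
  apply: (@le_trans _ _ (excess (t + 1) + (mine a b + (d * c)%:E))); last first.
    by rewrite addeA leeD2r.
  rewrite leeD2l//; rewrite /mine; case: ifP => _.
    apply: (lower d0 dN (fp0 t)); apply: (le_trans _ tail).
    apply: lee_nneseries => l *; rewrite lee_fin ?fp0//.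
    apply: (@le_trans _ _ (K t i l)); first by rewrite gerBl w0.
    by apply: le_trans (K_le_pi _ t0) _; rewrite mulrC ler_wpM2r// le_max lexx orbT.
  rewrite -excess_fm//; apply: (lower d0 dN (fm0 t)); apply: (le_trans _ tail).
  apply: lee_nneseries => l *; rewrite lee_fin ?fm0//.
  apply: (@le_trans _ _ (pi l)); first by rewrite gerBl w0.
  by rewrite ler_peMl.
pose x n := fine (excess n%:R).
have xE n : excess n%:R = (x n)%:E by rewrite fineK// excess_fin.
have [n xn] : exists n, (x n <= e)%R.
  apply: contrapT => /forallNP nx.
  have dec n : (x n <= x 0%N - n%:R * (d * c))%R.
    elim: n => [|n IH]; first by rewrite mul0r subr0.
    have := step n%:R (ler0n _ n); rewrite natr1 !xE -!EFinM -!EFinD lee_fin => H.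
    have /negP := nx n; rewrite -ltNge => xe.
    have dxe : (d * (2 * c) <= d * x n)%R.
      by rewrite ler_wpM2l ?(ltW d0)// /c mulrC divfK// ltW.
    rewrite -natr1; lra.
  (* After this many steps of size [d * c] the excess would be negative. *)
  pose n := (Num.truncn (x 0%N / (d * c))).+1.
  have := dec n; have : (0 <= x n)%R by apply: fine_ge0.
  have dc : (0 < d * c)%R by rewrite mulr_gt0.
  have : (x 0%N < n%:R * (d * c))%R by rewrite -ltr_pdivrMr// truncnS_gt.
  lra.
exists n%:R => // t nt.
rewrite -(subrK n%:R t) addrC; apply: (le_trans (excess_nonincreasing _ _)) => //.
  by rewrite subr_ge0.
by rewrite xE lee_fin.
Unshelve. all: by end_near. Qed.

Lemma stochastic_semigroup_cvg (g : nat -> R) (G e : R) : (0 < e)%R ->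
  (forall j, 0 <= g j <= G)%R ->
  exists2 t0 : R, (0 <= t0)%R & forall t, (t0 <= t)%R ->
   \sum_(j <oo) (K t i j * g j)%:E <= \sum_(j <oo) (pi j * g j)%:E + e%:E /\
   \sum_(j <oo) (pi j * g j)%:E <= \sum_(j <oo) (K t i j * g j)%:E + e%:E.
Proof.
move=> e0 gG.
have G0 : (0 <= G)%R by have /andP[/le_trans] := gG 0%N; apply.
have [t0 t00 H] := excess_cvg0 (divr_gt0 e0 (ltr_wpDr G0 ltr01)).
exists t0 => // t tt0; have tge0 : (0 <= t)%R by exact: le_trans tt0.
have bound (a b f : nat -> R) : (forall j, 0 <= a j)%R -> (forall j, 0 <= b j)%R ->
    (forall j, 0 <= f j)%R -> (forall j, a j <= b j + f j)%R ->
    \sum_(j <oo) (f j)%:E <= (e / (1 + G))%:E ->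
    \sum_(j <oo) (a j * g j)%:E <= \sum_(j <oo) (b j * g j)%:E + e%:E.
  move=> a0 b0 f0 abf fe.
  have g0 j : (0 <= g j)%R by have /andP[] := gG j.
  apply: (@le_trans _ _ (\sum_(j <oo) ((b j * g j)%:E + (G * f j)%:E))).
    apply: lee_nneseriesT => j; first by rewrite lee_fin mulr_ge0.
    rewrite -EFinD lee_fin; apply: (@le_trans _ _ ((b j + f j) * g j)%R).
      by rewrite ler_wpM2r.
    by rewrite mulrDl lerD2l mulrC ler_wpM2r//; have /andP[] := gG j.
  rewrite nneseriesDT; last 2 first.
  - by move=> j; rewrite lee_fin mulr_ge0.
  - by move=> j; rewrite lee_fin mulr_ge0.
  rewrite leeD2l//; under eq_eseriesr => j _ do rewrite EFinM.
  rewrite nneseriesZle ?lee_fin//.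
  apply: (@le_trans _ _ (G%:E * (e / (1 + G))%:E)).
    by rewrite lee_pmul ?lee_fin// nneseries_ge0T// => j; rewrite lee_fin.
  rewrite -EFinM lee_fin mulrCA ler_piMr ?(ltW e0)// ler_pdivrMr ?mul1r ?lerDr//.
  by rewrite ltr_wpDr.
have HE := H t tt0.
split; last first.
  apply: (bound _ _ (fm t)) => //; rewrite ?excess_fm//; first by move=> j; exact: K0.
  by move=> j; rewrite /fm addrCA lerDl subr_ge0 /w ge_min lexx.
apply: (bound _ _ (fp t)) => //; first by move=> j; exact: K0.
by move=> j; rewrite /fp addrCA lerDl subr_ge0 /w ge_min lexx orbT.
Qed.

End stochastic_semigroup.

(** * Green function of the chain tabooed at 0 *)

Section taboo_green.
Local Open Scope ereal_scope.
Variable R : realType.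
Notation leb := (@lebesgue_measure R).
Variable A : nat -> nat -> R.
Hypothesis A0 : forall i j, (0 <= A i j)%R.
Variable q : nat -> R.
Hypothesis irr : forall i (P : nat -> Prop), P i ->
  (forall k j, P k -> (0 < A k j)%R -> P j) -> forall j, P j.

(** Entries into 0 are deleted and exits from 0 kept: row 0 serves as the unnormalised entrance law
    of an excursion, which is lost on its return to 0. *)
Definition taboo (i j : nat) : R := if j == 0%N then 0%R else A i j.

Lemma taboo_ge0 i j : (0 <= taboo i j)%R.
Proof. by rewrite /taboo; case: ifP. Qed.

Section fixed_tilt.
Variable th : R.
Let c j := (q j - th)%R.

Definition green n j := \int[leb]_t jker taboo c (EFin \o taboo 0%N) n j t.

Let a0 k : 0 <= (EFin \o taboo 0%N) k.
Proof. by rewrite lee_fin taboo_ge0. Qed.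

Let ee j := \int[leb]_s (expk (c j) s)%:E.

Let ee_gt0 j : 0 < ee j.
Proof.
rewrite /ee; have [c0|c0] := ltP 0%R (c j).
  by rewrite expk_int_pos// lte_fin invr_gt0.
by rewrite expk_int_neg.
Qed.

Lemma green_ge0 n j : 0 <= green n j.
Proof. by apply: integral_ge0 => t _; apply: jker_ge0 => //; exact: taboo_ge0. Qed.

Lemma green0 j : green 0 j = (taboo 0 j)%:E * ee j.
Proof.
rewrite /green /= ge0_integralZl//.
- by apply/measurable_EFinP; exact: measurable_expk.
- by move=> s _; exact: expkE_ge0.
- by rewrite lee_fin taboo_ge0.
Qed.

(** Integrating a convolution over all times factorises it, so time disappears and a matrix
    recursion over the jump count remains. The factor [ee j] is [+oo] when the tilted rate is not
    positive. *)
Lemma greenS n j : green n.+1 j = (\sum_(k <oo) (green n k * (taboo k j)%:E)) * ee j.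
Proof.
pose f := flux taboo (jker taboo c (EFin \o taboo 0%N) n) j.
have mf : measurable_fun setT f by apply: measurable_flux_jker => //; exact: taboo_ge0.
have f0 s : 0 <= f s by apply: flux_jker_ge0 => //; exact: taboo_ge0.
rewrite /green; under eq_integral => t _ do rewrite jkerS.
rewrite (@tonelliRR R (fun t s => f s * (expk (c j) (t - s))%:E)); last 2 first.
- exact: measurable_conv.
- by move=> t s; rewrite mule_ge0 ?expkE_ge0.
have mk : measurable_fun setT (fun x : measurableTypeR R => (expk (c j) x)%:E).
  by apply/measurable_EFinP; exact: measurable_expk.
transitivity (\int[leb]_s (f s * ee j)).
  apply: eq_integral => s _; rewrite ge0_integralZl; [|exact: measurableT| | |exact: f0].
  - rewrite /ee -(@integral_shift R _ (- s)%R mk)// => x; exact: expkE_ge0.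
  - by apply: measurableT_comp mk _; exact: measurable_funB.
  - by move=> x _; exact: expkE_ge0.
rewrite ge0_integralZr ?(ltW (ee_gt0 j))//; congr (_ * _).
rewrite /f /flux integral_seriesT.
- apply: eq_eseriesr => k _; rewrite ge0_integralZr ?lee_fin ?taboo_ge0//.
    by apply: measurable_jker => //; exact: taboo_ge0.
  by move=> x _; apply: jker_ge0 => //; exact: taboo_ge0.
- move=> k; apply: emeasurable_funM => //.
  by apply: measurable_jker => //; exact: taboo_ge0.
- by move=> k x; rewrite mule_ge0 ?lee_fin ?taboo_ge0//; apply: jker_ge0 => //; exact: taboo_ge0.
Qed.

Lemma green_at0 n : green n 0 = 0.
Proof.
case: n => [|n]; first by rewrite green0 /taboo mul0e.
by rewrite greenS eseries0 ?mul0e// => k _ _; rewrite /taboo mule0.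
Qed.

Definition gsum j := \sum_(n <oo) green n j.

Lemma gsum_ge0 j : 0 <= gsum j.
Proof. by apply: nneseries_ge0T => n; exact: green_ge0. Qed.

Lemma gsumE j : gsum j = ((taboo 0 j)%:E + \sum_(k <oo) (gsum k * (taboo k j)%:E)) * ee j.
Proof.
rewrite /gsum nneseries_recl0; last by move=> n; exact: green_ge0.
rewrite green0 ge0_muleDl ?lee_fin ?taboo_ge0//; last first.
  apply: nneseries_ge0T => k; rewrite mule_ge0 ?lee_fin ?taboo_ge0//; exact: gsum_ge0.
congr (_ + _); under eq_eseriesr => n _ do rewrite greenS.
rewrite nneseriesZre ?(ltW (ee_gt0 j))//; last first.
  by move=> n; apply: nneseries_ge0T => k; rewrite mule_ge0 ?lee_fin ?taboo_ge0// green_ge0.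
congr (_ * _); rewrite nneseries_interchangeT; last first.
  by move=> n k; rewrite mule_ge0 ?lee_fin ?taboo_ge0// green_ge0.
apply: eq_eseriesr => k _; rewrite nneseriesZre ?lee_fin ?taboo_ge0// => n.
exact: green_ge0.
Qed.

(** Positivity spreads along positive rates. State 0 carries no Green mass, so the induction runs on
    the alternative [j = 0] or positive; a step out of 0 uses the entrance row. *)
Lemma gsum_gt0 j : (0 < j)%N -> 0 < gsum j.
Proof.
have : j = 0%N \/ 0 < gsum j; last by case=> // ->.
apply: (@irr 0%N (fun j => j = 0%N \/ 0 < gsum j)); first by left.
move=> k l Pk Akl; case: (posnP l) => [->|l0]; first by left.
right; have tkl : taboo k l = A k l by rewrite /taboo gtn_eqF.
rewrite gsumE mule_gt0//; case: Pk => [k0|gk].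
  apply: lt_le_trans (leeDl _ _); first by rewrite -k0 lte_fin tkl.
  by apply: nneseries_ge0T => i; rewrite mule_ge0 ?lee_fin ?taboo_ge0// gsum_ge0.
apply: lt_le_trans (leeDr _ _); last by rewrite lee_fin taboo_ge0.
apply: (@lt_le_trans _ _ (gsum k * (taboo k l)%:E)); first by rewrite mule_gt0// lte_fin tkl.
apply: (@nneseries_term _ (fun k => gsum k * (taboo k l)%:E)) => i.
by rewrite mule_ge0 ?lee_fin ?taboo_ge0// gsum_ge0.
Qed.

Definition green_return := \sum_(n <oo) \sum_(j <oo) (green n j * (A j 0)%:E).

Lemma green_returnE : green_return = \sum_(j <oo) (gsum j * (A j 0)%:E).
Proof.
rewrite /green_return nneseries_interchangeT; last first.
  by move=> n j; rewrite mule_ge0 ?green_ge0// lee_fin.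
apply: eq_eseriesr => j _; rewrite nneseriesZre ?lee_fin// => n.
exact: green_ge0.
Qed.

Hypothesis return_fin : green_return < +oo.

(** An infinite value would spread forward along positive rates. Irreducibility makes such a chain
    of states enter 0, and the state it enters from would make [green_return] infinite. *)
Lemma gsum_fin j : gsum j < +oo.
Proof.
have [->|j0] := posnP j.
  by rewrite /gsum eseries0 ?ltry// => n _ _; exact: green_at0.
move: j0; apply: contraPP => jfin.
have Nall : forall j, (0 < j)%N /\ ~ gsum j < +oo -> forall i, (0 < i)%N /\ ~ gsum i < +oo.
  move=> {jfin}j jfin; apply: (@irr j (fun j => (0 < j)%N /\ ~ gsum j < +oo)) => // k l [k0 kfin] Akl.
  case: (posnP l) => [l0|l0].
    exfalso; apply: kfin; move: return_fin; rewrite green_returnE => fin.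
    apply: (@mule_ge0_eq_pinfty _ (A k 0%N)%:E); rewrite ?lte_fin -?l0//; first exact: gsum_ge0.
    apply: le_lt_trans fin; rewrite muleC l0.
    apply: (@nneseries_term _ (fun j => gsum j * (A j 0)%:E)) => i.
    by rewrite mule_ge0 ?gsum_ge0// lee_fin.
  split=> //; apply: contra_not kfin => lfin.
  have tkl : taboo k l = A k l by rewrite /taboo gtn_eqF.
  apply: (@mule_ge0_eq_pinfty _ ((A k l)%:E * ee l)); rewrite ?gsum_ge0//.
    by rewrite mule_gt0 ?lte_fin.
  apply: le_lt_trans lfin; rewrite [leRHS]gsumE muleC muleA -tkl.
  rewrite lee_pmul ?(ltW (ee_gt0 l))//.
    by rewrite mule_ge0 ?gsum_ge0// lee_fin taboo_ge0.
  apply: le_trans (leeDr _ _); last by rewrite lee_fin taboo_ge0.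
  apply: (@nneseries_term _ (fun k => gsum k * (taboo k l)%:E)) => i.
  by rewrite mule_ge0 ?lee_fin ?taboo_ge0// gsum_ge0.
move=> j0; by have [] := Nall j (conj j0 jfin) 0%N.
Qed.

(** Otherwise the holding factor is [+oo], and [gsum j] would be 0 or infinite, against [gsum_gt0]
    and [gsum_fin]. *)
Lemma tilt_gt0 j : (0 < j)%N -> (0 < c j)%R.
Proof.
move=> j0; rewrite ltNge; apply/negP => cj.
have := gsum_fin j; have := gsum_gt0 j0; rewrite gsumE /ee expk_int_neg//.
set x := (_ + _); have [x0|x0|<-] := ltgtP 0 x; last by rewrite mul0e ltxx.
  by rewrite gt0_muley// ltxx.
by rewrite lt0_muley.
Qed.

Lemma eeE j : (0 < j)%N -> ee j = ((c j)^-1)%:E.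
Proof. by move=> j0; rewrite /ee expk_int_pos// tilt_gt0. Qed.

Let cVK j : (0 < j)%N -> (c j)%:E * ((c j)^-1)%:E = 1.
Proof. by move=> j0; rewrite -EFinM mulfV// lt0r_neq0// tilt_gt0. Qed.

Lemma green0_bal j : (c j)%:E * green 0 j = (taboo 0 j)%:E.
Proof.
have [->|j0] := posnP j; first by rewrite green_at0 mule0 /taboo.
by rewrite green0 eeE// muleCA cVK// mule1.
Qed.

Lemma greenS_bal n j : (c j)%:E * green n.+1 j = \sum_(k <oo) (green n k * (taboo k j)%:E).
Proof.
have [->|j0] := posnP j.
  by rewrite green_at0 mule0 eseries0// => k _ _; rewrite /taboo mule0.
by rewrite greenS eeE// muleCA cVK// mule1.
Qed.

Lemma gsum_bal j : (c j)%:E * gsum j = (taboo 0 j)%:E + \sum_(k <oo) (gsum k * (taboo k j)%:E).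
Proof.
have [->|j0] := posnP j.
  rewrite [gsum 0]/gsum eseries0 => [|n _ _]; last exact: green_at0.
  by rewrite mule0 [taboo 0 0]/taboo add0e eseries0// => k _ _; rewrite /taboo mule0.
by rewrite {1}gsumE eeE// muleCA cVK// mule1.
Qed.

(** A Dynkin inequality: [e n] is the outflow of generation [n] weighted by [f], and each generation
    yields at least its share of the surplus [g] on top of the next outflow. Hence all surpluses
    together are at most [e 0]. *)
Lemma superharmonic_green (f g : nat -> \bar R) :
  (forall j, 0 <= f j) -> (forall j, 0 <= g j) ->
  (forall j, (0 < j)%N -> \sum_(k <oo) ((taboo j k)%:E * f k) + g j <= (c j)%:E * f j) ->
  \sum_(n <oo) \sum_(j <oo) (green n j * g j) <= \sum_(j <oo) ((taboo 0 j)%:E * f j).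
Proof.
move=> f0 g0 H.
pose e n := \sum_(j <oo) ((c j)%:E * green n j * f j).
have cg0 n j : 0 <= (c j)%:E * green n j.
  have [->|j0] := posnP j; first by rewrite green_at0 mule0.
  by rewrite mule_ge0 ?green_ge0// lee_fin ltW// tilt_gt0.
have e0 n : 0 <= e n by apply: nneseries_ge0T => j; rewrite mule_ge0.
have gg0 n : 0 <= \sum_(j <oo) (green n j * g j).
  by apply: nneseries_ge0T => j; rewrite mule_ge0// green_ge0.
have E0 : e 0%N = \sum_(j <oo) ((taboo 0 j)%:E * f j).
  by apply: eq_eseriesr => j _; rewrite green0_bal.
have ES n : \sum_(j <oo) (green n j * g j) + e n.+1 <= e n.
  have -> : e n.+1 = \sum_(k <oo) (green n k * \sum_(j <oo) ((taboo k j)%:E * f j)).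
    transitivity (\sum_(j <oo) \sum_(k <oo) (green n k * ((taboo k j)%:E * f j))).
      apply: eq_eseriesr => j _; rewrite greenS_bal -nneseriesZre//.
        by apply: eq_eseriesr => k _; rewrite muleA.
      by move=> k; rewrite mule_ge0 ?green_ge0// lee_fin taboo_ge0.
    rewrite nneseries_interchangeT; last first.
      by move=> j k; rewrite !mule_ge0 ?green_ge0// lee_fin taboo_ge0.
    apply: eq_eseriesr => k _; rewrite nneseriesZle ?green_ge0// => j.
    by rewrite mule_ge0// lee_fin taboo_ge0.
  have s0 k : 0 <= \sum_(j <oo) ((taboo k j)%:E * f j).
    by apply: nneseries_ge0T => j; rewrite mule_ge0// lee_fin taboo_ge0.
  rewrite -nneseriesDT; last 2 first.
  - by move=> j; rewrite mule_ge0// green_ge0.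
  - by move=> j; rewrite mule_ge0// green_ge0.
  apply: lee_nneseriesT => j.
    by rewrite adde_ge0// mule_ge0// green_ge0.
  rewrite -ge0_muleDr// addeC (muleC (c j)%:E) -muleA.
  have [->|j0] := posnP j; first by rewrite green_at0 !mul0e.
  by rewrite lee_pmul ?green_ge0 ?adde_ge0// H.
rewrite -E0; apply: nneseries_le_fin => // N.
suff : \sum_(0 <= n < N) (\sum_(j <oo) (green n j * g j)) + e N <= e 0%N.
  by apply: le_trans; rewrite leeDl.
elim: N => [|N IH]; first by rewrite big_nil add0e.
by rewrite big_nat_recr//= -addeA; apply: le_trans IH; rewrite leeD2l// ES.
Qed.

(** Contribution to the exponential moment of the hitting time of 0 from paths with [l] intermediate
    states: each visit costs [(c i)^-1] and each jump its rate. It is meaningful for [i > 0] only,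
    where the tilted rate is positive. *)
Fixpoint hitl l i : \bar R := ((c i)^-1)%:E *
  (if l is l'.+1 then \sum_(k <oo) ((taboo i k)%:E * hitl l' k) else (A i 0)%:E).

Let ci_ge0 i : (0 < i)%N -> 0 <= ((c i)^-1)%:E :> \bar R.
Proof. by move=> i0; rewrite lee_fin invr_ge0 ltW// tilt_gt0. Qed.

Let thitl i k l : ((0 < k)%N -> 0 <= hitl l k) -> 0 <= (taboo i k)%:E * hitl l k.
Proof.
case: (posnP k) => [->|k0 H]; first by rewrite /taboo mul0e.
by rewrite mule_ge0 ?H// lee_fin taboo_ge0.
Qed.

Lemma hitl_ge0 l i : (0 < i)%N -> 0 <= hitl l i.
Proof.
elim: l i => [|l IH] i i0 /=; first by rewrite mule_ge0 ?ci_ge0// lee_fin.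
by rewrite mule_ge0 ?ci_ge0//; apply: nneseries_ge0T => k; apply: thitl; exact: IH.
Qed.

Let thitl0 i k l : 0 <= (taboo i k)%:E * hitl l k.
Proof. by apply: thitl; exact: hitl_ge0. Qed.

Definition hit i := if i == 0%N then 1 else \sum_(l <oo) hitl l i.

Lemma hit_ge0 i : 0 <= hit i.
Proof.
by rewrite /hit; case: ifPn => //; rewrite -lt0n => i0; apply: nneseries_ge0T => l; exact: hitl_ge0.
Qed.

Lemma taboo_hit i k : (taboo i k)%:E * hit k = \sum_(l <oo) ((taboo i k)%:E * hitl l k).
Proof.
rewrite /hit; case: (posnP k) => [->|k0].
  by rewrite /taboo mul0e eseries0// => l _ _; rewrite mul0e.
by rewrite ?gtn_eqF// nneseriesZle// ?lee_fin ?taboo_ge0// => l; exact: hitl_ge0.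
Qed.

Lemma hit_bal i : (0 < i)%N ->
  (c i)%:E * hit i = (A i 0)%:E + \sum_(k <oo) ((taboo i k)%:E * hit k).
Proof.
move=> i0; rewrite [hit i]/hit gtn_eqF// nneseries_recl0; last by move=> l; exact: hitl_ge0.
rewrite ge0_muleDr; last 2 first.
- exact: hitl_ge0.
- by apply: nneseries_ge0T => l; exact: hitl_ge0.
congr (_ + _); first by rewrite /= muleA cVK// mul1e.
rewrite -nneseriesZle; last 2 first.
- by rewrite lee_fin ltW// tilt_gt0.
- by move=> l; exact: hitl_ge0.
under eq_eseriesr => l _ do rewrite /= muleA cVK// mul1e.
rewrite nneseries_interchangeT; last by move=> l k; exact: thitl0.
by apply: eq_eseriesr => k _; rewrite taboo_hit.
Qed.

Let cgh n l j : 0 <= (c j)%:E * green n j * hitl l j.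
Proof.
have [->|j0] := posnP j; first by rewrite green_at0 mule0 mul0e.
by rewrite !mule_ge0 ?green_ge0 ?hitl_ge0// lee_fin ltW// tilt_gt0.
Qed.

(** Cut an excursion path at an intermediate state: its weight depends only on the total number of
    jumps. Induction moves one jump at a time from the [hitl] side to the [green] side. *)
Lemma green_hitl n l : \sum_(j <oo) ((c j)%:E * green n j * hitl l j) =
  \sum_(j <oo) (green (n + l)%N j * (A j 0)%:E).
Proof.
elim: l n => [|l IH] n.
  rewrite addn0; apply: eq_eseriesr => j _ /=.
  have [->|j0] := posnP j; first by rewrite green_at0 mule0 !mul0e.
  by rewrite muleACA cVK// mul1e.
rewrite addnS -addSn -IH.
transitivity (\sum_(j <oo) \sum_(k <oo) (green n j * ((taboo j k)%:E * hitl l k))).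
  apply: eq_eseriesr => j _ /=.
  rewrite nneseriesZle ?green_ge0//.
  have [->|j0] := posnP j; first by rewrite green_at0 mule0 !mul0e.
  by rewrite muleACA cVK// mul1e.
rewrite nneseries_interchangeT; last by move=> j k; rewrite mule_ge0 ?green_ge0// thitl0.
apply: eq_eseriesr => k _; rewrite greenS_bal.
have [->|k0] := posnP k.
  rewrite eseries0; last by move=> j _ _; rewrite /taboo mul0e mule0.
  by rewrite eseries0 ?mul0e// => j _ _; rewrite /taboo mule0.
rewrite -nneseriesZre ?hitl_ge0//; last first.
  by move=> j; rewrite mule_ge0 ?green_ge0// lee_fin taboo_ge0.
by apply: eq_eseriesr => j _; rewrite muleA.
Qed.

(** The sum is a tail of the convergent series [green_return]. At [n = 0] it gives the balance of
    [hit] at 0, for every [n] the finiteness of [hit], and as [n] grows a vanishing boundary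
    term. *)
Lemma green_hit n : \sum_(j <oo) ((c j)%:E * green n j * hit j) =
  \sum_(n <= l <oo) \sum_(j <oo) (green l j * (A j 0)%:E).
Proof.
rewrite -[RHS]nneseries_addn; last first.
  by move=> l; apply: nneseries_ge0T => j; rewrite mule_ge0 ?green_ge0// lee_fin.
under [RHS]eq_eseriesr => l _ do rewrite addnC -green_hitl.
rewrite nneseries_interchangeT//; apply: eq_eseriesr => j _.
have [->|j0] := posnP j.
  by rewrite green_at0 mule0 mul0e eseries0// => l _ _; rewrite mul0e.
rewrite nneseriesZle.
- by rewrite /hit gtn_eqF.
- by rewrite mule_ge0 ?green_ge0// lee_fin ltW// tilt_gt0.
- by move=> l; exact: hitl_ge0.
Qed.

Lemma taboo0_hit : \sum_(j <oo) ((taboo 0 j)%:E * hit j) = green_return.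
Proof.
rewrite /green_return -green_hit; apply: eq_eseriesr => j _.
by rewrite green0_bal.
Qed.

(** Some generation [n] charges [i]; then a positive multiple of [hit i] is one term of a tail of
    [green_return]. *)
Lemma hit_fin i : hit i < +oo.
Proof.
have [->|i0] := posnP i; first by rewrite /hit ltry.
have [n gn] : exists n, 0 < green n i.
  apply: contrapT => /forallNP nf; have := gsum_gt0 i0.
  rewrite /gsum eseries0 ?ltxx// => n _ _; apply/eqP.
  by rewrite eq_le green_ge0 andbT leNgt; exact/negP/nf.
apply: (@mule_ge0_eq_pinfty _ ((c i)%:E * green n i)).
- by rewrite mule_gt0// lte_fin tilt_gt0.
- exact: hit_ge0.
apply: (@le_lt_trans _ _ (\sum_(j <oo) ((c j)%:E * green n j * hit j))).
  apply: (@nneseries_term _ (fun j => (c j)%:E * green n j * hit j)) => j.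
  have [->|j0] := posnP j; first by rewrite green_at0 mule0 mul0e.
  by rewrite !mule_ge0 ?green_ge0 ?hit_ge0// lee_fin ltW// tilt_gt0.
rewrite green_hit; apply: le_lt_trans return_fin.
rewrite /green_return (@nneseries_split _ _ 0%N n).
  by rewrite add0n leeDr// sume_ge0// => l _; apply: nneseries_ge0T => j;
    rewrite mule_ge0 ?green_ge0// lee_fin.
by move=> l _; apply: nneseries_ge0T => j; rewrite mule_ge0 ?green_ge0// lee_fin.
Qed.

(* The telescoping identity [sum_j green n j * c_j + th * sum_j green n j =
   sum_j green n.+1 j * c_j + sum_j green n j * A j 0] has a boundary term
   which vanishes as soon as [hit] is bounded below. *)
Lemma green_mass (k qb : R) : (0 < k)%R -> (forall i, (0 < i)%N -> k%:E <= hit i) ->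
  (0 <= th)%R ->
  (forall i, (0 < i)%N -> \sum_(j <oo) (A i j)%:E = (q i)%:E) ->
  \sum_(j <oo) (taboo 0 j)%:E = qb%:E ->
  qb%:E + th%:E * \sum_(j <oo) gsum j = green_return.
Proof.
move=> k0 kh th0 rows b0.
pose a n := \sum_(j <oo) (green n j * (A j 0)%:E).
pose B n := \sum_(j <oo) ((c j)%:E * green n j).
pose G n := \sum_(j <oo) green n j.
have a0' n : 0 <= a n by apply: nneseries_ge0T => j; rewrite mule_ge0 ?green_ge0// lee_fin.
have cg0 n j : 0 <= (c j)%:E * green n j.
  have [->|j0] := posnP j; first by rewrite green_at0 mule0.
  by rewrite mule_ge0 ?green_ge0// lee_fin ltW// tilt_gt0.
have B0 n : 0 <= B n by exact: nneseries_ge0T.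
have G0 n : 0 <= G n by apply: nneseries_ge0T => j; exact: green_ge0.
have row_taboo i : (0 < i)%N -> \sum_(j <oo) (taboo i j)%:E + (A i 0)%:E = (q i)%:E.
  move=> i0; rewrite -(rows i i0) (nneseries_recl0 (f := fun j => (A i j)%:E)); last first.
    by move=> j; rewrite lee_fin.
  rewrite addeC (nneseries_recl0 (f := fun j => (taboo i j)%:E)); last first.
    by move=> j; rewrite lee_fin taboo_ge0.
  by rewrite {1}/taboo add0e.
have step n : B n + th%:E * G n = B n.+1 + a n.
  rewrite /G -nneseriesZle ?lee_fin//; last by move=> j; exact: green_ge0.
  rewrite /B -nneseriesDT//; last by move=> j; rewrite mule_ge0 ?green_ge0// lee_fin.
  transitivity (\sum_(j <oo) (green n j * (\sum_(k <oo) (taboo j k)%:E + (A j 0)%:E))).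
    apply: eq_eseriesr => j _.
    have [->|j0] := posnP j; first by rewrite green_at0 !mule0 mul0e adde0.
    rewrite row_taboo// -ge0_muleDl ?lee_fin ?(ltW (tilt_gt0 j0))//.
    by rewrite -EFinD subrK muleC.
  under eq_eseriesr => j _.
    rewrite ge0_muleDr ?lee_fin//; last first.
      by apply: nneseries_ge0T => i; rewrite lee_fin taboo_ge0.
    rewrite -nneseriesZle ?green_ge0//; last by move=> i; rewrite lee_fin taboo_ge0.
    over.
  rewrite nneseriesDT; last 2 first.
  - by move=> j; apply: nneseries_ge0T => i; rewrite mule_ge0 ?green_ge0// lee_fin taboo_ge0.
  - by move=> j; rewrite mule_ge0 ?green_ge0// lee_fin.
  congr (_ + _); rewrite nneseries_interchangeT; last first.
    by move=> j i; rewrite mule_ge0 ?green_ge0// lee_fin taboo_ge0.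
  by apply: eq_eseriesr => j _; rewrite greenS_bal.
have B_0 : B 0%N = qb%:E by rewrite -b0; apply: eq_eseriesr => j _; exact: green0_bal.
have part N : qb%:E + \sum_(0 <= n < N) (th%:E * G n) = B N + \sum_(0 <= n < N) a n.
  elim: N => [|N IH]; first by rewrite !big_nil !adde0.
  rewrite !big_nat_recr//= addeA IH addeAC step -addeA; congr (_ + _).
  by rewrite addeC.
have BN0 : B n @[n --> \oo] --> 0.
  apply: (@squeeze_cvge _ _ _ _ (fun=> 0) _ (fun n => (k^-1)%:E * \sum_(n <= l <oo) a l)).
  - apply: nearW => n; rewrite B0/=.
    rewrite -[leLHS]mul1e -(_ : (k^-1)%:E * k%:E = 1); last by rewrite -EFinM mulVf// gt_eqF.
    rewrite -muleA lee_pmul ?lee_fin ?invr_ge0 ?(ltW k0)//.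
      by rewrite mule_ge0// lee_fin ltW.
    rewrite -green_hit -nneseriesZle ?lee_fin ?(ltW k0)//.
    apply: lee_nneseriesT => j; first by rewrite mule_ge0// lee_fin ltW.
    have [->|j0] := posnP j; first by rewrite green_at0 !mule0 mul0e.
    by rewrite muleC lee_pmul// ?lee_fin ?(ltW k0)// kh.
  - exact: cvg_cst.
  - rewrite -[X in _ --> X](mule0 (k^-1)%:E); apply: cvgeZl => //.
    exact: nneseries_tail_cvg.
have lhs : qb%:E + \sum_(0 <= n < N) (th%:E * G n) @[N --> \oo] --> 
    qb%:E + th%:E * \sum_(j <oo) gsum j.
  apply: cvgeD; last 2 first.
  - exact: cvg_cst.
  - rewrite /gsum nneseries_interchangeT; last by move=> j n; exact: green_ge0.
    rewrite -nneseriesZle ?lee_fin//.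
    apply: is_cvg_nneseries => n _ _; rewrite mule_ge0// lee_fin//.
  by rewrite fin_num_adde_defr.
have rhs : B N + \sum_(0 <= n < N) a n @[N --> \oo] --> 0 + green_return.
  apply: cvgeD; [by []|exact: BN0|exact: is_cvg_nneseries].
rewrite add0e in rhs.
have E : (fun N : nat => qb%:E + \sum_(0 <= n < N) (th%:E * G n)) =
    (fun N => B N + \sum_(0 <= n < N) a n) by apply/funext => N; exact: part.
rewrite E in lhs.
exact: (cvg_unique _ lhs rhs).
Qed.

End fixed_tilt.

Lemma hitl_mono (th th' : R) l i : (th <= th')%R -> (green_return th < +oo) ->
  (green_return th' < +oo) -> (0 < i)%N -> hitl th l i <= hitl th' l i.
Proof.
move=> tt' f f'; elim: l i => [|l IH] i i0 /=.
  rewrite lee_pmul ?lee_fin ?invr_ge0 ?(ltW (tilt_gt0 f i0))//.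
  by rewrite lef_pV2 ?posrE ?tilt_gt0// lerB.
rewrite lee_pmul ?lee_fin ?invr_ge0 ?(ltW (tilt_gt0 f i0))//.
- apply: nneseries_ge0T => k; case: (posnP k) => [->|k0]; first by rewrite /taboo mul0e.
  by rewrite mule_ge0 ?hitl_ge0// lee_fin taboo_ge0.
- by rewrite lef_pV2 ?posrE ?tilt_gt0// lerB.
apply: lee_nneseriesT => k; case: (posnP k) => [->|k0]; rewrite ?/taboo ?mul0e//.
  by rewrite mule_ge0 ?hitl_ge0// lee_fin; case: ifP.
by rewrite lee_pmul ?hitl_ge0 ?lee_fin ?IH//; case: ifP.
Qed.

Lemma hit_mono (th th' : R) i : (th <= th')%R -> (green_return th < +oo) ->
  (green_return th' < +oo) -> hit th i <= hit th' i.
Proof.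
move=> tt' f f'; rewrite /hit; case: ifPn => //; rewrite -lt0n => i0.
apply: lee_nneseriesT => l; first exact: hitl_ge0.
exact: hitl_mono.
Qed.

(* Finiteness at a larger tilt gives positive recurrence. *)
Lemma gsum_hit_fin (th th' : R) : (th < th')%R -> (green_return th < +oo) ->
  (green_return th' < +oo) -> \sum_(j <oo) (gsum th j * hit th j) < +oo.
Proof.
move=> tt' f f'.
have h0 := hit_ge0 f'.
have d0 : (0 < th' - th)%R by rewrite subr_gt0.
(* The vector that balances at tilt [th'] is superharmonic at the smaller tilt [th], with surplus
   [th' - th] times itself, because the tilted rates differ by that constant. *)
have H := @superharmonic_green th f (hit th') (fun j => (th' - th)%:E * hit th' j) h0.
have : \sum_(n <oo) \sum_(j <oo) (green th n j * ((th' - th)%:E * hit th' j)) <= green_return th'.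
  rewrite -(taboo0_hit f'); apply: H => [j|j j0].
    by rewrite mule_ge0// lee_fin ltW.
  have -> : (q j - th)%:E = (q j - th')%:E + (th' - th)%:E.
    by rewrite -EFinD addrA subrK.
  rewrite ge0_muleDl ?lee_fin ?(ltW d0) ?(ltW (tilt_gt0 f' j0))//.
  by rewrite leeD2r// hit_bal// leeDr// lee_fin.
rewrite nneseries_interchangeT; last first.
  by move=> n j; rewrite !mule_ge0 ?green_ge0// lee_fin ltW.
have E (j : nat) : \sum_(n <oo) (green th n j * ((th' - th)%:E * hit th' j)) =
    (th' - th)%:E * (gsum th j * hit th' j).
  rewrite nneseriesZre ?mule_ge0 ?lee_fin ?(ltW d0)//; last by move=> n; exact: green_ge0.
  by rewrite muleCA.
rewrite (eq_eseriesr (fun j _ => E j)) nneseriesZle ?lee_fin ?(ltW d0)//; last first.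
  by move=> j; rewrite mule_ge0// gsum_ge0.
move=> /le_lt_trans /(_ f') Hfin.
apply: (@le_lt_trans _ _ (\sum_(j <oo) (gsum th j * hit th' j))).
  apply: lee_nneseriesT => j; first by rewrite mule_ge0 ?gsum_ge0 ?(hit_ge0 f).
  by rewrite lee_pmul ?gsum_ge0 ?(hit_ge0 f)// hit_mono// ltW.
apply: (mule_ge0_eq_pinfty _ _ Hfin); first by rewrite lte_fin.
by apply: nneseries_ge0T => j; rewrite mule_ge0// gsum_ge0.
Qed.

End taboo_green.

(** * The quasi-stationary distribution *)

Section kernel_positivity.
Local Open Scope ereal_scope.
Variable R : realType.
Notation leb := (@lebesgue_measure R).

(** Domination termwise with the same finite total forces equality termwise. This upgrades the
    one-sided comparison results to invariance of [m] and harmonicity of [h]. *)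
Lemma nneseries_squeeze_eq (f g : nat -> \bar R) :
  (forall k, 0 <= f k) -> (forall k, f k <= g k) -> \sum_(k <oo) g k < +oo ->
  \sum_(k <oo) g k <= \sum_(k <oo) f k -> forall k, f k = g k.
Proof.
move=> f0 fg gfin gf k.
have g0 j : 0 <= g j by exact: le_trans (fg j).
apply/eqP; rewrite eq_le fg/=.
move: gf gfin.
rewrite (@nneseriesD1 _ f k)// (@nneseriesD1 _ g k)// => gf gfin.
set a := \sum_(0 <= i <oo | _) f i in gf.
set b := \sum_(0 <= i <oo | _) g i in gf gfin.
have ab : a <= b by apply: lee_nneseries => *.
have b0 : 0 <= b by apply: nneseries_ge0 => *.
have bfin : b \is a fin_num.
  by rewrite ge0_fin_numE// (le_lt_trans _ gfin)// leeDr.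
by rewrite -(leeD2rE _ _ bfin) (le_trans gf)// leeD2l.
Qed.

Variable A : nat -> nat -> R.
Hypothesis A0 : forall i j, (0 <= A i j)%R.
Variable q : nat -> R.
Hypothesis q0 : forall j, (0 <= q j)%R.
Hypothesis irr : forall i (P : nat -> Prop), P i ->
  (forall k j, P k -> (0 < A k j)%R -> P j) -> forall j, P j.

(** Keep only the paths with exactly one jump, at a time [r] in [0, s]. Both holding factors are at
    least their value at [s], which gives the constant [C]. *)
Lemma tker_step_gt0 k j s : (0 < s)%R -> (0 < A k j)%R -> 0 < tker A q (@delta R k) j s.
Proof.
move=> s0 Akj.
have d0 := @delta_ge0 R k.
apply: (@lt_le_trans _ _ (jker A q (@delta R k) 1 j s)); last first.
  by apply: (@nneseries_term _ (fun n => jker A q (delta R k) n j s)) => n; exact: jker_ge0.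
pose C := (expR (- (q k * s)) * A k j * expR (- (q j * s)))%R.
have C0 : (0 < C)%R by rewrite !mulr_gt0// expR_gt0.
apply: (@lt_le_trans _ _ (\int[leb]_(r in `[0%R, s]) C%:E)).
  rewrite integral_cst//= lebesgue_measure_itv/= lte_fin s0 oppr0 adde0.
  by rewrite mule_gt0// lte_fin.
pose F := flux A (jker A q (delta R k) 0) j.
rewrite integral_mkcond jkerS -/F; apply: le_integralT.
- by move=> r; apply: erestrict_ge0 => y _; rewrite lee_fin ltW.
- by apply/(measurable_restrictT _ _).1 => //; exact: measurable_cst.
- by apply: measurable_conv_fix; exact: measurable_flux_jker.
move=> r; rewrite patchE mem_setE in_itv/=; case: ifPn => [/andP[r0 rs]|_]; last first.
  by apply: mule_ge0; [exact: flux_jker_ge0|exact: expkE_ge0].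
have -> : F r = (expk (q k) r * A k j)%:E.
  rewrite /F /flux /= /delta; under eq_eseriesr => l _ do rewrite -muleA.
  by rewrite nneseries_delta ?EFinM// => l; rewrite mule_ge0 ?expkE_ge0// lee_fin.
rewrite /C -EFinM lee_fin /expk r0 subr_ge0 rs.
rewrite ler_pM ?mulr_ge0 ?expR_ge0//.
  by rewrite ler_wpM2r// ler_expR lerN2 ler_wpM2l.
by rewrite ler_expR lerN2 ler_wpM2l// gerBl.
Qed.

(** The induction along positive rates carries the claim for all times at once, so each new jump can
    be given half of the available time. *)
Lemma tker_gt0 i j t : (0 < t)%R -> 0 < tker A q (@delta R i) j t.
Proof.
move: t; apply: (@irr i (fun j => forall t, (0 < t)%R -> 0 < tker A q (@delta R i) j t)).
  move=> t t0; apply: (@lt_le_trans _ _ (jker A q (@delta R i) 0 i t)).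
    by rewrite /= /delta eqxx mul1e lte_fin /expk ltW// expR_gt0.
  apply: (@nneseries_term _ (fun n => jker A q (delta R i) n i t)) => n.
  by apply: jker_ge0 => // k; exact: delta_ge0.
move=> k l Pk Akl t t0.
have t20 : (0 < t / 2)%R by rewrite divr_gt0.
rewrite [t]splitr chapman_kolmogorov ?(ltW t20)//.
apply: (@lt_le_trans _ _ (tker A q (delta R i) k (t / 2) * tker A q (delta R k) l (t / 2))).
  by rewrite mule_gt0 ?Pk// tker_step_gt0.
apply: (@nneseries_term _ (fun k => tker A q (delta R i) k (t / 2) * tker A q (delta R k) l (t / 2))) => m.
by rewrite mule_ge0// tker_ge0// => ?; exact: delta_ge0.
Qed.

End kernel_positivity.

(** * Invariance, decay rate and conditional limits for the tilted semigroup *)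

Section quasi_stationary.
Local Open Scope ereal_scope.
Variable R : realType.
Notation leb := (@lebesgue_measure R).
Variable A : nat -> nat -> R.
Hypothesis A0 : forall i j, (0 <= A i j)%R.
Hypothesis A00 : A 0 0 = 0%R.
Variable q : nat -> R.
Hypothesis irr : forall i (P : nat -> Prop), P i ->
  (forall k j, P k -> (0 < A k j)%R -> P j) -> forall j, P j.
Variables lam ts th' : R.
Hypothesis lam0 : (0 < lam)%R.
Hypothesis ts0 : (0 < ts)%R.
Hypothesis ts_th' : (ts < th')%R.
Hypothesis rows : forall i, (0 < i)%N -> \sum_(j <oo) (A i j)%:E = (q i)%:E.
Hypothesis row0 : \sum_(j <oo) (A 0 j)%:E = (q 0%N - lam)%:E.

Let p i j t := tker A q (delta R i) j t.

Hypothesis mass : forall i (t : R), (0 <= t)%R ->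
  \sum_(j <oo) p i j t + lam%:E * occup (p i 0%N) t = 1.
Hypothesis killed : forall i, lam%:E * \int[leb]_s p i 0%N s = 1.
Hypothesis ret : green_return A q ts = (q 0%N - ts)%:E.
Hypothesis ret' : green_return A q th' < +oo.

Let c j := (q j - ts)%R.
Let retfin : green_return A q ts < +oo.
Proof. by rewrite ret ltry. Qed.

(** Off 0 this is [tilt_gt0]; at 0 the hypothesis [ret] identifies the rate with [green_return], a
    sum of nonnegative terms. *)
Let c_ge0 j : (0 <= c j)%R.
Proof.
have [->|j0] := posnP j; last by rewrite ltW// /c; apply: (tilt_gt0 A0 irr retfin).
rewrite /c -lee_fin -ret; apply: nneseries_ge0T => n; apply: nneseries_ge0T => j'.
by rewrite mule_ge0 ?lee_fin// green_ge0.
Qed.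

Let d0 i k : 0 <= delta R i k.
Proof. exact: delta_ge0. Qed.

Let p0 i j t : 0 <= p i j t.
Proof. exact: tker_ge0. Qed.

Let mp i j : measurable_fun setT (p i j).
Proof. exact: measurable_tker. Qed.

Definition qsd_m j : R := if j == 0%N then 1%R else fine (gsum A q ts j).
Definition qsd_h j : R := fine (hit A q ts j).

Let m := qsd_m.
Let h := qsd_h.

Let gsum0 : gsum A q ts 0 = 0.
Proof. by rewrite /gsum eseries0// => n _ _; apply: green_at0. Qed.

Lemma qsd_mE j : (m j)%:E = delta R 0 j + gsum A q ts j.
Proof.
rewrite /m /qsd_m /delta; case: eqP => [->|_]; first by rewrite gsum0 adde0.
rewrite add0e fineK// ge0_fin_numE; last exact: gsum_ge0.
exact: (gsum_fin A0 irr retfin).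
Qed.

Lemma qsd_hE j : (h j)%:E = hit A q ts j.
Proof.
rewrite /h /qsd_h fineK// ge0_fin_numE; last exact: (hit_ge0 A0 irr retfin).
exact: (hit_fin A0 irr retfin).
Qed.

Lemma qsd_m_gt0 j : (0 < m j)%R.
Proof.
rewrite /m /qsd_m; case: eqP => // /eqP; rewrite -lt0n => j0; apply: fine_gt0.
by rewrite gsum_gt0//= (gsum_fin A0 irr retfin).
Qed.

Let h_ge0 j : (0 <= h j)%R.
Proof. by rewrite fine_ge0// (hit_ge0 A0 irr retfin). Qed.

Let h0E : h 0%N = 1%R.
Proof. by []. Qed.

Lemma qsd_m_bal j : \sum_(k <oo) (m k * A k j)%:E = (c j * m j)%:E.
Proof.
have g0 k : 0 <= gsum A q ts k by exact: gsum_ge0.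
under eq_eseriesr => k _ do rewrite EFinM qsd_mE ge0_muleDl ?d0//.
rewrite nneseriesDT; last 2 first.
- by move=> k; rewrite mule_ge0 ?d0 ?lee_fin.
- by move=> k; rewrite mule_ge0 ?lee_fin.
rewrite /delta nneseries_delta; last by move=> k; rewrite lee_fin.
have [->|j0] := posnP j.
  by rewrite A00 add0e -green_returnE// ret mulr1.
rewrite EFinM qsd_mE /delta (gtn_eqF j0) add0e /c.
rewrite (gsum_bal A0 irr retfin) /taboo gtn_eqF//.
Qed.

Lemma qsd_h_bal i : \sum_(k <oo) (A i k * h k)%:E = (c i * h i)%:E.
Proof.
have th0 k : 0 <= (taboo A i k)%:E * hit A q ts k.
  by rewrite mule_ge0 ?lee_fin ?taboo_ge0// (hit_ge0 A0 irr retfin).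
transitivity ((A i 0)%:E + \sum_(k <oo) ((taboo A i k)%:E * hit A q ts k)).
  rewrite nneseries_recl0; last by move=> k; rewrite lee_fin mulr_ge0.
  rewrite h0E mulr1; congr (_ + _).
  rewrite [RHS]nneseries_recl0// {1}/taboo mul0e add0e.
  by apply: eq_eseriesr => k _; rewrite EFinM qsd_hE.
have [->|i0] := posnP i; first by rewrite A00 add0e (taboo0_hit A0 irr retfin) ret h0E mulr1.
by rewrite -(hit_bal A0 irr retfin)// EFinM qsd_hE.
Qed.

Let ph i j t := tker A c (delta R i) j t.

Let ph0 i j t : 0 <= ph i j t.
Proof. exact: tker_ge0. Qed.

Lemma phE i j t : ph i j t = (expR (ts * t))%:E * p i j t.
Proof. by rewrite /ph /p tker_tilt. Qed.

Lemma pE i j t : p i j t = (expR (- (ts * t)))%:E * ph i j t.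
Proof. by rewrite phE muleA -EFinM -expRD addNr expR0 mul1e. Qed.

Lemma ph_superharmonic i t : (0 <= t)%R -> \sum_(j <oo) (ph i j t * (h j)%:E) <= (h i)%:E.
Proof.
move=> t0; apply: (le_trans (tker_superharmonic A0 c_ge0 (d0 i) h_ge0 t0 _)).
  by move=> j; rewrite qsd_h_bal.
by rewrite /delta nneseries_delta// => k; rewrite lee_fin.
Qed.

Lemma ph_le_h i t : ph i 0%N t <= (h i)%:E.
Proof.
have [t0|t0] := ltP t 0%R.
  rewrite /ph /tker eseries0 ?lee_fin// => n _ _; exact: jker_lt0.
apply: le_trans (ph_superharmonic i t0).
rewrite -[leLHS]mule1; apply: (@nneseries_term _ (fun j => ph i j t * (h j)%:E)) => j.
by rewrite mule_ge0 ?lee_fin.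
Qed.

(* [h i >= e^(ts t) p i 0 t] for all [t]; integrate in [t]. *)
Lemma qsd_h_lower i : (ts / lam <= h i)%R.
Proof.
rewrite ler_pdivrMr// mulrC -lee_fin.
have H : \int[leb]_s p i 0%N s <= (h i / ts)%:E.
  apply: (@le_trans _ _ (\int[leb]_s ((h i)%:E * (expk ts s)%:E))).
    apply: le_integralT.
    - by move=> s; exact: p0.
    - exact: mp.
    - apply: emeasurable_funM; first exact: measurable_cst.
      by apply/measurable_EFinP; exact: measurable_expk.
    - move=> s; rewrite pE /expk; case: ifPn => [s0|].
        by rewrite muleC lee_pmul ?lee_fin ?expR_ge0// ph_le_h.
      rewrite -ltNge => s0; rewrite (_ : ph i 0%N s = 0) ?mule0//.
      by rewrite /ph /tker eseries0// => n _ _; exact: jker_lt0.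
  rewrite ge0_integralZl ?lee_fin//.
  - by rewrite expk_int_pos.
  - by apply/measurable_EFinP; exact: measurable_expk.
  - by move=> s _; exact: expkE_ge0.
have : 1 <= lam%:E * (h i / ts)%:E by rewrite -(killed i) lee_pmul ?lee_fin ?(ltW lam0)// integral_ge0.
by rewrite -EFinM !lee_fin mulrA ler_pdivlMr// mul1r.
Qed.

Let h_gt0 j : (0 < h j)%R.
Proof. by apply: lt_le_trans (qsd_h_lower j); rewrite divr_gt0. Qed.

(** Mass balance at decay rate [ts]: killing removes [lam * m 0 = lam] per unit time, which must be
    [ts] times the total mass. [green_mass] makes this precise. *)
Lemma qsd_m_sum : \sum_(j <oo) (m j)%:E = (lam / ts)%:E.
Proof.
have b0 : \sum_(j <oo) (taboo A 0 j)%:E = (q 0%N - lam)%:E.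
  rewrite -row0; apply: eq_eseriesr => j _; rewrite /taboo; case: eqP => // ->.
  by rewrite A00.
have k0 : (0 < ts / lam)%R by rewrite divr_gt0.
have kh i : (0 < i)%N -> (ts / lam)%:E <= hit A q ts i.
  by move=> i0; rewrite -qsd_hE lee_fin qsd_h_lower.
have := green_mass A0 irr retfin k0 kh (ltW ts0) rows b0.
have G0 : 0 <= \sum_(j <oo) gsum A q ts j by apply: nneseries_ge0T => j; exact: gsum_ge0.
(* Finiteness has to be known before solving for the total: [hit] is at least [ts / lam], and the
   sum of the products is finite by [gsum_hit_fin]. *)
have Gf : \sum_(j <oo) gsum A q ts j <= \sum_(j <oo) ((lam / ts)%:E * (gsum A q ts j * hit A q ts j)).
  apply: lee_nneseriesT => j; first exact: gsum_ge0.
  rewrite muleCA -[leLHS]mule1 lee_pmul ?gsum_ge0//.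
  rewrite -qsd_hE -EFinM lee_fin mulrAC ler_pdivlMr// mul1r mulrC -ler_pdivrMr//.
  exact: qsd_h_lower.
rewrite nneseriesZle in Gf; last 2 first.
- by rewrite lee_fin divr_ge0 ?ltW.
- by move=> j; rewrite mule_ge0 ?gsum_ge0// (hit_ge0 A0 irr retfin).
have Gfin : \sum_(j <oo) gsum A q ts j \is a fin_num.
  rewrite ge0_fin_numE//; apply: (le_lt_trans Gf).
  have Hfin := gsum_hit_fin A0 irr ts_th' retfin ret'.
  rewrite lte_mul_pinfty// ?lee_fin ?divr_ge0 ?ltW//.
rewrite ret -(fineK Gfin) -EFinM -EFinD => -[] E.
under eq_eseriesr => j _ do rewrite qsd_mE.
rewrite nneseriesDT ?d0//; last by move=> j; exact: gsum_ge0.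
rewrite -(fineK Gfin).
have -> : \sum_(k <oo) delta R 0 k = 1.
  under eq_eseriesr => k _ do rewrite -[delta R 0 k]mule1.
  by rewrite /delta nneseries_delta.
rewrite -EFinD; congr _%:E; apply: (mulfI (lt0r_neq0 ts0)).
rewrite [RHS]mulrCA divff ?lt0r_neq0// mulr1.
lra.
Qed.

Lemma m_ph_le j t : (0 <= t)%R -> \sum_(i <oo) ((m i)%:E * ph i j t) <= (m j)%:E.
Proof.
move=> t0; have m0 k : (0 <= m k)%R by rewrite ltW// qsd_m_gt0.
rewrite -(@tker_delta R A A0 c (EFin \o m)) => [|k]; last by rewrite lee_fin.
by apply: tker_subinvariant => // k; rewrite qsd_m_bal.
Qed.

Let mE0 k : 0 <= (m k)%:E.
Proof. by rewrite lee_fin ltW// qsd_m_gt0. Qed.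

(** Started from [m], the mass lost by time t is [lam] times the occupation of 0. Subinvariance
    bounds the mass at 0 at time s by exp(- ts s), so at most [(lam / ts) * (1 - exp(- ts t))] is
    lost out of [lam / ts]. *)
Lemma m_p_mass t : (0 <= t)%R ->
  ((lam / ts) * expR (- (ts * t)))%:E <= \sum_(j <oo) \sum_(i <oo) ((m i)%:E * p i j t).
Proof.
move=> t0.
have M : \sum_(j <oo) \sum_(i <oo) ((m i)%:E * p i j t) +
    lam%:E * occup (fun s => \sum_(i <oo) ((m i)%:E * p i 0%N s)) t = (lam / ts)%:E.
  rewrite occup_series// nneseries_interchangeT; last by move=> j i; rewrite mule_ge0.
  rewrite -nneseriesZle ?lee_fin ?(ltW lam0)//; last first.
    by move=> i; rewrite mule_ge0 ?occup_ge0.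
  rewrite -nneseriesDT; last 2 first.
  - by move=> i; apply: nneseries_ge0T => j; rewrite mule_ge0.
  - by move=> i; rewrite !mule_ge0 ?occup_ge0// lee_fin ltW.
  rewrite -qsd_m_sum; apply: eq_eseriesr => i _.
  rewrite nneseriesZle// muleCA -ge0_muleDr; last 2 first.
  - exact: nneseries_ge0T.
  - by rewrite mule_ge0 ?lee_fin ?(ltW lam0)// occup_ge0.
  by rewrite mass// mule1.
have me : measurable_fun setT (fun s : measurableTypeR R => (expk ts s)%:E).
  by apply/measurable_EFinP; exact: measurable_expk.
have O : occup (fun s => \sum_(i <oo) ((m i)%:E * p i 0%N s)) t <= 
    \int[leb]_s ((s <= t)%R%:R * expk ts s)%:E.
  rewrite [leRHS](_ : _ = occup (fun s => (expk ts s)%:E) t); last first.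
    by apply: eq_integral => s _; rewrite EFinM.
  apply: le_occup => //.
  - by move=> s; apply: nneseries_ge0T => i; rewrite mule_ge0.
  - apply: measurable_seriesT => [i|i x]; last by rewrite mule_ge0.
    exact: emeasurable_funM.
  move=> s; rewrite /expk; case: ifPn => [s0|]; last first.
    rewrite -ltNge => s0; rewrite eseries0// => i _ _.
    by rewrite /p /tker eseries0 ?mule0// => n _ _; exact: jker_lt0.
  under eq_eseriesr => i _ do rewrite pE muleCA.
  rewrite nneseriesZle ?lee_fin ?expR_ge0//; last by move=> i; rewrite mule_ge0.
  rewrite -[leRHS]mule1 lee_pmul ?lee_fin ?expR_ge0 ?m_ph_le//.
  by apply: nneseries_ge0T => i; rewrite mule_ge0.
set S := \sum_(j <oo) _ in M *.
have := expk_int_itv ts t0; set I := \int[leb]_s _ in O * => EI.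
have I0 : 0 <= I by apply: integral_ge0 => s _; rewrite lee_fin mulr_ge0// expk_ge0.
have Ifin : I \is a fin_num.
  rewrite ge0_fin_numE//; apply: (@mule_ge0_eq_pinfty _ ts%:E); rewrite ?lte_fin//.
  by apply: (@le_lt_trans _ _ 1); rewrite ?ltry// -EI leeDl// expkE_ge0.
move: EI; rewrite /expk t0 -(fineK Ifin) -EFinM -EFinD => -[] EI.
have : (lam / ts)%:E <= S + lam%:E * I by rewrite -M leeD2l// lee_pmul ?lee_fin ?(ltW lam0)// occup_ge0// => s; apply: nneseries_ge0T => i; rewrite mule_ge0.
rewrite -(fineK Ifin) -EFinM -leeBlDr// -EFinB; apply: le_trans.
rewrite lee_fin (_ : fine I = (1 - expR (- (ts * t))) / ts)%R; last first.
  by rewrite -EI addrK mulrC mulKf// lt0r_neq0.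
by rewrite le_eqVlt; apply/orP; left; apply/eqP; field; rewrite lt0r_neq0.
Qed.

(** [m_ph_le] bounds every coordinate from above and [m_p_mass] bounds the total from below by the
    mass of [m], so no coordinate can lose anything. *)
Lemma m_ph j t : (0 <= t)%R -> \sum_(i <oo) ((m i)%:E * ph i j t) = (m j)%:E.
Proof.
move=> t0; apply: (@nneseries_squeeze_eq R (fun j => \sum_(i <oo) ((m i)%:E * ph i j t)) (EFin \o m)).
- by move=> k; apply: nneseries_ge0T => i; rewrite mule_ge0.
- by move=> k; exact: m_ph_le.
- by rewrite qsd_m_sum ltry.
rewrite qsd_m_sum.
have E k : \sum_(i <oo) ((m i)%:E * ph i k t) = 
    (expR (ts * t))%:E * \sum_(i <oo) ((m i)%:E * p i k t).
  rewrite -nneseriesZle ?lee_fin ?expR_ge0//; last by move=> i; rewrite mule_ge0.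
  by apply: eq_eseriesr => i _; rewrite phE muleCA.
rewrite (eq_eseriesr (fun k _ => E k)) nneseriesZle ?lee_fin ?expR_ge0//; last first.
  by move=> k; apply: nneseries_ge0T => i; rewrite mule_ge0.
have -> : (lam / ts)%:E = (expR (ts * t))%:E * ((lam / ts) * expR (- (ts * t)))%:E.
  by rewrite -EFinM mulrCA -expRD subrr expR0 mulr1.
rewrite lee_pmul ?lee_fin ?expR_ge0 ?m_p_mass//.
by rewrite mulr_ge0 ?expR_ge0// divr_ge0 ?ltW.
Qed.

Lemma qsd_invariant j t : (0 <= t)%R ->
  \sum_(i <oo) ((m i)%:E * p i j t) = (expR (- (ts * t)) * m j)%:E.
Proof.
move=> t0; rewrite EFinM -(m_ph j t0) -nneseriesZle ?lee_fin ?expR_ge0//; last first.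
  by move=> i; rewrite mule_ge0.
by apply: eq_eseriesr => i _; rewrite pE muleCA.
Qed.

Let mh_fin : \sum_(j <oo) (m j * h j)%:E \is a fin_num.
Proof.
rewrite ge0_fin_numE; last by apply: nneseries_ge0T => j; rewrite lee_fin mulr_ge0 ?ltW ?qsd_m_gt0.
under eq_eseriesr => j _ do rewrite EFinM qsd_mE ge0_muleDl ?d0 ?gsum_ge0//.
rewrite nneseriesDT; last 2 first.
- by move=> k; rewrite mule_ge0 ?d0 ?lee_fin.
- by move=> k; rewrite mule_ge0 ?lee_fin ?gsum_ge0.
rewrite /delta nneseries_delta; last by move=> k; rewrite lee_fin.
rewrite lte_add_pinfty ?ltry//; under eq_eseriesr => j _ do rewrite qsd_hE.
exact: (gsum_hit_fin A0 irr ts_th' retfin ret').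
Qed.

Definition qsd_Z : R := fine (\sum_(j <oo) (m j * h j)%:E).

Let ZE : \sum_(j <oo) (m j * h j)%:E = qsd_Z%:E.
Proof. by rewrite fineK. Qed.

Lemma qsd_Z_gt0 : (0 < qsd_Z)%R.
Proof.
rewrite -lte_fin -ZE; apply: (@lt_le_trans _ _ (m 0%N * h 0%N)%:E).
  by rewrite lte_fin mulr_gt0 ?qsd_m_gt0.
apply: (@nneseries_term _ (fun j => (m j * h j)%:E)) => j.
by rewrite lee_fin mulr_ge0 ?ltW ?qsd_m_gt0.
Qed.

(** Pair the superharmonic inequality with [m]: by invariance both sides have the same finite total
    [qsd_Z], hence agree termwise, and [m i > 0] can be divided out. *)
Lemma ph_harmonic i t : (0 <= t)%R -> \sum_(j <oo) (ph i j t * (h j)%:E) = (h i)%:E.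
Proof.
move=> t0.
have s0 i' : 0 <= \sum_(j <oo) (ph i' j t * (h j)%:E).
  by apply: nneseries_ge0T => j; rewrite mule_ge0 ?lee_fin.
have := @nneseries_squeeze_eq R (fun i => (m i)%:E * \sum_(j <oo) (ph i j t * (h j)%:E))
  (fun i => (m i * h i)%:E); move=> /(_ _ _ _ _ i) H.
have {H} : (m i)%:E * (\sum_(j <oo) (ph i j t * (h j)%:E)) = (m i * h i)%:E.
  apply: H.
  - by move=> k; rewrite mule_ge0.
  - by move=> k; rewrite EFinM lee_pmul// ph_superharmonic.
  - by rewrite ZE ltry.
  under [leRHS]eq_eseriesr => k _.
    rewrite -nneseriesZle//; last by move=> j; rewrite mule_ge0 ?lee_fin.
    over.
  rewrite nneseries_interchangeT; last first.
    by move=> k j; rewrite !mule_ge0 ?mE0 ?lee_fin.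
  apply: lee_nneseriesT => j; first by rewrite lee_fin mulr_ge0 ?ltW ?qsd_m_gt0.
  under eq_eseriesr => k _ do rewrite muleA.
  rewrite nneseriesZre ?lee_fin//; last by move=> k; rewrite mule_ge0.
  by rewrite m_ph// EFinM.
have mi0 : ((m i)^-1)%:E * (m i)%:E = 1 by rewrite -EFinM mulVf// lt0r_neq0// qsd_m_gt0.
move=> /(congr1 (fun x => ((m i)^-1)%:E * x)).
by rewrite muleA mi0 mul1e => ->; rewrite EFinM muleA mi0 mul1e.
Qed.

Let ph_fin i j t : (0 <= t)%R -> ph i j t \is a fin_num.
Proof.
move=> t0; rewrite ge0_fin_numE//; apply: (@mule_ge0_eq_pinfty _ (h j)%:E); rewrite ?lte_fin//.
apply: (@le_lt_trans _ _ (h i)%:E); last exact: ltry.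
rewrite -(ph_harmonic i t0) muleC.
by apply: (@nneseries_term _ (fun j => ph i j t * (h j)%:E)) => k; rewrite mule_ge0 ?lee_fin.
Qed.

Let K t i j := (fine (ph i j t) * h j / h i)%R.
Let pi j := (m j * h j / qsd_Z)%R.

(** Apply the l^1 convergence of the Doob transform to the test function [f / h], bounded by
    [lam / ts] thanks to [qsd_h_lower]. Undoing the transform multiplies by [h i], hence the
    tolerance [e / h i]. *)
Lemma qsd_cvg_sum i (f : nat -> R) (e : R) : (0 < e)%R -> (forall j, 0 <= f j <= 1)%R ->
  exists2 t0 : R, (0 <= t0)%R & forall t, (t0 <= t)%R ->
    \sum_(j <oo) (ph i j t * (f j)%:E) <= (h i / qsd_Z)%:E * \sum_(j <oo) (m j * f j)%:E + e%:E /\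
    (h i / qsd_Z)%:E * \sum_(j <oo) (m j * f j)%:E <= \sum_(j <oo) (ph i j t * (f j)%:E) + e%:E.
Proof.
move=> e0 f01.
have f0 j : (0 <= f j)%R by have /andP[] := f01 j.
have Z0 := qsd_Z_gt0.
have [||||||||||t0 t00 H] := @stochastic_semigroup_cvg R K pi i _ _ _ _ _ _ _ _ (fun j => f j / h j)%R (lam / ts)%R (e / h i)%R.
- by move=> t l j tt; rewrite /K divr_ge0 ?mulr_ge0 ?h_ge0// fine_ge0// ph0.
- move=> t l tt.
  have E j : (K t l j)%:E = ((h l)^-1)%:E * (ph l j t * (h j)%:E).
    by rewrite /K mulrC EFinM EFinM fineK// ph_fin.
  rewrite (eq_eseriesr (fun j _ => E j)) nneseriesZle ?lee_fin ?invr_ge0 ?(ltW (h_gt0 _))//.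
    by rewrite ph_harmonic// -EFinM mulVf// lt0r_neq0.
  by move=> j; rewrite mule_ge0// lee_fin ltW.
- move=> t s l j tt ss.
  rewrite /K (mulrAC (fine (ph l j (t + s)))) -mulrA EFinM fineK; last by rewrite ph_fin// addr_ge0.
  rewrite /ph chapman_kolmogorov// -nneseriesZre; last 2 first.
  - by rewrite lee_fin mulr_ge0 ?invr_ge0 ?ltW.
  - by move=> k; rewrite mule_ge0//; exact: ph0.
  apply: eq_eseriesr => k _; rewrite -/(ph l k t) -/(ph k j s).
  rewrite -[X in X * _ * _](fineK (ph_fin l k tt)) -[X in _ * X * _](fineK (ph_fin k j ss)) -!EFinM.
  by congr _%:E; field; rewrite !lt0r_neq0.
- move=> l; rewrite !mulr_gt0 ?invr_gt0// fine_gt0//.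
  rewrite tker_gt0//= -ge0_fin_numE//; exact: ph_fin.
- by move=> j; rewrite !mulr_ge0 ?invr_ge0 ?ltW ?qsd_m_gt0.
- under eq_eseriesr => j _ do rewrite /pi EFinM.
  rewrite nneseriesZre ?lee_fin ?invr_ge0 ?(ltW Z0)//; last first.
    by move=> j; rewrite lee_fin mulr_ge0 ?ltW ?qsd_m_gt0.
  by rewrite ZE -EFinM divff// lt0r_neq0.
- move=> t j tt.
  have E l : (pi l * K t l j)%:E = (h j / qsd_Z)%:E * ((m l)%:E * ph l j t).
    rewrite -[in RHS](fineK (ph_fin l j tt)) -!EFinM /pi /K; congr _%:E.
    by field; rewrite !lt0r_neq0.
  rewrite (eq_eseriesr (fun j _ => E j)) nneseriesZle ?lee_fin ?divr_ge0 ?(ltW Z0) ?(ltW (h_gt0 _))//.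
    rewrite m_ph// -EFinM /pi; congr _%:E; by rewrite mulrC mulrA.
  by move=> l; rewrite mule_ge0.
- by rewrite !mulr_gt0 ?invr_gt0 ?qsd_m_gt0.
- by rewrite divr_gt0.
- move=> j; apply/andP; split; first by rewrite divr_ge0.
  rewrite ler_pdivrMr//; apply: (@le_trans _ _ 1%R); first by have /andP[] := f01 j.
  rewrite mulrAC ler_pdivlMr// mul1r mulrC -ler_pdivrMr//; exact: qsd_h_lower.
exists t0 => // t tt; have t_ge0 : (0 <= t)%R by exact: le_trans tt.
have [] := H t tt.
have -> : \sum_(j <oo) (K t i j * (f j / h j))%:E = ((h i)^-1)%:E * \sum_(j <oo) (ph i j t * (f j)%:E).
  rewrite -nneseriesZle ?lee_fin ?invr_ge0 ?(ltW (h_gt0 _))//; last by move=> j; rewrite mule_ge0 ?lee_fin.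
  apply: eq_eseriesr => j _; rewrite -[in RHS](fineK (ph_fin i j t_ge0)) -!EFinM /K; congr _%:E.
  by field; rewrite !lt0r_neq0.
have -> : \sum_(j <oo) (pi j * (f j / h j))%:E = (qsd_Z^-1)%:E * \sum_(j <oo) (m j * f j)%:E.
  rewrite -nneseriesZle ?lee_fin ?invr_ge0 ?(ltW Z0)//; last first.
    by move=> j; rewrite lee_fin mulr_ge0// ltW// qsd_m_gt0.
  apply: eq_eseriesr => j _; rewrite -!EFinM /pi; congr _%:E.
  by field; rewrite !lt0r_neq0.
have hi0 : 0 <= (h i)%:E by rewrite lee_fin ltW.
have X0 : 0 <= \sum_(j <oo) (ph i j t * (f j)%:E).
  by apply: nneseries_ge0T => j; rewrite mule_ge0 ?lee_fin.
have Y0 : 0 <= \sum_(j <oo) (m j * f j)%:E.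
  by apply: nneseries_ge0T => j; rewrite lee_fin mulr_ge0// ltW// qsd_m_gt0.
have Zi0 : 0 <= (qsd_Z^-1)%:E :> \bar R by rewrite lee_fin invr_ge0 ltW.
have hV0 : 0 <= ((h i)^-1)%:E :> \bar R by rewrite lee_fin invr_ge0 ltW.
have hK (x : \bar R) : (h i)%:E * (((h i)^-1)%:E * x) = x.
  by rewrite muleA -EFinM divff ?mul1e// lt0r_neq0.
have he0 : 0 <= (e / h i)%:E by rewrite lee_fin divr_ge0 ?ltW.
have heE : (h i)%:E * (e / h i)%:E = e%:E by rewrite -EFinM mulrCA divff ?mulr1// lt0r_neq0.
move=> H1 H2; split.
- rewrite -[leLHS]hK; apply: (@le_trans _ _ ((h i)%:E * ((qsd_Z^-1)%:E * \sum_(j <oo) (m j * f j)%:E + (e / h i)%:E))).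
    by rewrite lee_pmul// mule_ge0.
  by rewrite ge0_muleDr ?mule_ge0// muleA -EFinM heE.
- rewrite EFinM -muleA; apply: (@le_trans _ _ ((h i)%:E * (((h i)^-1)%:E * (\sum_(j <oo) (ph i j t * (f j)%:E)) + (e / h i)%:E))).
    by rewrite lee_pmul// mule_ge0.
  by rewrite ge0_muleDr ?mule_ge0// hK heE.
Qed.

(** Replace 1 by [(lam / ts) * h j], which is at least 1, and use harmonicity. This explicit tail
    makes exponential moments of order below [ts] finite. *)
Lemma qsd_survival_le i t : (0 <= t)%R ->
  \sum_(j <oo) p i j t <= (h i * (lam / ts) * expR (- (ts * t)))%:E.
Proof.
move=> t0.
apply: (@le_trans _ _ (\sum_(j <oo) ((expR (- (ts * t)) * (lam / ts))%:E * (ph i j t * (h j)%:E)))).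
  apply: lee_nneseriesT => // j; rewrite pE EFinM -muleA lee_pmul ?lee_fin ?expR_ge0//.
  rewrite muleCA -[leLHS]mule1 lee_pmul// -EFinM lee_fin.
  by rewrite mulrAC ler_pdivlMr// mul1r mulrC -ler_pdivrMr// qsd_h_lower.
rewrite nneseriesZle; last 2 first.
- by rewrite lee_fin mulr_ge0 ?expR_ge0// divr_ge0 ?ltW.
- by move=> j; rewrite mule_ge0 ?lee_fin.
rewrite ph_harmonic// -EFinM lee_fin le_eqVlt; apply/orP; left; apply/eqP.
by rewrite [LHS]mulrC -[RHS]mulrA; congr (_ * _)%R; exact: mulrC.
Qed.

Let fine_cvg_pinfty (u : R -> \bar R) (l : \bar R) : l \is a fin_num ->
  (forall t, 0 <= u t) ->
  (forall e : R, (0 < e)%R -> exists2 t0 : R, (0 <= t0)%R & forall t, (t0 <= t)%R ->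
     u t <= l + e%:E /\ l <= u t + e%:E) ->
  fine (u t) @[t --> +oo%R] --> fine l.
Proof.
move=> lfin u0 H; apply/cvgrPdist_le => e e0.
have [t0 t00 Ht] := H e e0.
near=> t.
have tt0 : (t0 <= t)%R by near: t; apply: nbhs_pinfty_ge; rewrite num_real.
have [h1 h2] := Ht t tt0.
have ufin : u t \is a fin_num.
  rewrite ge0_fin_numE// (le_lt_trans h1)// lte_add_pinfty ?ltry// ltey_eq lfin//.
move: h1 h2; rewrite -{1 2}(fineK lfin) -{1 2}(fineK ufin) -!EFinD !lee_fin => h1 h2.
by rewrite ler_norml; apply/andP; split; lra.
Unshelve. all: by end_near. Qed.

Lemma qsd_cvg_point i j : fine (ph i j t) @[t --> +oo%R] --> (h i / qsd_Z * m j)%R.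
Proof.
pose f k : R := (k == j)%:R.
have f01 k : (0 <= f k <= 1)%R by rewrite /f; case: eqP; rewrite lexx ler01.
have E t : \sum_(k <oo) (ph i k t * (f k)%:E) = ph i j t.
  by under eq_eseriesr => k _ do rewrite muleC; rewrite nneseries_delta.
have E' : \sum_(k <oo) (m k * f k)%:E = (m j)%:E.
  by under eq_eseriesr => k _ do rewrite mulrC EFinM; rewrite nneseries_delta.
rewrite -[X in _ --> X]/(fine (h i / qsd_Z * m j)%:E).
apply: fine_cvg_pinfty => // e e0.
have [t0 t00 H] := qsd_cvg_sum i e0 f01.
by exists t0 => // t tt; have := H t tt; rewrite E E' -EFinM.
Qed.

Lemma qsd_cvg_mass i : fine (\sum_(j <oo) ph i j t) @[t --> +oo%R] --> (h i / qsd_Z * (lam / ts))%R.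
Proof.
have f01 (k : nat) : (0 <= (1 : R) <= 1)%R by rewrite lexx ler01.
have E t : \sum_(k <oo) (ph i k t * 1%:E) = \sum_(k <oo) ph i k t.
  by apply: eq_eseriesr => k _; rewrite mule1.
have E' : \sum_(k <oo) (m k * 1)%:E = (lam / ts)%:E.
  by rewrite -qsd_m_sum; apply: eq_eseriesr => k _; rewrite mulr1.
rewrite -[X in _ --> X]/(fine (h i / qsd_Z * (lam / ts))%:E).
apply: fine_cvg_pinfty => // [t|e e0]; first exact: nneseries_ge0T.
have [t0 t00 H] := qsd_cvg_sum i e0 f01.
by exists t0 => // t tt; have := H t tt; rewrite E E' -EFinM.
Qed.

(** The factor exp(- ts t) cancels in the quotient, and so does [h i / qsd_Z] in the limit; that is
    why the limit forgets the starting state. *)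
Lemma qsd_cvg_ratio i j :
  (fine (p i j t) / fine (\sum_(k <oo) p i k t))%R @[t --> +oo%R] --> (ts / lam * m j)%R.
Proof.
have hZ0 : (0 < h i / qsd_Z)%R by rewrite divr_gt0 ?qsd_Z_gt0.
have lt0 : (0 < lam / ts)%R by rewrite divr_gt0.
have -> : (ts / lam * m j = (h i / qsd_Z * m j) / (h i / qsd_Z * (lam / ts)))%R.
  by field; rewrite !lt0r_neq0 ?qsd_Z_gt0.
have -> : (fun t => fine (p i j t) / fine (\sum_(k <oo) p i k t))%R =
    (fun t => fine (ph i j t) / fine (\sum_(k <oo) ph i k t))%R.
  apply/funext => t.
  have e0 : (expR (- (ts * t)) != 0)%R by rewrite gt_eqF// expR_gt0.
  have -> : \sum_(k <oo) p i k t = (expR (- (ts * t)))%:E * \sum_(k <oo) ph i k t.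
    rewrite -nneseriesZle ?lee_fin ?expR_ge0//.
    by apply: eq_eseriesr => k _; exact: pE.
  (* Since [fine] sends [+oo] to 0, scaling commutes with it at infinite values as well, so the two
     quotients agree at every t without a finiteness argument. *)
  have fineZ (a : R) (x : \bar R) : a != 0%R -> 0 <= x -> (0 < a)%R -> fine (a%:E * x) = (a * fine x)%R.
    move=> a0 + a_gt0; case: x => //= _.
    by rewrite gt0_muley ?lte_fin// mulr0.
  rewrite pE !fineZ ?expR_gt0//; last exact: nneseries_ge0T.
  by rewrite -mulf_div divff// mul1r.
apply: cvgM; first exact: qsd_cvg_point.
apply: cvgV; last exact: qsd_cvg_mass.
by rewrite mulf_neq0// lt0r_neq0.
Qed.

End quasi_stationary.

(** * From the jump-chain description to kernels *)

Section probability_helpers.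
Local Open Scope ereal_scope.
Context d (Omega : measurableType d) (R : realType).
Variable P : probability Omega R.
Notation leb := (@lebesgue_measure R).

Lemma prob_fin (B : set Omega) : measurable B -> P B \is a fin_num.
Proof. by move=> mB; exact: fin_num_measure. Qed.

Lemma prob_eq_ae (B C N : set Omega) : measurable B -> measurable C -> measurable N ->
  P N = 0 -> (forall w, ~ N w -> (B w <-> C w)) -> P B = P C.
Proof.
move=> mB mC mN N0 BC.
rewrite -(measureU0 mB mN N0) -(measureU0 mC mN N0); congr (P _).
by apply/seteqP; split => w [] h; have [Nw|/BC bc] := pselect (N w);
  try (by right); left; apply/bc.
Qed.

Lemma prob_subset0 (B N : set Omega) : measurable B -> measurable N ->
  P N = 0 -> (forall w, B w -> N w) -> P B = 0.
Proof.
move=> mB mN N0 BN; apply/eqP; rewrite eq_le measure_ge0 andbT -N0.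
by rewrite le_measure// inE.
Qed.

Lemma expo_prob_ray (q u : R) : (0 < q)%R -> 
  exponential_prob q `]u, +oo[%classic = (expR (- (q * Num.max u 0%R)))%:E.
Proof.
move=> q0; set v := Num.max u 0%R.
have v0 : (0 <= v)%R by rewrite le_max lexx orbT.
have E : exponential_prob q `]u, +oo[%classic =
         \int[leb]_s (q%:E * (((v < s)%R%:R : R)%:E * (expk q s)%:E)).
  rewrite /exponential_prob integral_mkcond.
  have [w wv] : exists w : R, w = v by exists v.
  have := @lebesgue_measure_set1 R 0%R => h0.
  apply: ae_eq_integral => //.
  - apply/(measurable_restrictT _ _).1 => //; apply/measurable_EFinP.
    by apply: measurable_funTS; exact: measurable_exponential_pdf.
  - apply: emeasurable_funM => //; apply: emeasurable_funM.
      apply/measurable_EFinP; apply: measurableT_comp => //.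
      exact: measurable_fun_ltr.
    by apply/measurable_EFinP; exact: measurable_expk.
  exists [set 0%R]; split => //.
  move=> x /= /not_implyP[_]; apply: contra_notP => x0 /=.
  rewrite patchE mem_setE in_itv/= andbT /exponential_pdf patchE mem_setE in_itv/= andbT /expk.
  rewrite /v gt_max; case: (ltP u x) => ux; rewrite ?mul0e ?mule0 ?ltNge//=.
  rewrite -ltNge; case: (ltgtP 0%R x) => // [xp|xn|xe].
  - by rewrite mul1e mulNr EFinM.
  - by rewrite mul0e mule0.
  - by exfalso; apply: x0.
have me : measurable_fun setT (fun s : measurableTypeR R => (expk q s)%:E).
  by apply/measurable_EFinP; exact: measurable_expk.
have ml : measurable_fun setT (fun s : measurableTypeR R => ((v < s)%R%:R : R)%:E).
  apply/measurable_EFinP; apply: measurableT_comp => //; exact: measurable_fun_ltr.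
have ml' : measurable_fun setT (fun s : measurableTypeR R => ((s <= v)%R%:R : R)%:E).
  apply/measurable_EFinP; apply: measurableT_comp => //; exact: measurable_fun_ler.
have n1 s : 0 <= ((v < s)%R%:R : R)%:E * (expk q s)%:E by rewrite mule_ge0 ?expkE_ge0// lee_fin.
have n2 s : 0 <= ((s <= v)%R%:R : R)%:E * (expk q s)%:E by rewrite mule_ge0 ?expkE_ge0// lee_fin.
have S : \int[leb]_s (((s <= v)%R%:R : R)%:E * (expk q s)%:E) +
         \int[leb]_s (((v < s)%R%:R : R)%:E * (expk q s)%:E) = (q^-1)%:E.
  rewrite -expk_int_pos// -ge0_integralD//.
  - apply: eq_integral => s _; rewrite ltNge; case: (leP s v) => _; 
    by rewrite ?mul1e ?mul0e ?adde0 ?add0e.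
  - exact: emeasurable_funM.
  - exact: emeasurable_funM.
have S2 := expk_int_itv q v0.
move: S2; under eq_integral => s _ do rewrite EFinM.
rewrite E ge0_integralZl//; last 2 first.
- exact: emeasurable_funM.
- by rewrite lee_fin ltW.
have I1 : 0 <= \int[leb]_s (((s <= v)%R%:R : R)%:E * (expk q s)%:E) by exact: integral_ge0.
have I2 : 0 <= \int[leb]_s (((v < s)%R%:R : R)%:E * (expk q s)%:E) by exact: integral_ge0.
move: S I1 I2.
case: (\int[leb]_s (((s <= v)%R%:R : R)%:E * (expk q s)%:E)) => [a||] //;
case: (\int[leb]_s (((v < s)%R%:R : R)%:E * (expk q s)%:E)) => [b||] //.
rewrite -EFinD => -[ab] _ _; rewrite -EFinM -EFinD => -[qa].
rewrite -EFinM; congr _%:E.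
have : (q * (a + b) = 1)%R by rewrite ab divff// gt_eqF.
rewrite mulrDr -qa => /addrI ->.
by rewrite /expk v0.
Qed.

Lemma expo_prob_integral (q : R) (A : set R) : measurable A -> 
  exponential_prob q A = \int[leb]_x ((\1_A x)%:E * (q * expk q x)%:E).
Proof.
move=> mA; rewrite /exponential_prob integral_mkcond; apply: eq_integral => x _.
rewrite patchE indicE; case: ifP => _; last by rewrite mul0e.
rewrite mul1e /exponential_pdf patchE mem_setE in_itv/= andbT /expk.
by case: ifP => _; rewrite ?mulr0// mulNr.
Qed.

Section joint_law.
Variables (F K : set Omega) (J S : Omega -> R) (q c : R).
Hypotheses (mF : measurable F) (mK : measurable K).
Hypotheses (mJ : measurable_fun setT J) (mS : measurable_fun setT S).
Hypotheses (q0 : (0 < q)%R) (c0 : (0 <= c)%R).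
Hypothesis Spos : forall w, (0 < S w)%R.
Hypothesis law : forall (B : set R) (u : R), measurable B -> (0 <= u)%R ->
  P (F `&` (J @^-1` B) `&` [set w | (u < S w)%R]) = P (K `&` (J @^-1` B)) * (c * expR (- (q * u)))%:E.

Let mpre (f : Omega -> R) (B : set R) : measurable_fun setT f -> measurable B -> measurable (f @^-1` B).
Proof. by move=> mf mB; rewrite -[X in measurable X]setTI; exact: mf. Qed.

Let rect (B1 B2 : set R) : measurable B1 -> measurable B2 ->
  P (F `&` (J @^-1` B1) `&` (S @^-1` B2)) = P (K `&` (J @^-1` B1)) * (c%:E * exponential_prob q B2).
Proof.
move=> m1 m2.
have mFJ : measurable (F `&` (J @^-1` B1)) by apply: measurableI => //; exact: mpre.
have mKJ : measurable (K `&` (J @^-1` B1)) by apply: measurableI => //; exact: mpre.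
pose a := (fine (P (K `&` (J @^-1` B1))) * c)%R.
have a0 : (0 <= a)%R by rewrite mulr_ge0// fine_ge0.
pose nu1 : {measure set (measurableTypeR R) -> \bar R} := pushforward (mrestr P mFJ) (S : Omega -> measurableTypeR R).
pose E : probability (measurableTypeR R) R := exponential_prob q.
pose nu2 : {measure set (measurableTypeR R) -> \bar R} := mscale (NngNum a0) (E q0).
(* A negative [u] reduces to 0 on both sides: [S] is positive everywhere, and the exponential law
   does not charge the negatives. *)
have ray u : nu1 mS `]u, +oo[%classic = nu2 `]u, +oo[%classic.
  rewrite /nu1 /= /pushforward /mrestr /nu2 /= /mscale/= expo_prob_ray//.
  set v := Num.max u 0%R.
  have -> : S @^-1` `]u, +oo[%classic `&` (F `&` J @^-1` B1) = F `&` J @^-1` B1 `&` [set w | (v < S w)%R].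
    rewrite setIC; congr (_ `&` _); apply/seteqP; split => w /=; rewrite in_itv/= andbT gt_max.
      by move=> ->/=.
    by move=> /andP[].
  by rewrite law ?le_max ?lexx ?orbT// /a EFinM -(fineK (prob_fin mKJ)) -!EFinM mulrA.
have -> : P (F `&` J @^-1` B1 `&` S @^-1` B2) = nu1 mS B2.
  by rewrite /nu1 /= /pushforward /mrestr setIC.
have -> : P (K `&` J @^-1` B1) * (c%:E * exponential_prob q B2) = nu2 B2.
  by rewrite /nu2 /= /mscale /= /a EFinM fineK ?prob_fin// muleA.
apply: (@measure_unique _ R (measurableTypeR R) (@RGenOInfty.G R) (fun n => `](- n%:R)%R, +oo[%classic)
  _ _ _ _ (nu1 mS) nu2) => //.
- exact: RGenOInfty.measurableE.
- move=> _ _ [x ->] [y ->]; exists (Num.max x y).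
  apply/seteqP; split => z /=; rewrite !in_itv/= !andbT gt_max; first by move=> [-> ->].
  by move=> /andP[].
- by move=> n; exists (- n%:R)%R.
- apply/seteqP; split => // x _; exists (Num.truncn `|x|).+1 => //=.
  rewrite in_itv/= andbT ltrNl; apply: le_lt_trans (truncnS_gt _).
  by rewrite -normrN ler_norm.
- by move=> A [x ->]; exact: ray.
- move=> n; rewrite ray /nu2 /= /mscale/= expo_prob_ray// -EFinM ltry//.
Qed.

(** Two uniqueness arguments: from rays to Borel sets for [S] with the event on [J] fixed ([rect]),
    then from rectangles to the plane. [F] may involve the path after the holding time; the constant
    [c] carries the weight of that future. *)
Lemma joint_lawE (C : set (R * R)) : measurable C ->
  P (F `&` [set w | C (J w, S w)]) =
  c%:E * \int[P]_w ((\1_K w)%:E * exponential_prob q (xsection C (J w))).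
Proof.
move=> mC.
have mJS : measurable_fun setT (fun w => (J w, S w)) by exact: measurable_fun_pair.
pose mp (p : Omega * R) := (J p.1, p.2).
have mmp : measurable_fun setT mp.
  by apply: measurable_fun_pair => //; exact: measurableT_comp.
have mKT : measurable (K `*` [set: R]) by exact: measurableX.
pose E' : probability (measurableTypeR R) R := exponential_prob q.
pose E := E' q0.
pose nu1' : {measure set (measurableTypeR R * measurableTypeR R) -> \bar R} :=
  pushforward (mrestr P mF) (fun w => (J w, S w) : measurableTypeR R * measurableTypeR R).
pose nu1 := nu1' mJS.
pose nu2' : {measure set (measurableTypeR R * measurableTypeR R) -> \bar R} :=
  pushforward (mrestr (P \x E) mKT) (mp : _ -> measurableTypeR R * measurableTypeR R).
pose nu2 := mscale (NngNum c0) (nu2' mmp).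
have -> : P (F `&` [set w | C (J w, S w)]) = nu1 C.
  by rewrite /nu1 /= /pushforward /mrestr setIC.
transitivity (nu2 C).
  have rc (B1 B2 : set (measurableTypeR R)) : measurable B1 -> measurable B2 -> nu1 (B1 `*` B2) = nu2 (B1 `*` B2).
    move=> m1 m2.
    have -> : nu2 (B1 `*` B2) = c%:E * (P \x E) ((K `&` J @^-1` B1) `*` B2).
      rewrite /nu2 /= /mscale/= /pushforward /mrestr; congr (_ * (_ \x _) _).
      by apply/seteqP; split => -[w x] /=; rewrite /mp/=; [move=> [[? ?] [? _]]|move=> [[? ?] ?]].
    rewrite product_measure1E//; last by apply: measurableI => //; exact: mpre.
    rewrite muleCA -rect// /nu1 /= /pushforward /mrestr; congr (P _).
    by apply/seteqP; split => w /=; [move=> [[? ?] ?]|move=> [[? ?] ?]].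
  apply: (@measure_unique _ R (measurableTypeR R * measurableTypeR R)%type
    [set A `*` B | A in measurable & B in measurable] (fun=> setT) _ _ _ _ nu1 nu2) => //.
  - by rewrite measurable_prod_measurableType.
  - move=> /= _ _ [A1 mA1 [A2 mA2 <-]] [B1 mB1 [B2 mB2 <-]].
    exists (A1 `&` B1); first exact: measurableI.
    by exists (A2 `&` B2); [exact: measurableI|rewrite setXI].
  - by move=> _; exists setT => //; exists setT => //; rewrite setXTT.
  - by rewrite bigcup_const//; exists 0%N.
  - by move=> A [A1 mA1 [A2 mA2 <-]]; exact: rc.
  - move=> _; rewrite /nu1 /= /pushforward /mrestr preimage_setT setTI.
    by apply: (le_lt_trans (probability_le1 _ mF)); rewrite ltry.
rewrite /nu2 /= /mscale/=; congr (_ * _).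
rewrite /pushforward /mrestr /product_measure1; apply: eq_integral => w _ /=.
have [wK|wK] := boolP (w \in K).
  rewrite indicE wK mul1e; congr (exponential_prob q _).
  apply/seteqP; split => x; rewrite /xsection/= !inE/=; first by move=> [].
  by move=> h; split => //; split => //; rewrite inE in wK.
rewrite indicE (negbTE wK) mul0e.
have -> : xsection (mp @^-1` C `&` K `*` setT) w = set0.
  apply/seteqP; split => x //; rewrite /xsection/= inE/= => -[_ [Kw _]].
  by move: wK; rewrite notin_setE.
by rewrite measure0.
Qed.

End joint_law.

End probability_helpers.

Section measurability_helpers.
Context d (Omega : measurableType d).

Lemma measurable_impl (b : bool) (Q : set Omega) : measurable Q ->
  measurable [set w | b -> Q w].
Proof.
case: b => mQ.
  by rewrite (_ : [set _ | _] = Q)//; apply/seteqP; split => w /=; [apply|move=> ? _].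
by rewrite (_ : [set _ | _] = setT)//; apply/seteqP; split.
Qed.

Lemma measurable_forall (Q : nat -> set Omega) : (forall k, measurable (Q k)) ->
  measurable [set w | forall k, Q k w].
Proof.
move=> mQ; rewrite (_ : [set _ | _] = \bigcap_k Q k); first exact: bigcapT_measurable.
by apply/seteqP; split => w H k; [move=> _; exact: H|exact: H].
Qed.

Lemma measurable_forall_impl (b : nat -> bool) (Q : nat -> set Omega) :
  (forall k, measurable (Q k)) -> measurable [set w | forall k, b k -> Q k w].
Proof.
by move=> mQ; apply: measurable_forall => k; exact: measurable_impl.
Qed.

Lemma measurable_exists (Q : nat -> set Omega) : (forall k, measurable (Q k)) ->
  measurable [set w | exists k, Q k w].
Proof.
move=> mQ; rewrite (_ : [set _ | _] = \bigcup_k Q k); first exact: bigcupT_measurable.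
by apply/seteqP; split => w; [move=> [k Qk]; exists k|move=> [k _ Qk]; exists k].
Qed.

Lemma measurable_conj (A B : set Omega) : measurable A -> measurable B ->
  measurable [set w | A w /\ B w].
Proof. exact: measurableI. Qed.

Lemma measurable_state_pred (Y : Omega -> state) (p : state -> Prop) :
  (forall z, measurable (Y @^-1` [set z])) -> measurable [set w | p (Y w)].
Proof.
move=> mY.
rewrite (_ : [set _ | _] = (\bigcup_k [set w | Y w = Some k /\ p (Some k)])
    `|` [set w | Y w = None /\ p None]).
  have mp z : measurable [set w | Y w = z /\ p z].
    have [pz|npz] := pselect (p z).
      by rewrite (_ : [set _ | _] = Y @^-1` [set z])//; apply/seteqP; split => w //= [].
    by rewrite (_ : [set _ | _] = set0)//; apply/seteqP; split => w //= [].
  by apply: measurableU; [exact: bigcupT_measurable|].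
apply/seteqP; split => w /=.
  by case E: (Y w) => [k|] pk; [left; exists k|right].
by move=> [[k _ [-> //]]|[-> //]].
Qed.

Variable R : realType.

Lemma measurable_setlt (f g : Omega -> R) : measurable_fun setT f -> measurable_fun setT g ->
  measurable [set w | (f w < g w)%R].
Proof.
move=> mf mg; have := measurable_fun_ltr mf mg measurableT (Y := [set true]).
by rewrite setTI => H; apply: H.
Qed.

Lemma measurable_setle (f g : Omega -> R) : measurable_fun setT f -> measurable_fun setT g ->
  measurable [set w | (f w <= g w)%R].
Proof.
move=> mf mg; have := measurable_fun_ler mf mg measurableT (Y := [set true]).
by rewrite setTI => H; apply: H.
Qed.

Lemma measurable_preim (f : Omega -> R) (B : set R) : measurable_fun setT f -> measurable B ->
  measurable [set w | B (f w)].
Proof. by move=> mf mB; have := mf measurableT B mB; rewrite setTI. Qed.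

Lemma state_split (P : probability Omega R) (Y : Omega -> state) (F : set Omega) :
  (forall z, measurable (Y @^-1` [set z])) -> measurable F ->
  (P F = P [set w | F w /\ Y w = None] + \sum_(k <oo) P [set w | F w /\ Y w = Some k])%E.
Proof.
move=> mY mF.
have mS z : measurable [set w | F w /\ Y w = z] by apply: measurable_conj => //; exact: mY.
have -> : (\sum_(k <oo) P [set w | F w /\ Y w = Some k])%E =
    P (\bigcup_k [set w | F w /\ Y w = Some k]).
  rewrite measure_bigcup//; last first.
    by apply/trivIsetP => i j _ _ ij; apply/seteqP; split => w //= [[_ ->] [_ []]] e; rewrite e eqxx in ij.
  by apply: eq_eseriesl => k /=; apply/esym; exact: mem_set.
rewrite -measureU//.
- congr (P _); apply/seteqP; split => w /=.
    by case E: (Y w) => [k|] Fw; [right; exists k|left].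
  by move=> [[]|[k _ []]].
- exact: bigcupT_measurable.
- by apply/seteqP; split => w //= -[[_ e1] [k _ [_]]]; rewrite e1.
Qed.

End measurability_helpers.

Section density_transfer.
Local Open Scope ereal_scope.
Context d (Omega : measurableType d) (R : realType).
Variable P : probability Omega R.
Notation leb := (@lebesgue_measure R).

Lemma layer_cake (x : R) : (0 <= x)%R ->
  \int[leb]_v (((0 <= v < x)%R%:R : R)%:E) = x%:E.
Proof.
move=> x0; rewrite -[RHS](_ : leb `[0%R, x[%classic = _); last first.
  rewrite lebesgue_measure_itv/= lte_fin; case: ltgtP x0 => // [x0 _|<- _//].
  by rewrite oppr0 adde0.
rewrite -[RHS]mul1e -integral_cst//= [RHS]integral_mkcond; apply: eq_integral => v _.
by rewrite patchE mem_setE in_itv/=; case: ifP.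
Qed.

(** The layer-cake formula writes [phi] as an integral of indicators of its level sets, and Tonelli
    reduces the claim to the hypothesis on Borel sets. *)
Lemma density_transfer (K : set Omega) (J : Omega -> R) (f : R -> \bar R) (phi : R -> R) :
  measurable K -> measurable_fun setT J -> measurable_fun setT f -> (forall u, 0 <= f u) ->
  (forall B, measurable B -> P (K `&` [set w | B (J w)]) = \int[leb]_u ((\1_B u)%:E * f u)) ->
  measurable_fun setT phi -> (forall u, (0 <= phi u)%R) ->
  \int[P]_w ((\1_K w)%:E * (phi (J w))%:E) = \int[leb]_u (f u * (phi u)%:E).
Proof.
move=> mK mJ mf f0 H mphi phi0.
have mI : measurable_fun setT (fun p : Omega * R => ((0 <= p.2 < phi (J p.1))%R%:R : R)%:E).
  apply/measurable_EFinP; apply: measurableT_comp => //; apply: measurable_and.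
    by apply: measurable_fun_ler.
  apply: measurable_fun_ltr => //; apply: measurableT_comp => //; exact: measurableT_comp.
have mI' : measurable_fun setT (fun p : R * R => ((0 <= p.2 < phi p.1)%R%:R : R)%:E).
  apply/measurable_EFinP; apply: measurableT_comp => //; apply: measurable_and.
    by apply: measurable_fun_ler.
  by apply: measurable_fun_ltr => //; apply: measurableT_comp.
have mkk : measurable_fun setT (fun w : Omega => (\1_K w)%:E : \bar R).
  by apply/measurable_EFinP; exact: measurable_indic.
transitivity (\int[P]_w \int[leb]_v ((\1_K w)%:E * ((0 <= v < phi (J w))%R%:R : R)%:E)).
  apply: eq_integral => w _; rewrite ge0_integralZl ?lee_fin//; last first.
    apply/measurable_EFinP; apply: measurableT_comp => //; apply: measurable_and; first exact: measurable_fun_ler.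
    by apply: measurable_fun_ltr.
  by rewrite layer_cake.
rewrite (@fubini_tonelli _ _ _ _ R P leb (fun p : Omega * R => (\1_K p.1)%:E * ((0 <= p.2 < phi (J p.1))%R%:R : R)%:E)); last 2 first.
- apply: emeasurable_funM => //; exact: (measurableT_comp mkk).
- by move=> p; rewrite mule_ge0// lee_fin.
transitivity (\int[leb]_v \int[leb]_u (f u * ((0 <= v < phi u)%R%:R : R)%:E)).
  apply: eq_integral => v _ /=.
  pose B := [set u | (0 <= v < phi u)%R].
  have mB : measurable B.
    rewrite /B; case: (leP 0%R v) => v0.
      by rewrite (_ : [set _ | _] = [set u | (v < phi u)%R])//; apply: (@measurable_setlt _ (measurableTypeR R)).
    by rewrite (_ : [set _ | _] = set0)//; apply/seteqP; split.
  have mKB : measurable (K `&` [set w | B (J w)]).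
    by apply: measurableI => //; exact: measurable_preim.
  transitivity (\int[P]_w (\1_(K `&` [set w | B (J w)]) w)%:E).
    apply: eq_integral => w _; rewrite indicI /= EFinM; congr (_ * (_)%:E).
    rewrite indicE; congr (_%:R); congr nat_of_bool.
    by apply/idP/idP; rewrite inE.
  transitivity (P (K `&` [set w | B (J w)])); first by rewrite integral_indic// setIT.
  rewrite H//; apply: eq_integral => u _.
  rewrite muleC indicE; congr (_ * (_)%:E); congr (_%:R); congr nat_of_bool.
  by apply/idP/idP; rewrite inE.
rewrite -(@tonelliRR R (fun u v => f u * ((0 <= v < phi u)%R%:R : R)%:E)); last 2 first.
- apply: emeasurable_funM; first exact: measurableT_comp.
  exact: mI'.
- by move=> u v; rewrite mule_ge0// lee_fin.
apply: eq_integral => u _; rewrite ge0_integralZl//.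
- by rewrite layer_cake.
- apply/measurable_EFinP; apply: measurableT_comp => //; apply: measurable_and; first exact: measurable_fun_ler.
  by apply: measurable_fun_ltr.
Qed.

End density_transfer.

(** * Law of a jump path observed while it stays in a set [D] of states; used for the killed chain
    and for the excursion chain *)

Section path_law.
Local Open Scope ereal_scope.
Context d (Omega : measurableType d) (R : realType).
Variable P : probability Omega R.
Notation leb := (@lebesgue_measure R).
Variables (Y : nat -> Omega -> state) (S : nat -> Omega -> R).
Variables (al : state -> R) (jp : state -> state -> R) (rt : state -> R) (D : pred nat).

Definition inDs (x : state) : bool := if x is Some k then D k else false.

Hypothesis mY : forall n z, measurable (Y n @^-1` [set z]).
Hypothesis mS : forall n, measurable_fun setT (S n).
Hypothesis Spos : forall n w, (0 < S n w)%R.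
Hypothesis jp0 : forall x y, (0 <= jp x y)%R.
Hypothesis rt0 : forall x, inDs x -> (0 < rt x)%R.
Hypothesis jp1 : forall l, D l ->
  (jp (Some l) None)%:E + \sum_(k <oo) (jp (Some l) (Some k))%:E = 1.

Definition pweight n (y : nat -> state) (s : nat -> R) : R :=
  (\prod_(k < n) (jp (y k) (y k.+1) * expR (- (rt (y k) * s k))))%R.

Hypothesis law : forall n (y : nat -> state) (s : nat -> R), (forall k, (0 <= s k)%R) ->
  (forall k, (k < n)%N -> inDs (y k)) ->
  P [set w | (forall k, (k <= n)%N -> Y k w = y k) /\
             (forall k, (k < n)%N -> (s k < S k w)%R)] = (al (y 0%N) * pweight n y s)%:E.

Definition jtime m (w : Omega) : R := (\sum_(k < m) S k w)%R.

Lemma measurable_jtime m : measurable_fun setT (jtime m).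
Proof. by rewrite /jtime; apply: measurable_sum => k. Qed.

Definition inD m := [set w | forall k, (k < m)%N -> inDs (Y k w)].

Lemma measurable_inD m : measurable (inD m).
Proof.
apply: (@measurable_forall_impl _ _ (fun k => (k < m)%N)) => k.
exact: (@measurable_state_pred _ _ _ (fun z => inDs z)).
Qed.

Definition fut m n (y : nat -> state) (s : nat -> R) :=
  [set w | (forall k, (k <= n)%N -> Y (m + k) w = y k) /\
           (forall k, (k < n)%N -> (s k < S (m + k) w)%R)].

Lemma measurable_Yeq n z : measurable [set w | Y n w = z].
Proof. exact: mY. Qed.

Lemma measurable_fut m n y s : measurable (fut m n y s).
Proof.
apply: measurable_conj.
  by apply: (@measurable_forall_impl _ _ (fun k => (k <= n)%N)) => k; exact: measurable_Yeq.
apply: (@measurable_forall_impl _ _ (fun k => (k < n)%N)) => k.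
by apply: measurable_setlt.
Qed.

Definition kap m z (B : set R) := P [set w | inD m w /\ B (jtime m w) /\ Y m w = z].

Lemma measurable_kapset m z B : measurable B ->
  measurable [set w | inD m w /\ B (jtime m w) /\ Y m w = z].
Proof.
move=> mB; apply: measurable_conj; first exact: measurable_inD.
apply: measurable_conj; last exact: measurable_Yeq.
exact: measurable_preim (measurable_jtime m) mB.
Qed.

Definition evt m n y s B := [set w | inD m w /\ B (jtime m w) /\ fut m n y s w].

Lemma measurable_evt m n y s B : measurable B -> measurable (evt m n y s B).
Proof.
move=> mB; apply: measurable_conj; first exact: measurable_inD.
apply: measurable_conj; last exact: measurable_fut.
exact: measurable_preim (measurable_jtime m) mB.
Qed.

Definition at_ m l := [set w | inD m w /\ Y m w = Some l].

Lemma measurable_at m l : measurable (at_ m l).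
Proof. by apply: measurable_conj; [exact: measurable_inD|exact: measurable_Yeq]. Qed.

Lemma pweight_ge0 n y s : (0 <= pweight n y s)%R.
Proof. by apply: prodr_ge0 => k _; rewrite mulr_ge0 ?expR_ge0. Qed.

Definition scons (T : Type) (x : T) (f : nat -> T) (k : nat) : T := if k is k'.+1 then f k' else x.

Lemma pweight_scons n x y u s :
  pweight n.+1 (scons x y) (scons u s) = (jp x (y 0%N) * expR (- (rt x * u)) * pweight n y s)%R.
Proof. by rewrite /pweight big_ord_recl. Qed.

(** Markov property at the [m]-th jump, jointly with the jump time: the past enters only through
    [kap], the law of that time on the event that the path stayed in [D] and is now at [y 0]. *)
Definition markov_at m := forall n y s B, measurable B -> (forall k, (0 <= s k)%R) ->
  (forall k, (k < n)%N -> inDs (y k)) ->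
  P (evt m n y s B) = kap m (y 0%N) B * (pweight n y s)%:E.

Lemma markov_at0 : markov_at 0.
Proof.
have j0 w : jtime 0 w = 0%R by rewrite /jtime big_ord0.
have inD0 w : inD 0 w by [].
move=> n y s B mB s0 yD.
have [B0|nB0] := pselect (B 0%R); last first.
  rewrite (_ : evt _ _ _ _ _ = set0); last first.
    by apply/seteqP; split => w //= [_ []]; rewrite j0.
  rewrite /kap (_ : [set _ | _] = set0) ?measure0 ?mul0e//.
  by apply/seteqP; split => w //= [_ []]; rewrite j0.
have -> : evt 0 n y s B = [set w | (forall k, (k <= n)%N -> Y k w = y k) /\
             (forall k, (k < n)%N -> (s k < S k w)%R)].
  by apply/seteqP; split => w /=; [move=> [_ [_ []]]|move=> H; split => //; rewrite j0; split].
rewrite law// /kap EFinM; congr (_ * _).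
have <- : P [set w | (forall k, (k <= 0)%N -> Y k w = y k) /\
             (forall k, (k < 0)%N -> (0 < S k w)%R)] = (al (y 0%N))%:E.
  by rewrite (law (s := fun=> 0%R))// /pweight big_ord0 mulr1.
congr (P _); apply/seteqP; split => w /=; first by move=> [H _]; rewrite j0; split=> //; split => //; exact: H.
by move=> [_ [_ H]]; split=> // k; rewrite leqn0 => /eqP ->.
Qed.

(** Applying [markov_at m] to the path [y] preceded by [l], with threshold [u] on the holding time
    in [l], gives exactly the ray identity that [joint_lawE] requires. *)
Lemma markov_joint m l n y s C : markov_at m -> D l -> measurable C -> (forall k, (0 <= s k)%R) ->
  (forall k, (k < n)%N -> inDs (y k)) ->
  P [set w | (at_ m l w /\ fut m.+1 n y s w) /\ C (jtime m w, S m w)] =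
  (jp (Some l) (y 0%N) * pweight n y s)%:E *
    \int[P]_w ((\1_(at_ m l) w)%:E * exponential_prob (rt (Some l)) (xsection C (jtime m w))).
Proof.
move=> Cm Dl mC s0 yD.
have mat := measurable_at m l; have mfut := measurable_fut m.+1 n y s.
apply: (@joint_lawE _ Omega R P (at_ m l `&` fut m.+1 n y s) (at_ m l) (jtime m) (S m) (rt (Some l))) => //.
- exact: measurableI.
- exact: measurable_jtime.
- exact: rt0.
- by rewrite mulr_ge0// pweight_ge0.
move=> B u mB u0.
have := Cm n.+1 (scons (Some l) y) (scons u s) B mB _ _.
rewrite pweight_scons /= => H.
rewrite (_ : (_ * _ * expR _ = jp (Some l) (y 0%N) * expR (- (rt (Some l) * u)) * pweight n y s)%R); last by ring.
transitivity (P (evt m n.+1 (scons (Some l) y) (scons u s) B)).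
  congr (P _); apply/seteqP; split => w /=.
    move=> [[[[iw Yw] [fY fS]] Bw] us]; split => //; split => //; split.
      by move=> [_|k]/=; [rewrite addn0|rewrite ltnS -addSnnS; exact: fY].
    by move=> [_|k]/=; [rewrite addn0|rewrite ltnS -addSnnS; exact: fS].
  move=> [iw [Bw [fY fS]]]; split; last by have := fS 0%N (ltn0Sn _); rewrite addn0.
  split => //; split; first by split => //; have := fY 0%N (leq0n _); rewrite addn0.
  split => k kn; rewrite addSnnS; [exact: (fY k.+1)|exact: (fS k.+1)].
rewrite H.
- congr (_ * _); rewrite /kap; congr (P _); apply/seteqP; split => w /=.
    by move=> [? [? ?]].
  by move=> [[? ?] ?].
- by case.
- by case => //= _; exact: Dl.
Qed.

Let mexpk q m : measurable_fun setT (fun p : Omega * R => ((expk q (p.2 - jtime m p.1))%:E : \bar R)).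
Proof.
apply/measurable_EFinP; apply: measurableT_comp; first exact: measurable_expk.
apply: measurable_funB => //; apply: measurableT_comp => //; exact: measurable_jtime.
Qed.

Let mind (K : set Omega) : measurable K -> measurable_fun setT (fun w : Omega => (\1_K w)%:E : \bar R).
Proof. by move=> mK; apply/measurable_EFinP; exact: measurable_indic. Qed.

Definition hold_at m l x :=
  \int[P]_w ((\1_(at_ m l) w)%:E * (expk (rt (Some l)) (x - jtime m w))%:E).

Lemma hold_at_ge0 m l x : 0 <= hold_at m l x.
Proof. by apply: integral_ge0 => w _; rewrite mule_ge0 ?expkE_ge0// lee_fin. Qed.

Let mhold m l : measurable_fun setT (fun p : Omega * R =>
  (\1_(at_ m l) p.1)%:E * (expk (rt (Some l)) (p.2 - jtime m p.1))%:E).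
Proof.
apply: emeasurable_funM; last exact: mexpk.
exact: (measurableT_comp (mind (measurable_at m l))).
Qed.

Lemma measurable_hold_at m l : measurable_fun setT (hold_at m l).
Proof.
apply: (@measurable_fun_fubini_tonelli_G _ _ _ _ R P (fun p : Omega * R =>
  (\1_(at_ m l) p.1)%:E * (expk (rt (Some l)) (p.2 - jtime m p.1))%:E)) => //.
by move=> p; rewrite mule_ge0 ?expkE_ge0// lee_fin.
Qed.

(** Translating the exponential law by the current jump time shows that the next jump time has
    density rate times [hold_at], the intensity of leaving [l] at time x. *)
Lemma next_time_law m l B : D l -> measurable B ->
  \int[P]_w ((\1_(at_ m l) w)%:E * exponential_prob (rt (Some l))
     (xsection [set p : R * R | B (p.1 + p.2)%R] (jtime m w))) =
  \int[leb]_x ((\1_B x)%:E * ((rt (Some l))%:E * hold_at m l x)).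
Proof.
move=> Dl mB; set q := rt (Some l).
have q0 : (0 < q)%R by exact: rt0.
have mBi : measurable_fun setT (fun x : measurableTypeR R => (\1_B x)%:E : \bar R).
  by apply/measurable_EFinP; exact: measurable_indic.
have mexp : measurable_fun setT (fun x : measurableTypeR R => (expk q x)%:E).
  by apply/measurable_EFinP; exact: measurable_expk.
transitivity (\int[P]_w \int[leb]_x ((\1_B x)%:E * (q%:E *
   ((\1_(at_ m l) w)%:E * (expk q (x - jtime m w))%:E)))).
  apply: eq_integral => w _.
  have -> : exponential_prob q (xsection [set p : R * R | B (p.1 + p.2)%R] (jtime m w)) =
            \int[leb]_x ((\1_B x)%:E * (q%:E * (expk q (x - jtime m w))%:E)).
    have -> : xsection [set p : R * R | B (p.1 + p.2)%R] (jtime m w) = [set v | B (jtime m w + v)%R].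
      by apply/seteqP; split => v; rewrite /xsection/= inE.
    have mBs : measurable [set v | B (jtime m w + v)%R].
      by apply: (@measurable_preim _ (measurableTypeR R) R (fun v => jtime m w + v)%R) => //;
        exact: measurable_funD.
    rewrite (expo_prob_integral q mBs).
    rewrite -[RHS](@integral_shift R _ (jtime m w)).
    - apply: eq_integral => v _; rewrite addrK EFinM; congr (_ * _).
      rewrite !indicE; congr (_%:R%:E); congr nat_of_bool.
      by apply/idP/idP; rewrite !inE/= addrC.
    - apply: emeasurable_funM => //; apply: emeasurable_funM => //.
      by apply: measurableT_comp mexp _; exact: measurable_funB.
    - by move=> x; rewrite !mule_ge0 ?expkE_ge0// lee_fin// ltW.
  rewrite -ge0_integralZl ?lee_fin//.
  - by apply: eq_integral => x _; rewrite muleCA; congr (_ * _); rewrite muleCA.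
  - apply: emeasurable_funM => //; apply: emeasurable_funM => //.
    by apply: measurableT_comp mexp _; exact: measurable_funB.
  - by move=> x _; rewrite !mule_ge0 ?expkE_ge0// lee_fin// ltW.
rewrite (@fubini_tonelli _ _ _ _ R P leb (fun p : Omega * R => (\1_B p.2)%:E * (q%:E *
   ((\1_(at_ m l) p.1)%:E * (expk q (p.2 - jtime m p.1))%:E)))); last 2 first.
- apply: emeasurable_funM; first exact: (measurableT_comp mBi).
  by apply: emeasurable_funM => //; exact: mhold.
- by move=> p; rewrite !mule_ge0 ?expkE_ge0// lee_fin// ltW.
have mh x : measurable_fun setT (fun w => (\1_(at_ m l) w)%:E * (expk q (x - jtime m w))%:E).
  apply: emeasurable_funM; first exact: mind (measurable_at m l).
  apply/measurable_EFinP; apply: measurableT_comp; first exact: measurable_expk.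
  by apply: measurable_funB => //; exact: measurable_jtime.
apply: eq_integral => x _ /=; rewrite ge0_integralZl ?lee_fin//.
- rewrite ge0_integralZl ?lee_fin ?(ltW q0)// => w _.
  by rewrite !mule_ge0 ?expkE_ge0// lee_fin.
- exact: emeasurable_funM.
- by move=> w _; rewrite !mule_ge0 ?expkE_ge0// lee_fin// ltW.
Qed.

Definition dens m z x := \sum_(l <oo) (if D l then
  (jp (Some l) z)%:E * ((rt (Some l))%:E * hold_at m l x) else 0).

Lemma dens_ge0 m z x : 0 <= dens m z x.
Proof.
apply: nneseries_ge0T => l; case: ifP => // Dl.
by rewrite !mule_ge0 ?hold_at_ge0// lee_fin// ltW// rt0.
Qed.

Lemma measurable_dens m z : measurable_fun setT (dens m z).
Proof.
apply: measurable_seriesT => [l|l x].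
  case: (D l); last exact: measurable_cst.
  by apply: emeasurable_funM => //; apply: emeasurable_funM => //; exact: measurable_hold_at.
by case: ifP => // Dl; rewrite !mule_ge0 ?hold_at_ge0// lee_fin// ltW// rt0.
Qed.

(** Sum over the state [l] occupied before the jump. The right-hand side separates the time and
    state of the jump from the weight of the future, which is the Markov property one index
    later. *)
Lemma evtS m n y s B : markov_at m -> measurable B -> (forall k, (0 <= s k)%R) ->
  (forall k, (k < n)%N -> inDs (y k)) ->
  P (evt m.+1 n y s B) =
  \int[leb]_x ((\1_B x)%:E * dens m (y 0%N) x) * (pweight n y s)%:E.
Proof.
move=> Cm mB s0 yD.
rewrite (@state_split _ Omega R P (Y m) (evt m.+1 n y s B)) => [|z|]; last 2 first.
- exact: mY.
- exact: measurable_evt.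
rewrite [X in X + _](_ : _ = 0) ?add0e; last first.
  rewrite (_ : [set _ | _] = set0) ?measure0//; apply/seteqP; split => w //= [[iw _] e].
  by have := iw m (ltnSn m); rewrite e.
have mBi : measurable_fun setT (fun x : measurableTypeR R => (\1_B x)%:E : \bar R).
  by apply/measurable_EFinP; exact: measurable_indic.
pose I l := \int[leb]_x ((\1_B x)%:E * ((rt (Some l))%:E * hold_at m l x)).
have q0 l : D l -> 0 <= (rt (Some l))%:E by move=> Dl; rewrite lee_fin ltW// rt0.
have I0 l : D l -> 0 <= I l.
  by move=> Dl; apply: integral_ge0 => x _; rewrite !mule_ge0 ?q0 ?hold_at_ge0// lee_fin.
transitivity (\sum_(l <oo) ((if D l then (jp (Some l) (y 0%N))%:E * I l else 0) * (pweight n y s)%:E)).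
  apply: eq_eseriesr => l _; case: ifPn => Dl; last first.
    rewrite mul0e (_ : [set _ | _] = set0) ?measure0//; apply/seteqP; split => w //= [[iw _] e].
    by have := iw m (ltnSn m); rewrite e /= (negbTE Dl).
  have mC : measurable [set p : R * R | B (p.1 + p.2)%R].
    apply: (@measurable_preim _ (measurableTypeR R * measurableTypeR R)%type R (fun p => p.1 + p.2)%R) => //.
    exact: measurable_funD.
  rewrite muleAC -EFinM /I -next_time_law// -markov_joint//.
  congr (P _); apply/seteqP; split => w /=.
    move=> [[iw [Bw fw]] e]; split; last by move: Bw; rewrite /jtime big_ord_recr.
    by split => //; split=> // k km; apply: iw; exact: ltnW.
  move=> [[[iw e] fw] Bw]; split => //; split; last by rewrite /jtime big_ord_recr.
  move=> k; rewrite ltnS leq_eqVlt => /predU1P[->|]; last exact: iw.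
  by rewrite e.
rewrite nneseriesZre ?lee_fin ?pweight_ge0//; last first.
  by move=> l; case: ifP => // Dl; rewrite mule_ge0 ?I0// lee_fin.
congr (_ * _); rewrite /dens.
transitivity (\int[leb]_x \sum_(l <oo) ((\1_B x)%:E * (if D l then
  (jp (Some l) (y 0%N))%:E * ((rt (Some l))%:E * hold_at m l x) else 0))).
  rewrite integral_seriesT.
  - apply: eq_eseriesr => l _; have [Dl|Dl] := boolP (D l); last first.
      by under eq_integral => x _ do rewrite mule0; rewrite integral0.
    rewrite /I -ge0_integralZl ?lee_fin//.
    + by apply: eq_integral => x _; rewrite muleCA.
    + apply: emeasurable_funM => //; apply: emeasurable_funM => //; exact: measurable_hold_at.
    + by move=> x _; rewrite !mule_ge0 ?q0 ?hold_at_ge0// lee_fin.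
  - move=> l; apply: emeasurable_funM => //; case: (D l); last exact: measurable_cst.
    by apply: emeasurable_funM => //; apply: emeasurable_funM => //; exact: measurable_hold_at.
  - move=> l x; case: ifP => Dl; last by rewrite mule0.
    by rewrite !mule_ge0 ?q0 ?hold_at_ge0// lee_fin.
apply: eq_integral => x _; rewrite nneseriesZle ?lee_fin// => l.
by case: ifP => // Dl; rewrite !mule_ge0 ?q0 ?hold_at_ge0// lee_fin.
Qed.

Lemma kap_evt m z B : kap m z B = P (evt m 0 (fun=> z) (fun=> 0%R) B).
Proof.
rewrite /kap; congr (P _); apply/seteqP; split => w /= [iw [Bw]].
  by move=> e; split => //; split => //; split => // k; rewrite leqn0 => /eqP ->; rewrite addn0.
by move=> [fw _]; split => //; split => //; have := fw 0%N (leqnn 0); rewrite addn0.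
Qed.

Lemma markov_all m : markov_at m.
Proof.
elim: m => [|m IH]; first exact: markov_at0.
move=> n y s B mB s0 yD; rewrite evtS// kap_evt evtS//.
by rewrite {2}/pweight big_ord0 mule1.
Qed.

Lemma kapS m z B : measurable B ->
  kap m.+1 z B = \int[leb]_x ((\1_B x)%:E * dens m z x).
Proof.
move=> mB; rewrite kap_evt evtS//; last exact: markov_all.
by rewrite /pweight big_ord0 mule1.
Qed.

(** Identifies [hold_at] as a probability. The path law controls a holding time only together with
    the state that follows it, so the event is split over that state and recombined by [jp1]. *)
Lemma hold_atE m l x : D l ->
  P [set w | at_ m l w /\ (jtime m w <= x < jtime m w + S m w)%R] = hold_at m l x.
Proof.
move=> Dl; set q := rt (Some l); have q0 : (0 < q)%R by exact: rt0.
pose C := [set p : R * R | (p.1 <= x < p.1 + p.2)%R].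
have mC : measurable C.
  rewrite (_ : C = [set p : R * R | (p.1 <= x)%R /\ (x < p.1 + p.2)%R]).
    apply: measurable_conj.
      exact: (@measurable_setle _ (measurableTypeR R * measurableTypeR R)%type R).
    apply: (@measurable_setlt _ (measurableTypeR R * measurableTypeR R)%type R) => //.
    exact: measurable_funD.
  by apply/seteqP; split => p /=; [move/andP|move=> H; apply/andP].
have mset : measurable [set w | at_ m l w /\ (jtime m w <= x < jtime m w + S m w)%R].
  apply: measurable_conj; first exact: measurable_at.
  have mJS : measurable_fun setT (fun w => (jtime m w, S m w)).
    by apply: measurable_fun_pair => //; exact: measurable_jtime.
  by have := mJS measurableT C mC; rewrite setTI.
pose I := \int[P]_w ((\1_(at_ m l) w)%:E * exponential_prob q (xsection C (jtime m w))).
have I0 : 0 <= I.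
  apply: integral_ge0 => w _; rewrite mule_ge0 ?lee_fin//.
  apply: integral_ge0 => v _; rewrite lee_fin exponential_pdf_ge0// ltW//.
transitivity I; last first.
  apply: eq_integral => w _; congr (_ * _); set u := jtime m w.
  have [ux|xu] := leP u x.
    have -> : xsection C u = `](x - u)%R, +oo[%classic.
      by apply/seteqP; split => v; rewrite /xsection/= inE/= in_itv/= andbT /C/= ux/= ltrBlDl.
    rewrite expo_prob_ray// /expk subr_ge0 ux; congr (expR (- (_ * _)))%:E.
    by apply/max_idPl; rewrite subr_ge0.
  have -> : xsection C u = set0.
    by apply/seteqP; split => v //; rewrite /xsection/= inE/= /C/= leNgt xu.
  rewrite /exponential_prob integral_set0 /expk ifF//.
  by apply/negbTE; rewrite subr_ge0 -ltNge.
rewrite (@state_split _ Omega R P (Y m.+1) _ (@mY m.+1) mset).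
have E z : P [set w | (at_ m l w /\ (jtime m w <= x < jtime m w + S m w)%R) /\ Y m.+1 w = z] =
    (jp (Some l) z)%:E * I.
  have := @markov_joint m l 0 (fun=> z) (fun=> 0%R) C (@markov_all m) Dl mC (fun=> lexx _) _.
  rewrite /pweight big_ord0 mulr1 => <-//; congr (P _); apply/seteqP; split => w /=.
    by move=> [[aw jw] e]; split => //; split => //; split => // k; rewrite leqn0 => /eqP ->; rewrite addn0.
  move=> [[aw [fw _]] jw]; split => //; by have := fw 0%N (leqnn 0); rewrite addn0.
rewrite E (eq_eseriesr (fun k _ => E (Some k))).
have -> : \sum_(i <oo) ((jp (Some l) (Some i))%:E * I) = (\sum_(i <oo) (jp (Some l) (Some i))%:E) * I.
  by rewrite nneseriesZre// => k; rewrite lee_fin.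
rewrite -ge0_muleDl ?lee_fin//; last by apply: nneseries_ge0T => k; rewrite lee_fin.
by rewrite jp1// mul1e.
Qed.

Lemma hold_at0 l x : D l -> hold_at 0 l x = (al (Some l))%:E * (expk (rt (Some l)) x)%:E.
Proof.
move=> Dl.
have E : P (at_ 0 l) = (al (Some l))%:E.
  have := @law 0%N (fun=> Some l) (fun=> 0%R) (fun=> lexx _) _.
  rewrite /pweight big_ord0 mulr1 => <-//; congr (P _); apply/seteqP; split => w /=.
    by move=> [_ e]; split => // k; rewrite leqn0 => /eqP ->.
  by move=> [H _]; split => //; exact: H.
rewrite /hold_at; under eq_integral => w _ do rewrite /jtime big_ord0 subr0.
have mm := mind (measurable_at 0%N l).
rewrite ge0_integralZr ?expkE_ge0//.
by rewrite integral_indic ?setIT//; [rewrite -E|exact: measurable_at].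
Qed.

Lemma hold_atS m j x : hold_at m.+1 j x =
  \int[leb]_u (dens m (Some j) u * (expk (rt (Some j)) (x - u))%:E).
Proof.
apply: (@density_transfer _ Omega R P (at_ m.+1 j) (jtime m.+1) (dens m (Some j))
  (fun u => expk (rt (Some j)) (x - u))).
- exact: measurable_at.
- exact: measurable_jtime.
- exact: measurable_dens.
- exact: dens_ge0.
- move=> B mB; rewrite -kapS// /kap; congr (P _); apply/seteqP; split => w /=.
    by move=> [[? ?] ?].
  by move=> [? [? ?]].
- apply: measurableT_comp; first exact: measurable_expk.
  exact: measurable_funB.
- by move=> u; exact: expk_ge0.
Qed.

Definition Aker (l j : nat) : R := if D l && D j then (jp (Some l) (Some j) * rt (Some l))%R else 0%R.
Definition aker (j : nat) : \bar R := if D j then (al (Some j))%:E else 0.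
Definition qker (j : nat) : R := rt (Some j).

Lemma Aker_ge0 l j : (0 <= Aker l j)%R.
Proof.
rewrite /Aker; case: ifP => // /andP[Dl _]; rewrite mulr_ge0// ltW//; exact: rt0.
Qed.

Lemma jker_off m j x : ~~ D j -> jker Aker qker aker m j x = 0.
Proof.
move=> Dj; case: m => [|m] /=; first by rewrite /aker (negbTE Dj) mul0e.
rewrite integral0_eq// => s _; rewrite /flux eseries0 ?mul0e// => k _ _.
by rewrite /Aker (negbTE Dj) andbF mule0.
Qed.

(** Both satisfy the same recursion in the number of jumps: [hold_atS] is the convolution defining
    [jker], with jump rate equal to jump probability times holding rate. *)
Lemma hold_at_jker m j x : D j -> hold_at m j x = jker Aker qker aker m j x.
Proof.
elim: m j x => [|m IH] j x Dj; first by rewrite hold_at0//= /aker Dj.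
rewrite hold_atS jkerS; apply: eq_integral => u _; congr (_ * _).
rewrite /dens /flux; apply: eq_eseriesr => l _; case: ifPn => Dl; last first.
  by rewrite jker_off// mul0e.
by rewrite IH// /Aker Dl Dj/= EFinM [RHS]muleC -muleA.
Qed.

Lemma densE m z x : dens m z x =
  \sum_(l <oo) (jker Aker qker aker m l x * (jp (Some l) z * rt (Some l))%:E).
Proof.
apply: eq_eseriesr => l _; case: ifPn => Dl; last by rewrite jker_off// mul0e.
by rewrite hold_at_jker// EFinM [RHS]muleC -muleA.
Qed.

End path_law.

Section qmatrix.
Local Open Scope ereal_scope.
Variable R : realType.
Variable Q : state -> state -> R.
Hypothesis HQ : is_Qmatrix Q.
Hypothesis QN : forall y, Q None y = 0%R.

Definition offdiag (i j : nat) : R := if i == j then 0%R else Q (Some i) (Some j).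

Lemma offdiag_ge0 i j : (0 <= offdiag i j)%R.
Proof.
rewrite /offdiag; case: eqP => // /eqP ij; apply: HQ.1.
by apply: contra ij => /eqP [->].
Qed.

Lemma nneseries_of_cvg (f : nat -> R) (l : R) : (forall k, (0 <= f k)%R) ->
  (fun n : nat => (\sum_(k < n) f k)%R) @ \oo --> l -> \sum_(k <oo) (f k)%:E = l%:E.
Proof.
move=> f0 fl; apply/cvg_lim => //.
rewrite (_ : (fun n => _) = (fun n => ((\sum_(k < n) f k)%R)%:E)).
  by apply: cvg_EFin => //; exact: nearW.
by apply/funext => n; rewrite sumEFin big_mkord.
Qed.

Lemma offdiag_sum i : \sum_(j <oo) (offdiag i j)%:E = (qrate Q (Some i) - Q (Some i) None)%:E.
Proof.
apply: nneseries_of_cvg => [j|]; first exact: offdiag_ge0.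
rewrite /qrate.
apply: (@cvg_trans _ ((fun n : nat => (- Q (Some i) (Some i) + \sum_(k < n) Q (Some i) (Some (k : nat)))%R) @ \oo)).
  apply: near_eq_cvg; near=> n.
  have ni : (i < n)%N by near: n; exists i.+1.
  rewrite (bigD1 (Ordinal ni))//= [in RHS](bigD1 (Ordinal ni))//= /offdiag eqxx add0r addrA addNr add0r.
  apply: eq_bigr => k ki; case: eqP => // ik; exfalso; move/eqP: ki; apply.
  by apply: val_inj; rewrite /= ik.
by apply: cvgD; [exact: cvg_cst|exact: HQ.2].
Unshelve. all: by end_near. Qed.

Lemma qrate_ge0 x : (0 <= qrate Q x)%R.
Proof.
case: x => [i|]; last by rewrite /qrate QN oppr0.
have H : (0 <= qrate Q (Some i) - Q (Some i) None)%R.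
  by rewrite -lee_fin -offdiag_sum; apply: nneseries_ge0T => j; rewrite lee_fin offdiag_ge0.
by apply: le_trans H _; rewrite gerBl HQ.1.
Qed.

Lemma jprob_ge0 x y : (0 <= jprob Q x y)%R.
Proof.
rewrite /jprob; case: ifP => _; first by case: eqP.
by case: eqP => // /eqP xy; rewrite divr_ge0 ?qrate_ge0// HQ.1.
Qed.

Lemma jprob_Some i j : (0 < qrate Q (Some i))%R ->
  jprob Q (Some i) (Some j) = (offdiag i j / qrate Q (Some i))%R.
Proof.
move=> q0; rewrite /jprob gt_eqF// /offdiag.
have -> : (Some i == Some j) = (i == j) by apply/eqP/eqP => [[]|->].
by case: eqP => // _; rewrite mul0r.
Qed.

Lemma jprob_sum x : (jprob Q x None)%:E + \sum_(k <oo) (jprob Q x (Some k))%:E = 1.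
Proof.
have [q0|qn0] := eqVneq (qrate Q x) 0%R.
  rewrite /jprob q0 eqxx; case: x q0 => [i|] _ /=.
    rewrite add0e; under eq_eseriesr => k _.
      rewrite (_ : (Some i == Some k) = (k == i)); last by apply/eqP/eqP => [[]|->].
      rewrite -[X in X%:E]mulr1 EFinM.
      over.
    by rewrite nneseries_delta.
  by rewrite eseries0 ?adde0.
have q0 : (0 < qrate Q x)%R by rewrite lt_neqAle eq_sym qn0 qrate_ge0.
case: x qn0 q0 => [i|]; last by rewrite /qrate QN oppr0 eqxx.
move=> qn0 q0.
under eq_eseriesr => k _ do rewrite jprob_Some// EFinM.
rewrite nneseriesZre ?lee_fin ?invr_ge0 ?(ltW q0)//; last by move=> k; rewrite lee_fin offdiag_ge0.
rewrite offdiag_sum -EFinM /jprob gt_eqF//= -EFinD -mulrDl addrC subrK divff//.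
Qed.

End qmatrix.

(** * Almost sure regularity of the jump chain and real-valued holding times *)

Section ctmc_clean.
Local Open Scope ereal_scope.
Context d (Omega : measurableType d) (R : realType).
Variable P : probability Omega R.
Variable Q : state -> state -> R.
Variable x0 : state.
Hypothesis HQ : is_Qmatrix Q.
Hypothesis QN : forall y, Q None y = 0%R.
Variables (Y : nat -> Omega -> state) (J : nat -> Omega -> \bar R).
Hypothesis mY : forall n y, measurable (Y n @^-1` [set y]).
Hypothesis mJ : forall n, measurable_fun [set: Omega] (J n : Omega -> \bar R).
Hypothesis law : forall n (y : nat -> state) (s : nat -> R), (forall k, (0 <= s k)%R) ->
  P [set w | (forall k, (k <= n)%N -> Y k w = y k) /\
             (forall k, (k < n)%N -> ((s k)%:E < hold J k w)%E)]
         = ((y 0%N == x0)%:R *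
            \prod_(k < n) (jprob Q (y k) (y k.+1) *
                           expR (- qrate Q (y k) * s k)))%:E.

Lemma measurable_hold n : measurable_fun setT (hold J n).
Proof.
apply: measurable_fun_ifT.
- by apply: measurable_fun_eqe.
- exact: measurable_cst.
- exact: emeasurable_funB.
Qed.

Lemma measurable_setlte (f g : Omega -> \bar R) : measurable_fun setT f -> measurable_fun setT g ->
  measurable [set w | f w < g w].
Proof.
by move=> mf mg; have := emeasurable_fun_lt measurableT mf mg; rewrite setTI.
Qed.

Definition cyl n (y : nat -> state) := [set w | forall k, (k <= n)%N -> Y k w = y k].

Lemma measurable_cyl n y : measurable (cyl n y).
Proof. by apply: (@measurable_forall_impl _ _ (fun k => (k <= n)%N)) => k; exact: mY. Qed.

Definition upd (y : nat -> state) n z : nat -> state := fun k => if (k <= n)%N then y k else z.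

Lemma cylS n y z w : cyl n.+1 (upd y n z) w <-> cyl n y w /\ Y n.+1 w = z.
Proof.
split=> [H|[H e] k].
  split; last by rewrite H// /upd ltnn.
  by move=> k kn; rewrite H ?leqW// /upd kn.
by rewrite leq_eqVlt => /predU1P[->|]; rewrite /upd ?ltnn// ltnS => kn; rewrite kn H.
Qed.

(** Only countably many initial paths of length [n.+1] exist, so an event that is null on each of
    them is null. *)
Lemma path_null n (F : set Omega) : measurable F ->
  (forall y, P [set w | cyl n y w /\ F w] = 0) -> P F = 0.
Proof.
move=> mF; elim: n => [|n IH] H.
  rewrite (state_split P (@mY 0%N) mF).
  have E z : P [set w | F w /\ Y 0 w = z] = 0.
    rewrite -(H (fun=> z)); congr (P _); apply/seteqP; split => w /=.
      by move=> [Fw e]; split => // k; rewrite leqn0 => /eqP ->.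
    by move=> [c Fw]; split => //; exact: c.
  by rewrite E eseries0 ?adde0.
apply: IH => y.
have mc : measurable [set w | cyl n y w /\ F w] by apply: measurable_conj => //; exact: measurable_cyl.
rewrite (state_split P (@mY n.+1) mc).
have E z : P [set w | (cyl n y w /\ F w) /\ Y n.+1 w = z] = 0.
  rewrite -(H (upd y n z)); congr (P _); apply/seteqP; split => w /=.
    by move=> [[cw Fw] e]; split => //; apply/cylS.
  by move=> [/cylS [? ?] ?].
by rewrite E eseries0 ?adde0.
Qed.

Definition holdpos n := [set w | forall k, (k < n)%N -> 0 < hold J k w].

Lemma measurable_holdgt n u : measurable [set w | u < hold J n w].
Proof. by apply: measurable_setlte => //; exact: measurable_hold. Qed.

Lemma measurable_holdpos n : measurable (holdpos n).
Proof.
by apply: (@measurable_forall_impl _ _ (fun k => (k < n)%N)) => k; exact: measurable_holdgt.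
Qed.

Definition cylw n (y : nat -> state) : R := ((y 0%N == x0)%:R * \prod_(k < n) jprob Q (y k) (y k.+1))%R.

Lemma cylw_ge0 n y : (0 <= cylw n y)%R.
Proof. by rewrite mulr_ge0//; apply: prodr_ge0 => k _; apply: jprob_ge0. Qed.

Lemma cyl_pos n y : P [set w | cyl n y w /\ holdpos n w] = (cylw n y)%:E.
Proof.
rewrite (@law n y (fun=> 0%R) (fun=> lexx _))//; congr (_%:E); rewrite /cylw; congr (_ * _)%R.
by apply: eq_bigr => k _; rewrite mulr0 expR0 mulr1.
Qed.

(** The law with [n.+1] holding times also prescribes the state [Y n.+1]; summing over it by
    [jprob_sum] isolates the last holding time. *)
Lemma cyl_hold n y u : (0 <= u)%R ->
  P [set w | (cyl n y w /\ holdpos n w) /\ u%:E < hold J n w] =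
  (cylw n y * expR (- qrate Q (y n) * u))%:E.
Proof.
move=> u0.
have mc : measurable [set w | (cyl n y w /\ holdpos n w) /\ u%:E < hold J n w].
  apply: measurable_conj; last exact: measurable_holdgt.
  by apply: measurable_conj; [exact: measurable_cyl|exact: measurable_holdpos].
have E z : P [set w | ((cyl n y w /\ holdpos n w) /\ u%:E < hold J n w) /\ Y n.+1 w = z] =
   (cylw n y * expR (- qrate Q (y n) * u))%:E * (jprob Q (y n) z)%:E.
  pose s k : R := if (k < n)%N then 0%R else u.
  have := @law n.+1 (upd y n z) s _; rewrite big_ord_recr/= => H.
  transitivity (P [set w | (forall k, (k <= n.+1)%N -> Y k w = upd y n z k) /\
      (forall k, (k < n.+1)%N -> ((s k)%:E < hold J k w)%E)]).
    congr (P _); apply/seteqP; split => w /=.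
      move=> [[[cw hw] uw] e]; split; first by apply/cylS.
      move=> k; rewrite ltnS leq_eqVlt => /predU1P[->|kn]; first by rewrite /s ltnn.
      by rewrite /s kn; exact: hw.
    move=> [/cylS [cw e] hw]; split => //; split; last by have := hw n (ltnSn n); rewrite /s ltnn.
    by split => // k kn; have := hw k (ltnW kn); rewrite /s kn.
  rewrite H; last by move=> k; rewrite /s; case: ifP.
  rewrite -EFinM; congr (_%:E).
  rewrite {1}/upd leq0n /cylw -!mulrA; congr (_ * _)%R.
  rewrite [X in (X * _)%R](_ : _ = \prod_(k < n) jprob Q (y k) (y k.+1))%R; last first.
    apply: eq_bigr => k _; rewrite /upd (ltnW (ltn_ord k)) ltn_ord /s ltn_ord.
    by rewrite mulr0 expR0 mulr1.
  by rewrite /upd leqnn ltnn /s ltnn; congr (_ * _)%R; rewrite mulrC.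
rewrite (state_split P (@mY n.+1) mc) E (eq_eseriesr (fun k _ => E (Some k))).
have w0 : 0 <= (cylw n y * expR (- qrate Q (y n) * u))%:E.
  by rewrite lee_fin mulr_ge0 ?expR_ge0//; exact: cylw_ge0.
rewrite nneseriesZle//; last by move=> k; rewrite lee_fin jprob_ge0.
rewrite -ge0_muleDr ?lee_fin ?jprob_ge0//; last first.
  by apply: nneseries_ge0T => k; rewrite lee_fin jprob_ge0.
by rewrite jprob_sum// mule1.
Qed.

Lemma prob_setDI (A B : set Omega) : measurable A -> measurable B ->
  P A = P (A `\` B) + P (A `&` B).
Proof. by move=> mA mB; exact: measureDI. Qed.

(** Requiring one more holding time to be positive is the case [u = 0] of [cyl_hold] and leaves
    every cylinder probability unchanged. *)
Lemma hold_nonpos_null n : P [set w | holdpos n w /\ ~ (0 < hold J n w)] = 0.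
Proof.
have mF : measurable [set w | holdpos n w /\ ~ (0 < hold J n w)].
  apply: measurable_conj; first exact: measurable_holdpos.
  exact: measurableC (measurable_holdgt n 0).
apply: (path_null (n := n)) => // y.
have mE : measurable [set w | cyl n y w /\ holdpos n w].
  by apply: measurable_conj; [exact: measurable_cyl|exact: measurable_holdpos].
have := prob_setDI mE (measurable_holdgt n 0); rewrite cyl_pos.
have -> : [set w | cyl n y w /\ holdpos n w] `&` [set w | 0 < hold J n w] =
    [set w | (cyl n y w /\ holdpos n w) /\ 0%:E < hold J n w] by [].
rewrite cyl_hold// mulr0 expR0 mulr1.
have -> : [set w | cyl n y w /\ holdpos n w] `\` [set w | 0 < hold J n w] =
    [set w | cyl n y w /\ holdpos n w /\ ~ (0 < hold J n w)].
  by apply/seteqP; split => w /=; [move=> [[? ?] ?]|move=> [? [? ?]]].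
have mG : measurable [set w | cyl n y w /\ holdpos n w /\ ~ (0 < hold J n w)].
  by apply: measurable_conj => //; exact: measurable_cyl.
rewrite -(fineK (prob_fin P mG)) -EFinD => -[] /eqP.
by rewrite -subr_eq subrr eq_sym => /eqP ->.
Qed.

Lemma exists_nonpos_null : P [set w | exists n, ~ (0 < hold J n w)] = 0.
Proof.
have mF n : measurable [set w | holdpos n w /\ ~ (0 < hold J n w)].
  apply: measurable_conj; first exact: measurable_holdpos.
  exact: measurableC (measurable_holdgt n 0).
apply: (@prob_subset0 _ _ _ _ _ (\bigcup_n [set w | holdpos n w /\ ~ (0 < hold J n w)])).
- by apply: measurable_exists => n; exact: measurableC (measurable_holdgt n 0).
- exact: bigcupT_measurable.
- have : P.-negligible (\bigcup_n [set w | holdpos n w /\ ~ (0 < hold J n w)]).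
    by apply: negligible_bigcup => n; apply/negligibleP => //; exact: hold_nonpos_null.
  by move/negligibleP; apply; exact: bigcupT_measurable.
move=> w [n nn].
have [m Hm minm] := @ex_minnP (fun n => ~~ (0 < hold J n w)) (ex_intro _ n (introN idP nn)).
exists m => //; split; last exact/negP.
move=> k km; apply: contraTT km => nk; rewrite -leqNgt; exact: minm.
Qed.

Lemma cyl_prob n y : P (cyl n y) = (cylw n y)%:E.
Proof.
rewrite -cyl_pos; apply: (@prob_eq_ae _ _ _ _ _ _ [set w | exists n, ~ (0 < hold J n w)]).
- exact: measurable_cyl.
- by apply: measurable_conj; [exact: measurable_cyl|exact: measurable_holdpos].
- by apply: measurable_exists => k; exact: measurableC (measurable_holdgt k 0).
- exact: exists_nonpos_null.
move=> w nN; split=> [cw|[]//]; split => // k _.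
by apply: contrapT => nk; apply: nN; exists k.
Qed.

Lemma measurable_jump n : measurable [set w | jprob Q (Y n w) (Y n.+1 w) = 0%R].
Proof.
  rewrite (_ : [set _ | _] = \bigcup_k [set w | Y n w = Some k /\ jprob Q (Some k) (Y n.+1 w) = 0%R]
     `|` [set w | Y n w = None /\ jprob Q None (Y n.+1 w) = 0%R]).
    apply: measurableU; first apply: bigcupT_measurable => k; apply: measurable_conj; try exact: mY.
      exact: (@measurable_state_pred _ _ _ (fun z => jprob Q (Some k) z = 0%R)).
    exact: (@measurable_state_pred _ _ _ (fun z => jprob Q None z = 0%R)).
  apply/seteqP; split => w /=.
    by case E: (Y n w) => [k|] h; [left; exists k|right].
  by move=> [[k _ [-> //]]|[-> //]].
Qed.

Lemma jump_null n : P [set w | jprob Q (Y n w) (Y n.+1 w) = 0%R] = 0.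
Proof.
apply: (path_null (n := n.+1)); first exact: measurable_jump.
move=> y; have mF := measurable_jump n.
have [e|ne] := eqVneq (jprob Q (y n) (y n.+1)) 0%R.
  apply: (@prob_subset0 _ _ _ _ _ (cyl n.+1 y)); last by move=> w [].
  - by apply: measurable_conj => //; exact: measurable_cyl.
  - exact: measurable_cyl.
  by rewrite cyl_prob /cylw big_ord_recr/= e !mulr0.
rewrite (_ : [set _ | _] = set0) ?measure0//; apply/seteqP; split => w //= [cw].
by rewrite !cw//; move/eqP: ne.
Qed.

Lemma measurable_hold_infinite n : measurable [set w | (0 < qrate Q (Y n w))%R /\ hold J n w = +oo].
Proof.
have mi : measurable [set w | hold J n w = +oo].
  rewrite (_ : [set _ | _] = hold J n @^-1` [set +oo])//.
  by rewrite -[X in measurable X]setTI; apply: measurable_hold.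
apply: measurable_conj => //.
exact: (@measurable_state_pred _ _ _ (fun z => (0 < qrate Q z)%R)).
Qed.

(** On each cylinder the probability is at most [c * exp(- q u)] for every [u >= 0]. *)
Lemma hold_infinite_null n : P [set w | (0 < qrate Q (Y n w))%R /\ hold J n w = +oo] = 0.
Proof.
have mF := measurable_hold_infinite n.
apply: (path_null (n := n)) => // y.
have mcF : measurable [set w | cyl n y w /\ (0 < qrate Q (Y n w))%R /\ hold J n w = +oo].
  by apply: measurable_conj => //; exact: measurable_cyl.
have [q0|q0] := ltP 0%R (qrate Q (y n)); last first.
  rewrite (_ : [set _ | _] = set0) ?measure0//; apply/seteqP; split => w //= [cw [+ _]].
  by rewrite cw// ltNge q0.
have bnd u : (0 <= u)%R -> P [set w | cyl n y w /\ (0 < qrate Q (Y n w))%R /\ hold J n w = +oo] <=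
    (cylw n y * expR (- qrate Q (y n) * u))%:E.
  move=> u0; rewrite -cyl_hold//.
  set N := [set w | exists n, ~ (0 < hold J n w)].
  have mN : measurable N by apply: measurable_exists => k; exact: measurableC (measurable_holdgt k 0).
  have mc : measurable [set w | (cyl n y w /\ holdpos n w) /\ u%:E < hold J n w].
    apply: measurable_conj; last exact: measurable_holdgt.
    by apply: measurable_conj; [exact: measurable_cyl|exact: measurable_holdpos].
  rewrite -[leRHS](measureU0 mc mN exists_nonpos_null) le_measure ?inE//; first exact: measurableU.
  move=> w [cw [_ e]]; have [Nw|nN] := pselect (N w); [by right|left].
  split; last by rewrite e ltry.
  split => // k _; by apply: contrapT => nk; apply: nN; exists k.
set p := P _ in bnd *; have pf : p \is a fin_num by exact: prob_fin.
have p0 : 0 <= p by exact: measure_ge0.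
apply/eqP; rewrite eq_le p0 andbT -(fineK pf) lee_fin.
rewrite leNgt; apply/negP => a0.
set a := fine p in a0; set c := cylw n y in bnd; set q := qrate Q (y n) in q0 bnd.
have c0 : (0 <= c)%R by exact: cylw_ge0.
(* With this [u] the exponent is [- c / a]; then exp x >= 1 + x would give [a + c <= c], impossible
   for [a > 0]. *)
have u0 : (0 <= c / (a * q))%R by rewrite divr_ge0// mulr_ge0 ?ltW.
have := bnd _ u0; rewrite -(fineK pf) lee_fin -/a.
have -> : (- q * (c / (a * q)) = - (c / a))%R by field; rewrite !lt0r_neq0.
rewrite expRN => le1.
have e1 : (1 + c / a <= expR (c / a))%R by exact: expR_ge1Dx.
have ca0 : (0 <= c / a)%R by rewrite divr_ge0// ltW.
have : (a * (1 + c / a) <= c)%R.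
  apply: (@le_trans _ _ (a * expR (c / a))%R); first by rewrite ler_wpM2l// ltW.
  by rewrite -ler_pdivlMr ?expR_gt0.
by rewrite mulrDr mulr1 mulrCA divff ?lt0r_neq0// mulr1 gerDr leNgt a0.
Qed.

Lemma init_null : P [set w | Y 0 w <> x0] = 0.
Proof.
have mF : measurable [set w | Y 0 w <> x0] by exact: measurableC (@mY 0%N x0).
apply: (path_null (n := 0)) => // y.
have [e|ne] := eqVneq (y 0%N) x0.
  rewrite (_ : [set _ | _] = set0) ?measure0//; apply/seteqP; split => w //= [cw].
  by rewrite cw.
apply: (@prob_subset0 _ _ _ _ _ (cyl 0 y)); last by move=> w [].
- by apply: measurable_conj => //; exact: measurable_cyl.
- exact: measurable_cyl.
by rewrite cyl_prob /cylw (negbTE ne) mul0r.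
Qed.

Lemma ctmc_good : exists N : set Omega, [/\ measurable N, P N = 0 &
  forall w, ~ N w -> [/\ Y 0 w = x0, forall n, 0 < hold J n w,
    forall n, jprob Q (Y n w) (Y n.+1 w) <> 0%R &
    forall n, (0 < qrate Q (Y n w))%R -> hold J n w < +oo]].
Proof.
pose B n := [set w | ~ (0 < hold J n w)] `|`
  ([set w | jprob Q (Y n w) (Y n.+1 w) = 0%R] `|` 
  ([set w | (0 < qrate Q (Y n w))%R /\ hold J n w = +oo] `|` [set w | Y 0 w <> x0])).
have neg : P.-negligible (\bigcup_n B n).
  apply: negligible_bigcup => n; apply: negligibleU; last apply: negligibleU; last apply: negligibleU.
  - apply: (@negligibleS _ _ _ _ [set w | exists n, ~ (0 < hold J n w)]); first by move=> w nw; exists n.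
    apply/negligibleP; last exact: exists_nonpos_null.
    by apply: measurable_exists => k; exact: measurableC (measurable_holdgt k 0).
  - by apply/negligibleP; [exact: measurable_jump|exact: jump_null].
  - by apply/negligibleP; [exact: measurable_hold_infinite|exact: hold_infinite_null].
  - by apply/negligibleP; [exact: measurableC (@mY 0%N x0)|exact: init_null].
case: neg => N [mN N0 BN]; exists N; split => // w nN.
have nB n : ~ B n w by move=> Bn; apply: nN; apply: BN; exists n.
split.
- by apply: contrapT => h; apply: (nB 0%N); right; right; right.
- by move=> n; apply: contrapT => h; apply: (nB n); left.
- by move=> n h; apply: (nB n); right; left.
- move=> n q0; rewrite ltey; apply/negP => /eqP h; apply: (nB n); right; right; left; split => //.
Qed.

(** The default 1 applies on exceptional paths and to infinite holding times, as in an absorbing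
    state; it makes the real holding time positive everywhere, as the path law requires. *)
Definition rhold n w : R := if (0 < hold J n w) && (hold J n w < +oo) then fine (hold J n w) else 1%R.

Lemma rhold_gt0 n w : (0 < rhold n w)%R.
Proof. by rewrite /rhold; case: ifP => // ?; exact: fine_gt0. Qed.

Lemma measurable_rhold n : measurable_fun setT (rhold n).
Proof.
apply: measurable_fun_ifT.
- apply: measurable_and; apply: measurable_fun_lte => //; exact: measurable_hold.
- by apply: measurableT_comp => //; exact: measurable_hold.
- exact: measurable_cst.
Qed.

Lemma rholdE n w : 0 < hold J n w -> hold J n w < +oo -> (rhold n w)%:E = hold J n w.
Proof.
move=> h0 h1; rewrite /rhold h0 h1/= fineK//; rewrite ge0_fin_numE//; exact: ltW.
Qed.

Lemma ctmc_law_rhold n (y : nat -> state) (s : nat -> R) : (forall k, (0 <= s k)%R) ->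
  (forall k, (k < n)%N -> (0 < qrate Q (y k))%R) ->
  P [set w | (forall k, (k <= n)%N -> Y k w = y k) /\
             (forall k, (k < n)%N -> (s k < rhold k w)%R)]
  = ((y 0%N == x0)%:R * pweight (jprob Q) (qrate Q) n y s)%:E.
Proof.
move=> s0 qy; have [N [mN N0 good]] := ctmc_good.
rewrite (_ : pweight _ _ _ _ _ = \prod_(k < n) (jprob Q (y k) (y k.+1) * expR (- qrate Q (y k) * s k)))%R; last first.
  rewrite /pweight; apply: eq_bigr => k _; congr (_ * expR _)%R.
  exact/esym/mulNr.
rewrite -law//; apply: (@prob_eq_ae _ _ _ _ _ _ N) => //.
- apply: measurable_conj; first exact: measurable_cyl.
  apply: (@measurable_forall_impl _ _ (fun k => (k < n)%N)) => k.
  by apply: measurable_setlt => //; exact: measurable_rhold.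
- apply: measurable_conj; first exact: measurable_cyl.
  by apply: (@measurable_forall_impl _ _ (fun k => (k < n)%N)) => k; exact: measurable_holdgt.
move=> w nN; have [_ h0 _ hf] := good w nN.
split=> -[cw H]; split => // k kn; have := H k kn.
  by rewrite -lte_fin rholdE// hf// cw ?qy// ltnW.
by rewrite -lte_fin rholdE// hf// cw ?qy// ltnW.
Qed.

End ctmc_clean.

(** * The killed chain *)

Section jump_paths.
Local Open Scope ereal_scope.
Context d (Omega : measurableType d) (R : realType).
Variables (Y : nat -> Omega -> state) (J : nat -> Omega -> \bar R).
Hypothesis J0 : forall w, J 0%N w = 0%E.
Hypothesis Jmono : forall n w, J n w <= J n.+1 w.
Hypothesis Jexp : forall w (t : R), exists n, t%:E < J n w.

Lemma Jle m n w : (m <= n)%N -> J m w <= J n w.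
Proof.
move=> /subnK <-; elim: (n - m)%N => [|k IH]; first by rewrite add0n.
by rewrite addSn; apply: le_trans IH _.
Qed.

Lemma Jge0 n w : 0 <= J n w.
Proof. by rewrite -(J0 w) Jle. Qed.

Lemma jump_index w (t : R) : (0 <= t)%R -> exists n, J n w <= t%:E /\ t%:E < J n.+1 w.
Proof.
move=> t0; have [n tn minn] := @ex_minnP (fun n => t%:E < J n w) (Jexp w t).
case: n tn minn => [|n] tn minn; first by move: tn; rewrite J0 lte_fin ltNge t0.
exists n; split => //; rewrite leNgt; apply/negP => /minn; by rewrite ltnn.
Qed.

Lemma jump_index_lt w (t s : R) n m : J n w <= t%:E -> s%:E < J m.+1 w -> (t <= s)%R -> (n <= m)%N.
Proof.
move=> nt sm ts; rewrite leqNgt; apply/negP => mn.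
have := lt_le_trans sm (Jle w mn); rewrite ltNge => /negP; apply.
by apply: le_trans nt _; rewrite lee_fin.
Qed.

Lemma hold_jtime S n w : (forall k, (k < n)%N -> 0 < hold J k w /\ (S k w)%:E = hold J k w) ->
  J n w = (jtime S n w)%:E.
Proof.
elim: n => [_|n IH H]; first by rewrite J0 /jtime big_ord0.
have Jn : J n w = (jtime S n w)%:E by apply: IH => k kn; apply: H; exact: ltnW.
have [_] := H n (ltnSn n); rewrite /hold Jn /= => Sn.
rewrite /jtime big_ord_recr/= -/(jtime S n w) EFinD Sn.
case: (J n.+1 w) Sn => //= r _.
by rewrite -EFinB -EFinD addrC subrK.
Qed.

End jump_paths.

(** * Transition and survival probabilities of the killed chain as jump kernels *)

Section killed_chain.
Local Open Scope ereal_scope.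
Context d (Omega : measurableType d) (R : realType).
Variable P : probability Omega R.
Notation leb := (@lebesgue_measure R).
Variable Q : state -> state -> R.
Variable i0 : nat.
Variable lam : R.
Hypothesis HQ : is_Qmatrix Q.
Hypothesis QN : forall y, Q None y = 0%R.
Hypothesis qpos : forall k, (0 < qrate Q (Some k))%R.
Hypothesis lam0 : (0 < lam)%R.
Hypothesis Qkill : forall i : nat, Q (Some i) None = (if i == 0%N then lam else 0%R).
Variable X : R -> Omega -> state.
Variables (Y : nat -> Omega -> state) (J : nat -> Omega -> \bar R).
Hypothesis mY : forall n y, measurable (Y n @^-1` [set y]).
Hypothesis mJ : forall n, measurable_fun [set: Omega] (J n : Omega -> \bar R).
Hypothesis J0 : forall w, J 0%N w = 0%E.
Hypothesis Jmono : forall n w, J n w <= J n.+1 w.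
Hypothesis Jexp : forall w (t : R), exists n, t%:E < J n w.
Hypothesis XY : forall w n (t : R), J n w <= t%:E -> t%:E < J n.+1 w -> X t w = Y n w.
Hypothesis law : forall n (y : nat -> state) (s : nat -> R), (forall k, (0 <= s k)%R) ->
  P [set w | (forall k, (k <= n)%N -> Y k w = y k) /\
             (forall k, (k < n)%N -> ((s k)%:E < hold J k w)%E)]
         = ((y 0%N == Some i0)%:R *
            \prod_(k < n) (jprob Q (y k) (y k.+1) *
                           expR (- qrate Q (y k) * s k)))%:E.

Let S := rhold J.
Let A := offdiag Q.
Let q k := qrate Q (Some k).
Let D : pred nat := predT.
Let al (x : state) : R := (x == Some i0)%:R.

Let Dq x : inDs D x -> (0 < qrate Q x)%R.
Proof. by case: x. Qed.

Let lawS n (y : nat -> state) (s : nat -> R) : (forall k, (0 <= s k)%R) ->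
  (forall k, (k < n)%N -> inDs D (y k)) ->
  P [set w | (forall k, (k <= n)%N -> Y k w = y k) /\
             (forall k, (k < n)%N -> (s k < S k w)%R)] = (al (y 0%N) * pweight (jprob Q) (qrate Q) n y s)%:E.
Proof.
move=> s0 yD; apply: (ctmc_law_rhold HQ QN mY mJ law) => // k kn.
exact/Dq/yD.
Qed.

Let mS n : measurable_fun setT (S n).
Proof. exact: measurable_rhold. Qed.
Let S0 n w : (0 < S n w)%R.
Proof. exact: rhold_gt0. Qed.
Let jp0 x y : (0 <= jprob Q x y)%R.
Proof. exact: jprob_ge0. Qed.
Let jp1 l : D l -> (jprob Q (Some l) None)%:E + \sum_(k <oo) (jprob Q (Some l) (Some k))%:E = 1.
Proof. by move=> _; exact: jprob_sum. Qed.

Let AkerE : Aker (jprob Q) (qrate Q) D = A.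
Proof.
apply/funext => l; apply/funext => j; rewrite /Aker /= jprob_Some// divfK//.
exact: lt0r_neq0 (qpos l).
Qed.

Let akerE : aker al D = delta R i0.
Proof.
apply/funext => j; rewrite /aker /= /al /delta.
by have -> : (Some j == Some i0) = (j == i0) by apply/eqP/eqP => [[]|->].
Qed.

Let A0 i j : (0 <= A i j)%R.
Proof. exact: offdiag_ge0. Qed.

(** Absorption is permanent off a null set: [None] has rate 0, so its only jump of nonzero
    probability is to itself, and almost every path makes only such jumps. *)
Lemma killed_good : exists N : set Omega, [/\ measurable N, P N = 0 &
  forall w, ~ N w -> [/\ Y 0 w = Some i0,
    forall m n, (m <= n)%N -> Y m w = None -> Y n w = None &
    forall n, (forall k, (k < n)%N -> inDs D (Y k w)) -> J n w = (jtime S n w)%:E /\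
       (inDs D (Y n w) -> J n.+1 w = (jtime S n w + S n w)%:E) /\ J n w < J n.+1 w]].
Proof.
have [N [mN N0 good]] := ctmc_good HQ QN mY mJ law.
exists N; split => // w nN; have [Y0 h0 jn hf] := good w nN.
have hS k : inDs D (Y k w) -> 0 < hold J k w /\ (S k w)%:E = hold J k w.
  by move=> Dk; split; [exact: h0|apply: rholdE => //; apply: hf; exact: Dq].
have Jt n : (forall k, (k < n)%N -> inDs D (Y k w)) -> J n w = (jtime S n w)%:E.
  by move=> H; apply: hold_jtime => // k kn; apply: hS; exact: H.
split=> //.
  move=> m n /subnK <-; elim: (n - m)%N => [//|k IH] Ym.
  have := jn (k + m)%N; rewrite addSn IH//.
  case: (Y (k + m).+1 w) => [l|//].
  by rewrite /jprob /qrate QN oppr0 eqxx.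
move=> n H; split; first exact: Jt.
split.
  move=> Dn; rewrite (Jt n.+1).
    by rewrite /jtime big_ord_recr.
  by move=> k; rewrite ltnS leq_eqVlt => /predU1P[->|/H].
have := h0 n; rewrite /hold (Jt n H) /=.
case: (J n.+1 w) => //= [r|_]; last exact: ltry.
by rewrite -EFinB !lte_fin subr_gt0.
Qed.

Definition ontime n (t : R) := [set w | J n w <= t%:E /\ t%:E < J n.+1 w].

Lemma measurable_ontime n t : measurable (ontime n t).
Proof.
apply: measurable_conj.
  have := emeasurable_fun_le measurableT (mJ n) (measurable_cst t%:E); by rewrite setTI.
have := emeasurable_fun_lt measurableT (measurable_cst t%:E) (mJ n.+1); by rewrite setTI.
Qed.

Lemma X_eq t w z : (0 <= t)%R -> X t w = z <-> exists n, Y n w = z /\ ontime n t w.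
Proof.
move=> t0; split=> [Xz|[n [Yz [h1 h2]]]]; last by rewrite -Yz; exact: XY.
have [n [h1 h2]] := jump_index J0 Jexp w t0; exists n; split => //.
by rewrite -Xz; apply/esym; exact: XY.
Qed.

Lemma measurable_X t z : (0 <= t)%R -> measurable [set w | X t w = z].
Proof.
move=> t0; rewrite (_ : [set _ | _] = [set w | exists n, Y n w = z /\ ontime n t w]).
  by apply: measurable_exists => n; apply: measurable_conj; [exact: mY|exact: measurable_ontime].
by apply/seteqP; split => w /= H; apply/(X_eq _ _ t0).
Qed.

Lemma X_trans j t : (0 <= t)%R -> P [set w | X t w = Some j] = tker A q (delta R i0) j t.
Proof.
move=> t0; have [N [mN N0 good]] := killed_good.
transitivity (\sum_(n <oo) P [set w | Y n w = Some j /\ ontime n t w]).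
  have mE n : measurable [set w | Y n w = Some j /\ ontime n t w].
    by apply: measurable_conj; [exact: mY|exact: measurable_ontime].
  rewrite (eq_eseriesl (Q := fun n => n \in [set: nat])); last by move=> k; apply/esym; exact: mem_set.
  rewrite -measure_bigcup//.
    congr (P _); apply/seteqP; split => w /=.
      by move=> /(X_eq _ _ t0)[n H]; exists n.
    by move=> [n _ H]; apply/(X_eq _ _ t0); exists n.
  apply/trivIsetP => a b _ _ ab; apply/seteqP; split => w //= [[_ [a1 a2]] [_ [b1 b2]]].
  move/negP: ab; apply; rewrite eqn_leq.
  by rewrite (jump_index_lt Jmono a1 b2)//= (jump_index_lt Jmono b1 a2).
rewrite /tker; apply: eq_eseriesr => n _.
rewrite -AkerE -akerE -(hold_at_jker mY mS S0 jp0 Dq lawS)//.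
rewrite -(hold_atE mY mS S0 jp0 Dq jp1 lawS)//.
apply: (@prob_eq_ae _ _ _ _ _ _ N) => //.
- by apply: measurable_conj; [exact: mY|exact: measurable_ontime].
- apply: measurable_conj; first exact: measurable_at.
  have mjt : measurable_fun setT (jtime S n) by exact: measurable_jtime.
  have mm : measurable [set w | (jtime S n w <= t)%R /\ (t < jtime S n w + S n w)%R].
    apply: measurable_conj; first exact: measurable_setle.
    by apply: measurable_setlt => //; exact: measurable_funD.
  by congr measurable: mm; apply/seteqP; split => w /=; [move=> h; exact/andP|move/andP].
move=> w nN; have [Y0 abs HJ] := good w nN; split.
  move=> [Yn [h1 h2]].
  have Hd k : (k < n)%N -> inDs D (Y k w).
    move=> kn; case E: (Y k w) => //; have := abs k n (ltnW kn) E; by rewrite Yn.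
  have [e1 [e2 _]] := HJ n Hd.
  split; first by split.
  by apply/andP; rewrite -lee_fin -lte_fin -e1 -e2 ?Yn.
move=> [[iw Yn] /andP[h1 h2]]; split => //.
have [e1 [e2 _]] := HJ n iw.
by split; rewrite ?e1 ?e2 ?Yn ?lee_fin ?lte_fin.
Qed.

(** Only state 0 leads to [None], at rate [lam], so the sum defining the density of the absorption
    time has a single term. *)
Let kapNone n (B : set R) : measurable B ->
  kap P Y S D n.+1 None B = lam%:E * \int[leb]_x ((\1_B x)%:E * jker A q (delta R i0) n 0 x).
Proof.
move=> mB; rewrite (kapS mY mS S0 jp0 Dq lawS)//.
have d0 k : 0 <= delta R i0 k by exact: delta_ge0.
have mk : measurable_fun setT (jker A q (delta R i0) n 0) by exact: measurable_jker.
rewrite -ge0_integralZl//.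
- apply: eq_integral => x _; rewrite muleCA; congr (_ * _).
  rewrite (densE mY mS S0 jp0 Dq lawS) AkerE akerE -/q.
  have k0 l : 0 <= jker A q (delta R i0) n l x by exact: jker_ge0.
  rewrite nneseries_recl0; last by move=> l; rewrite mule_ge0 ?lee_fin// mulr_ge0// ltW.
  have jN l : (jprob Q (Some l) None * qrate Q (Some l) = if l == 0%N then lam else 0)%R.
    by rewrite /jprob gt_eqF//= divfK ?Qkill// lt0r_neq0.
  rewrite jN/= muleC eseries0 ?adde0// => l _ _; by rewrite jN/= mule0.
- apply: emeasurable_funM => //; apply/measurable_EFinP; exact: measurable_indic.
- by move=> x _; rewrite mule_ge0 ?lee_fin// jker_ge0.
- by rewrite lee_fin ltW.
Qed.

Let kap0None (B : set R) : measurable B -> kap P Y S D 0 None B = 0.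
Proof.
move=> mB; have [N [mN N0 good]] := killed_good.
apply: (@prob_subset0 _ _ _ _ _ N) => //; first by apply: measurable_kapset.
move=> w [_ [_ YN]]; apply: contrapT => nN; have [Y0 _ _] := good w nN.
by rewrite Y0 in YN.
Qed.

(* Absorption occurs at the first index [m] with [Y m = None]. *)
Let first_none (B : set R) : measurable B ->
  P [set w | exists m, inD Y D m w /\ B (jtime S m w) /\ Y m w = None] =
  lam%:E * \int[leb]_x ((\1_B x)%:E * tker A q (delta R i0) 0 x).
Proof.
move=> mB.
have d0 k : 0 <= delta R i0 k by exact: delta_ge0.
have mk n : measurable_fun setT (jker A q (delta R i0) n 0) by exact: measurable_jker.
have k0 n x : 0 <= jker A q (delta R i0) n 0 x by exact: jker_ge0.
have mBi : measurable_fun setT (fun x : measurableTypeR R => (\1_B x)%:E : \bar R).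
  by apply/measurable_EFinP; exact: measurable_indic.
transitivity (\sum_(m <oo) kap P Y S D m None B).
  rewrite (eq_eseriesl (Q := fun n => n \in [set: nat])); last by move=> k; apply/esym; exact: mem_set.
  rewrite /kap -measure_bigcup//.
  - by congr (P _); apply/seteqP; split => w /=; [move=> [m H]; exists m|move=> [m _ H]; exists m].
  - by move=> m _; exact: measurable_kapset.
  apply/trivIsetP => a b _ _ ab; apply/seteqP; split => w //= [[ia [_ Ya]] [ib [_ Yb]]].
  have [h|h|h] := ltngtP a b.
  - by have := ib a h; rewrite Ya.
  - by have := ia b h; rewrite Yb.
  - by rewrite h eqxx in ab.
rewrite nneseries_recl0; last by move=> m; exact: measure_ge0.
rewrite kap0None// add0e.
under eq_eseriesr => n _ do rewrite kapNone//.
rewrite nneseriesZle ?lee_fin ?(ltW lam0)//; last first.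
  by move=> n; apply: integral_ge0 => x _; rewrite mule_ge0// lee_fin.
congr (_ * _); rewrite -integral_seriesT.
- apply: eq_integral => x _; rewrite nneseriesZle ?lee_fin//.
- by move=> n; exact: (emeasurable_funM mBi (mk n)).
- by move=> n x; rewrite mule_ge0// lee_fin.
Qed.

Let least_none w n : Y n w = None -> exists m, [/\ (m <= n)%N, inD Y D m w & Y m w = None].
Proof.
move=> /eqP Yn; have [m /eqP Ym minm] := @ex_minnP (fun n => Y n w == None) (ex_intro _ n Yn).
exists m; split => //; first exact: minm.
move=> k km; case E: (Y k w) => //; have := minm k; rewrite E eqxx => /(_ isT).
by rewrite leqNgt km.
Qed.

Let measurable_first_none (B : set R) : measurable B ->
  measurable [set w | exists m, inD Y D m w /\ B (jtime S m w) /\ Y m w = None].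
Proof. by move=> mB; apply: measurable_exists => m; exact: measurable_kapset. Qed.

(** Off the null set, the chain is absorbed at time t exactly when the first jump into [None]
    happened by t; [first_none] is applied to the half-line up to t. *)
Lemma X_killed t : (0 <= t)%R ->
  P [set w | X t w = None] = lam%:E * occup (tker A q (delta R i0) 0) t.
Proof.
move=> t0; have [N [mN N0 good]] := killed_good.
have -> : occup (tker A q (delta R i0) 0) t =
    \int[leb]_x ((\1_(`]-oo, t]%classic) x)%:E * tker A q (delta R i0) 0 x).
  apply: eq_integral => x _; congr (_ * _); rewrite indicE mem_setE in_itv/=.
  by [].
rewrite -first_none//; apply: (@prob_eq_ae _ _ _ _ _ _ N) => //.
- exact: measurable_X.
- exact: measurable_first_none.
move=> w nN; have [Y0 abs HJ] := good w nN; split.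
  move=> /(X_eq _ _ t0)[n [Yn [h1 h2]]].
  have [m [mn im Ym]] := least_none Yn; exists m; split => //; split => //.
  have [e1 _] := HJ m im; rewrite /= in_itv/= -lee_fin -e1.
  exact: le_trans (Jle Jmono w mn) h1.
move=> [m [im [Bm Ym]]]; have [e1 _] := HJ m im.
move: Bm; rewrite /= in_itv/= -lee_fin -e1 => Jm.
have [n [h1 h2]] := jump_index J0 Jexp w t0.
apply/(X_eq _ _ t0); exists n; split => //; apply: (abs m n _ Ym).
exact: (jump_index_lt Jmono Jm h2).
Qed.

Lemma X_mass t : (0 <= t)%R ->
  \sum_(j <oo) tker A q (delta R i0) j t + lam%:E * occup (tker A q (delta R i0) 0) t = 1.
Proof.
move=> t0; rewrite -(probability_setT P).
have mX z : measurable (X t @^-1` [set z]) by exact: measurable_X.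
rewrite (state_split P mX measurableT) -X_killed// addeC; congr (_ + _).
  by congr (P _); apply/seteqP; split => w //= [].
apply: eq_eseriesr => j _; rewrite -X_trans//; congr (P _).
by apply/seteqP; split => w //= [].
Qed.

(** Writes [Tdelta] as a countable infimum over intervals of constancy, which gives measurability.
    An interval of length zero contains no time and contributes [+oo]. *)
Definition gnone n w : \bar R := if (Y n w == None) && (J n w < J n.+1 w) then J n w else +oo.

Lemma TdeltaE w : Tdelta X w = ereal_inf [set gnone n w | n in setT].
Proof.
apply/eqP; rewrite eq_le; apply/andP; split.
  apply: le_ereal_inf_tmp => _ [n _ <-]; rewrite /gnone; case: ifP => [/andP[/eqP Yn JJ]|_]; last exact: leey.
  apply: ereal_inf_lbound.
  have [r r0 Jr] : exists2 r : R, (0 <= r)%R & J n w = r%:E.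
    have := Jge0 J0 Jmono n w; move: JJ; case: (J n w) => [r _ r0| |_]; [by exists r|by rewrite ltNge leey|by []].
  exists r; last by rewrite Jr.
  by split => //; rewrite -Yn; apply: XY; rewrite -Jr.
apply: le_ereal_inf_tmp => _ [t [t0 Xt] <-].
have [n [Yn [h1 h2]]] := (X_eq w None t0).1 Xt.
apply: (@le_trans _ _ (gnone n w)); first by apply: ereal_inf_lbound; exists n.
by rewrite /gnone Yn eqxx (le_lt_trans h1 h2).
Qed.

Lemma measurable_Tdelta : measurable_fun setT (Tdelta X).
Proof.
have mg n : measurable_fun setT (gnone n).
  apply: measurable_fun_ifT; [|exact: mJ|exact: measurable_cst].
  apply: measurable_and; last by apply: measurable_fun_lte.
  apply: (measurable_fun_bool true); rewrite setTI.
  by rewrite (_ : _ @^-1` _ = Y n @^-1` [set None])//; apply/seteqP; split => w /= /eqP.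
rewrite (_ : Tdelta X = fun w => einfs (gnone ^~ w) 0%N).
  by apply: measurable_fun_einfs.
apply/funext => w; rewrite TdeltaE /einfs /sdrop.
congr ereal_inf; apply/seteqP; split => x /= [n _ <-]; by exists n.
Qed.

(** Off a null set the path stays in [None] from the first jump time into it, and that time is
    [Tdelta]. The null set matters: elsewhere a path could leave [None] again. *)
Lemma Tdelta_gt : exists N : set Omega, [/\ measurable N, P N = 0 &
  forall w, ~ N w -> forall t : R, (0 <= t)%R -> t%:E < Tdelta X w <-> X t w <> None].
Proof.
have [N [mN N0 good]] := killed_good; exists N; split => // w nN t t0.
have [Y0 abs HJ] := good w nN; split=> [tT XN|XN].
  move: tT; rewrite ltNge => /negP; apply.
  by apply: ereal_inf_lbound; exists t.
have [[n YN]|noN] := pselect (exists n, Y n w = None); last first.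
  rewrite TdeltaE (_ : [set _ | _ in _] = [set +oo]); first by rewrite ereal_inf1 ltry.
  have gy n : gnone n w = +oo.
    by rewrite /gnone; case: eqP => // YN; exfalso; apply: noN; exists n.
  by apply/seteqP; split => x /= => [[n _ <-//]|->]; exists 0%N.
have [m [mn im Ym]] := least_none YN.
have [e1 _] := HJ m im.
apply: (@lt_le_trans _ _ (J m w)).
  rewrite ltNge; apply/negP => Jm; apply: XN.
  have [k [h1 h2]] := jump_index J0 Jexp w t0.
  rewrite (XY h1 h2); apply: (abs m k _ Ym).
  exact: (jump_index_lt Jmono Jm h2).
rewrite TdeltaE; apply: le_ereal_inf_tmp => _ [k _ <-].
rewrite /gnone; case: ifP => [/andP[/eqP Yk _]|_]; last exact: leey.
apply: Jle => //; rewrite leqNgt; apply/negP => km.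
by have := im k km; rewrite Yk.
Qed.

Lemma X_alive j t : (0 <= t)%R ->
  P [set w | X t w = Some j /\ t%:E < Tdelta X w] = tker A q (delta R i0) j t.
Proof.
move=> t0; rewrite -X_trans//; have [N [mN N0 H]] := Tdelta_gt.
apply: (@prob_eq_ae _ _ _ _ _ _ N) => //.
- apply: measurable_conj; first exact: measurable_X.
  have := emeasurable_fun_lt measurableT (measurable_cst t%:E) measurable_Tdelta; by rewrite setTI.
- exact: measurable_X.
by move=> w /H /(_ _ t0) h; split => [[]//|Xj]; split => //; apply/h; rewrite Xj.
Qed.

Lemma X_survival t : (0 <= t)%R ->
  P [set w | t%:E < Tdelta X w] = \sum_(j <oo) tker A q (delta R i0) j t.
Proof.
move=> t0; have [N [mN N0 H]] := Tdelta_gt.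
have mX z : measurable (X t @^-1` [set z]) by exact: measurable_X.
have mT : measurable [set w | t%:E < Tdelta X w].
  have := emeasurable_fun_lt measurableT (measurable_cst t%:E) measurable_Tdelta; by rewrite setTI.
rewrite (state_split P mX mT) (_ : P _ = 0) ?add0e.
  apply: eq_eseriesr => j _; rewrite -X_alive//; congr (P _).
  by apply/seteqP; split => w /= [].
apply: (@prob_subset0 _ _ _ _ _ N) => //.
  by apply: measurable_conj => //; exact: measurable_X.
move=> w [tT XN]; apply: contrapT => /H /(_ _ t0) [h _]; exact: h.
Qed.

Lemma X_absorbed : P [set w | Tdelta X w < +oo] = 1 ->
  lam%:E * \int[leb]_x tker A q (delta R i0) 0 x = 1.
Proof.
move=> <-; have [N [mN N0 good]] := killed_good.
have -> : \int[leb]_x tker A q (delta R i0) 0 x =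
    \int[leb]_x ((\1_(@setT R) x)%:E * tker A q (delta R i0) 0 x).
  by apply: eq_integral => x _; rewrite indicT mul1e.
rewrite -first_none//; apply: (@prob_eq_ae _ _ _ _ _ _ N) => //.
- exact: measurable_first_none.
- have := emeasurable_fun_lt measurableT measurable_Tdelta (measurable_cst +oo); by rewrite setTI.
move=> w nN; have [Y0 abs HJ] := good w nN; split.
  move=> [m [im [_ Ym]]]; have [e1 [_ e2]] := HJ m im.
  rewrite /= TdeltaE; apply: (@le_lt_trans _ _ (gnone m w)).
    by apply: ereal_inf_lbound; exists m.
  by rewrite /gnone Ym eqxx e2 e1 ltry.
rewrite /= TdeltaE => /ereal_inf_lt[_ [n _ <-]].
rewrite /gnone; case: ifP => [/andP[/eqP Yn _] _|_]; last by rewrite ltxx.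
by have [m [mn im Ym]] := least_none Yn; exists m.
Qed.

End killed_chain.

(** * Exponential moments *)

Lemma measurable_expeR (R : realType) : measurable_fun setT (@expeR R).
Proof.
rewrite (_ : @expeR R = fun x => if (x == +oo)%E then +oo%E else
    if (x == -oo)%E then 0%E else (expR (fine x))%:E); last by apply/funext => -[].
have meq (c : \bar R) : measurable_fun setT (fun x : \bar R => x == c).
  apply: (measurable_fun_bool true); rewrite setTI.
  rewrite (_ : _ @^-1` _ = [set c]); first exact: emeasurable_set1.
  by apply/seteqP; split => x /= /eqP.
apply: measurable_fun_ifT => //; apply: measurable_fun_ifT => //.
apply/measurable_EFinP; exact: measurableT_comp.
Qed.

Section exponential_moments.
Local Open Scope ereal_scope.
Context d (Omega : measurableType d) (R : realType).
Variable P : probability Omega R.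
Variable T : Omega -> \bar R.
Hypothesis mT : measurable_fun setT T.
Hypothesis T0 : forall w, 0 <= T w.

Definition mgf (g : R) : \bar R := \int[P]_w expeR (g%:E * T w).

Lemma measurable_expeRM (g : R) : measurable_fun setT (fun w => expeR (g%:E * T w)).
Proof.
by apply: measurableT_comp; [exact: measurable_expeR|exact: emeasurable_funM].
Qed.

Let mlt (t : \bar R) : measurable [set w | t < T w].
Proof.
by have := emeasurable_fun_lt measurableT (measurable_cst t) mT; rewrite setTI.
Qed.

Lemma mgf_le (g g' : R) : (g <= g')%R -> mgf g <= mgf g'.
Proof.
move=> gg; apply: le_integralT => [w|||w]; [exact: expeR_ge0|exact: measurable_expeRM|exact: measurable_expeRM|].
by rewrite lee_expeR lee_wpmul2r ?lee_fin.
Qed.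

Lemma mgf0 : mgf 0 = 1.
Proof.
rewrite /mgf (eq_integral (fun=> 1)); first by rewrite integral_cst// mul1e; exact: probability_setT.
by move=> w _; rewrite mul0e expeR0.
Qed.

Lemma mgf_chernoff (g t : R) : (0 <= g)%R -> (0 <= t)%R ->
  (expR (g * t))%:E * P [set w | t%:E < T w] <= mgf g.
Proof.
move=> g0 t0; have -> : P [set w | t%:E < T w] = \int[P]_w (\1_[set w : Omega | (t%:E < T w)%E] w)%:E.
  by rewrite integral_indic// setIT.
have mi : measurable_fun setT (fun w => (\1_[set w : Omega | (t%:E < T w)%E] w)%:E : \bar R).
  by apply/measurable_EFinP; exact: measurable_indic.
rewrite -ge0_integralZl ?lee_fin ?expR_ge0//.
apply: le_integralT => [w|||w]; [by rewrite mule_ge0 ?lee_fin ?expR_ge0|exact: emeasurable_funM|exact: measurable_expeRM|].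
rewrite indicE; case: (boolP (w \in _)) => [|_]; last by rewrite mule0 expeR_ge0.
rewrite inE /= => tT; rewrite mule1 -[(expR _)%:E]/(expeR (g * t)%:E) lee_expeR EFinM.
by rewrite lee_wpmul2l ?lee_fin// ltW.
Qed.

(** Bound exp(g T) by 1 plus the sum over [n] of exp(g (n + 1)) on the event [n < T]. The tail
    hypothesis turns the integral of this into a geometric series of ratio exp(g - a). *)
Lemma mgf_lty_of_tail (g a C : R) : (0 < g)%R -> (g < a)%R -> (0 <= C)%R ->
  (forall t : R, (0 <= t)%R -> P [set w | t%:E < T w] <= (C * expR (- (a * t)))%:E) ->
  mgf g < +oo.
Proof.
move=> g0 ga C0 tail.
pose r := expR (g - a).
have r0 : (0 < r)%R by exact: expR_gt0.
have r1 : (r < 1)%R by rewrite -expR0 ltr_expR subr_lt0.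
pose f n w := (expR (g * n.+1%:R))%:E * (\1_[set w : Omega | (n%:R%:E < T w)%E] w)%:E : \bar R.
have f0 n w : 0 <= f n w by rewrite mule_ge0 ?lee_fin ?expR_ge0.
have mi n : measurable_fun setT (fun w => (\1_[set w : Omega | (n%:R%:E < T w)%E] w)%:E : \bar R).
  by apply/measurable_EFinP; exact: measurable_indic.
have mf n : measurable_fun setT (f n) by exact: emeasurable_funM.
apply: (@le_lt_trans _ _ (\int[P]_w (1 + \sum_(n <oo) f n w))).
  apply: le_integralT => [w|||w]; first exact: expeR_ge0.
  - exact: measurable_expeRM.
  - by apply: emeasurable_funD => //; exact: measurable_seriesT.
  case E : (T w) => [x||]; last by have := T0 w; rewrite E.
    have x0 : (0 <= x)%R by have := T0 w; rewrite E.
    have [->|xn0] := eqVneq x 0%R.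
      by rewrite mule0 expeR0 leeDl// nneseries_ge0T.
    have xgt : (0 < x)%R by rewrite lt_neqAle eq_sym xn0.
    pose n := (Num.truncn (x)).
    have /andP[n1 n2] := truncn_itv x0.
    apply: (@le_trans _ _ (\sum_(n <oo) f n w)); last by rewrite leeDr.
    have key k : (k%:R < x)%R -> (x <= k.+1%:R)%R -> (expeR (g%:E * x%:E)) <= \sum_(n <oo) f n w.
      move=> kx xk; apply: (@le_trans _ _ (f k w)); last exact: (@nneseries_term _ (fun n => f n w)).
      rewrite /f indicE mem_set/= ?E ?lte_fin// mule1 lee_fin ler_expR ler_wpM2l//.
      exact: ltW.
    (* If [x] is itself an integer, the strict event [n < T] fails at [n = x], and the preceding
       integer is used. *)
    move: n1; rewrite le_eqVlt => /predU1P[nx|nx]; last by apply: (key n) => //; exact: ltW.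
    case En : n => [|m].
      by move: xgt; rewrite -nx -/n En ltxx.
    apply: (key m); rewrite -nx -/n En ?ltr_nat//.
  rewrite mulry gtr0_sg// mul1e /= leye_eq; apply/eqP.
  suff -> : \sum_(n <oo) f n w = +oo by [].
  apply: eq_infty => y; pose k := Num.truncn (y / g).
  apply: (@le_trans _ _ (f k w)); last exact: (@nneseries_term _ (fun n => f n w)).
  rewrite /f indicE mem_set/= ?E ?ltry// mule1 lee_fin.
  apply: (@le_trans _ _ (1 + g * k.+1%:R)%R); last exact: expR_ge1Dx.
  have : (y / g < k.+1%:R)%R by exact: truncnS_gt.
  rewrite ltr_pdivrMr// mulrC => /ltW yg; apply: le_trans yg _; by rewrite lerDr.
rewrite ge0_integralD//; last 2 first.
- by move=> w _; exact: nneseries_ge0T.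
- exact: measurable_seriesT.
rewrite integral_cst// mul1e integral_seriesT//.
apply: lte_add_pinfty.
  by apply: (@le_lt_trans _ _ 1); [exact: probability_le1|exact: ltry].
apply: (@le_lt_trans _ _ (\sum_(n <oo) ((C * expR g) * r ^+ n)%:E)).
  apply: lee_nneseriesT => [n|n]; first exact: integral_ge0.
  rewrite ge0_integralZl ?lee_fin ?expR_ge0//.
  rewrite integral_indic// setIT.
  apply: (@le_trans _ _ ((expR (g * n.+1%:R))%:E * (C * expR (- (a * n%:R)))%:E)).
    by rewrite lee_wpmul2l ?tail// lee_fin expR_ge0.
  rewrite -EFinM lee_fin mulrCA -mulrA ler_wpM2l// -expRD -expRM_natl -expRD ler_expR.
  by rewrite -[n.+1]addn1 natrD; lra.
have cv := @cvg_geometric_series R (C * expR g) r.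
have rn : (`|r| < 1)%R by rewrite ger0_norm// ltW.
have H := cv rn.
have cvE : \sum_(0 <= n < k) ((C * expR g) * r ^+ n)%:E @[k --> \oo] -->
    ((C * expR g) / (1 - r))%:E.
  rewrite (_ : (fun k => _) = (fun k => (series (geometric (C * expR g) r) k)%:E)).
    by apply: cvg_EFin; [exact: nearW|exact: H].
  by apply/funext => k; rewrite sumEFin.
by rewrite (cvg_lim _ cvE)// ltry.
Qed.

Lemma mgf_ltyE g : (0 < g)%R -> mgf g < +oo -> P [set w | T w = +oo] = 0.
Proof.
move=> g0 gfin.
have mE : measurable [set w | T w = +oo].
  by have := mT measurableT (emeasurable_set1 +oo); rewrite setTI.
apply/eqP; rewrite eq_le measure_ge0 andbT leNgt; apply/negP => p0.
move: gfin; rewrite ltNge => /negP; apply.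
have -> : +oo = +oo * P [set w | T w = +oo] by rewrite gt0_mulye.
have -> : P [set w | T w = +oo] = \int[P]_w (\1_[set w : Omega | (T w = +oo)%E] w)%:E.
  by rewrite integral_indic// setIT.
have mi : measurable_fun setT (fun w => (\1_[set w : Omega | (T w = +oo)%E] w)%:E : \bar R).
  by apply/measurable_EFinP; exact: measurable_indic.
rewrite -ge0_integralZl//.
apply: le_integralT => [w|||w]; [by rewrite mule_ge0 ?lee_fin|exact: emeasurable_funM|exact: measurable_expeRM|].
rewrite indicE; case: (boolP (w \in _)) => [|_]; last by rewrite mule0 expeR_ge0.
by rewrite inE /= => ->; rewrite mule1 gt0_muley ?lte_fin.
Qed.

Lemma mgf_fineE g0 : (0 < g0)%R -> mgf g0 < +oo -> forall g,
  mgf g = \int[P]_w (expR (g * fine (T w)))%:E.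
Proof.
move=> g00 gfin g; apply: ae_eq_integral => //.
- exact: measurable_expeRM.
- apply/measurable_EFinP; apply: measurableT_comp => //; apply: measurable_funM => //.
  exact: measurableT_comp.
exists [set w | T w = +oo]; split => //.
- by have := mT measurableT (emeasurable_set1 +oo); rewrite setTI.
- exact: mgf_ltyE gfin.
move=> w /= H; apply: contrapT => Tw; apply: H => _.
by have := T0 w; case E : (T w) Tw => [x| |].
Qed.

(** Dominated by exp(th T). The bound -1 is an arbitrary negative number that puts 0 inside the
    interval, since the intermediate value argument for [psi] starts at 0. *)
Lemma mgf_continuous (th x : R) : (0 < th)%R -> mgf th < +oo -> (-1 < x)%R -> (x < th)%R ->
  {for x, continuous (fun g => fine (mgf g))}.
Proof.
move=> th0 thfin x0 xth.
have E g : fine (mgf g) = (\int[P]_w expR (g * fine (T w)))%R.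
  by rewrite (mgf_fineE th0 thfin).
rewrite (_ : (fun g => fine (mgf g)) = (fun g => (\int[P]_w expR (g * fine (T w)))%R)); last exact/funext.
have mfT : measurable_fun setT (fun w => fine (T w)) by exact: measurableT_comp.
have me g : measurable_fun setT (fun w => expR (g * fine (T w)))%R.
  by apply: measurableT_comp => //; exact: measurable_funM.
have ig g : (g <= th)%R -> P.-integrable setT (EFin \o (fun w => expR (g * fine (T w))%R)).
  move=> gth; apply/integrableP; split; first exact/measurable_EFinP.
  apply: (le_lt_trans _ thfin).
  rewrite (mgf_fineE th0 thfin); apply: le_integralT => [w|||w] //.
  - by apply/measurable_EFinP; apply: measurableT_comp.
  - exact/measurable_EFinP.
  rewrite /= ger0_norm ?expR_ge0// lee_fin ler_expR ler_wpM2r// fine_ge0//.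
apply: (@continuity_under_integral R _ _ P (fun g w => expR (g * fine (T w)))%R setT measurableT (-1)%R th
  _ _ (fun w => expR (th * fine (T w)))%R).
- by move=> g; rewrite /= in_itv/= => /andP[_ gth]; apply: ig; exact: ltW.
- apply: aeW => w _ g _.
  by apply: (@continuous_comp _ _ _ (fun g : R => g * fine (T w))%R expR); [exact: mulrr_continuous|exact: continuous_expR].
- exact: ig.
- move=> g; rewrite /= in_itv/= => /andP[_ gth]; apply: aeW => w _.
  by rewrite ger0_norm ?expR_ge0// ler_expR ler_wpM2r ?fine_ge0// ltW.
by rewrite inE /= in_itv/= x0.
Qed.

End exponential_moments.

(** * The first excursion *)

Section Qbar_facts.
Variable R : realType.
Variable Q : state -> state -> R.
Hypothesis HQ : is_Qmatrix Q.
Hypothesis QN : forall y, Q None y = 0%R.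

Lemma Qbar_None y : Qbar Q None y = 0.
Proof. by case: y => [j|] /=; rewrite QN. Qed.

Lemma Qbar_offdiag i j : offdiag (Qbar Q) i j = offdiag Q i j.
Proof.
rewrite /offdiag /Qbar; case: (eqVneq i j) => // ij.
by case: eqP => // -[] /eqP; rewrite (negbTE ij).
Qed.

Lemma qrate_Qbar i : qrate (Qbar Q) (Some i) = qrate Q (Some i) - Q (Some i) None.
Proof. by rewrite /qrate /Qbar eqxx opprD. Qed.

Lemma is_Qmatrix_Qbar : is_Qmatrix (Qbar Q).
Proof.
split.
  move=> x [j|] xy; last by rewrite /Qbar; case: x xy.
  by rewrite /Qbar (negbTE xy) HQ.1.
case=> [i|]; last first.
  rewrite [X in X @ _ --> _](_ : _ = cst 0).
    by rewrite Qbar_None oppr0; exact: cvg_cst.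
  by apply/funext => n /=; rewrite big1// => k _; rewrite Qbar_None.
rewrite /= oppr0.
have c1 : (fun n : nat => \sum_(k < n) (Q (Some i) (Some (k : nat)))) @ \oo --> - Q (Some i) None.
  exact: HQ.2.
rewrite -[X in _ --> X](addNr (Q (Some i) None)).
have c2 : (fun n : nat => (i < n)%N%:R * Q (Some i) None) @ \oo --> Q (Some i) None.
  apply: cvg_near_cst; exists i.+1 => // n /= ni.
  by rewrite ni mul1r.
rewrite [X in X @ _ --> _](_ : _ = (fun n : nat => \sum_(k < n) (Q (Some i) (Some (k : nat))) + (i < n)%N%:R * Q (Some i) None)).
  exact: cvgD.
apply/funext => n.
transitivity (\sum_(k < n) (Q (Some i) (Some (k : nat)) + (k == i :> nat)%:R * Q (Some i) None)).
  apply: eq_bigr => k _ /=; rewrite /Qbar.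
  have -> : (Some i == Some (k : nat)) = (k == i :> nat) by apply/eqP/eqP => [[->]|->].
  by case: eqP => [->|_]; rewrite ?mul1r// mul0r addr0.
rewrite big_split/= -mulr_suml; congr (_ + _ * _).
have [ni|ni] := ltnP i n.
  rewrite (bigD1 (Ordinal ni))//= eqxx big1 ?addr0// => k /eqP ki.
  by case: eqP => // e; exfalso; apply: ki; exact: val_inj.
by rewrite big1// => k _; rewrite ltn_eqF// (leq_trans (ltn_ord k)).
Qed.

End Qbar_facts.

(** The infima in [exc_g1] and [exc_d1] range over strictly later times, so the left end of an
    interval is reached only as a limit from the right. *)
Lemma le_of_right_dense (R : realType) (x b : \bar R) (r : R) : (r%:E < b)%E ->
  (forall t : R, (r%:E < t%:E)%E -> (t%:E < b)%E -> (x <= t%:E)%E) -> (x <= r%:E)%E.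
Proof.
move=> rb H; rewrite leNgt; apply/negP => rx.
have : (r%:E < mine x b)%E by rewrite lt_min rx rb.
case E : (mine x b) => [s||//] rs.
  have h1 : (r%:E < ((r + s) / 2)%:E)%E by rewrite lte_fin midf_lt.
  have : (((r + s) / 2)%:E < mine x b)%E by rewrite E lte_fin midf_lt.
  rewrite lt_min => /andP[tx tb].
  by have := H _ h1 tb; rewrite leNgt tx.
have : ((r + 1)%:E < mine x b)%E by rewrite E ltry.
rewrite lt_min => /andP[tx tb].
by have := H (r + 1) _ tb; rewrite leNgt tx => /(_ _)/negP; rewrite lte_fin ltrDl ltr01 => /(_ isT).
Qed.

(** * Start, end and states of the first excursion in terms of the jump times *)

Section excursion_paths.
Local Open Scope ereal_scope.
Context d (Omega : measurableType d) (R : realType).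
Variable X : R -> Omega -> state.
Variables (Y : nat -> Omega -> state) (J : nat -> Omega -> \bar R).
Hypothesis mY : forall n y, measurable (Y n @^-1` [set y]).
Hypothesis mJ : forall n, measurable_fun [set: Omega] (J n : Omega -> \bar R).
Hypothesis J0 : forall w, J 0%N w = 0%E.
Hypothesis Jmono : forall n w, J n w <= J n.+1 w.
Hypothesis Jexp : forall w (t : R), exists n, t%:E < J n w.
Hypothesis XY : forall w n (t : R), J n w <= t%:E -> t%:E < J n.+1 w -> X t w = Y n w.

Let Jge n w : 0 <= J n w.
Proof. exact: Jge0. Qed.

Let fin_of_lt (x y : \bar R) : 0 <= x -> x < y -> exists2 r : R, (0 <= r)%R & x = r%:E.
Proof.
by case: x => [r r0 _| _ |//]; [exists r|rewrite ltNge leey].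
Qed.

Definition g1_at n w : \bar R := if (Y n w != Some 0%N) && (J n w < J n.+1 w) then J n w else +oo.

Lemma exc_g1E w : exc_g1 X w = ereal_inf [set g1_at n w | n in setT].
Proof.
apply/eqP; rewrite eq_le; apply/andP; split.
  apply: le_ereal_inf_tmp => _ [n _ <-]; rewrite /g1_at; case: ifP => [/andP[/eqP Yn JJ]|_]; last exact: leey.
  have [r r0 Jr] := fin_of_lt (Jge n w) JJ; rewrite Jr in JJ *.
  apply: (le_of_right_dense JJ) => t rt tJ; apply: ereal_inf_lbound; exists t => //; split.
    by rewrite (le_lt_trans r0).
  by rewrite (@XY w n)// Jr ltW.
apply: le_ereal_inf_tmp => _ [t [t0 Xt] <-].
have [n [h1 h2]] := jump_index J0 Jexp w (ltW t0).
apply: (@le_trans _ _ (g1_at n w)); first by apply: ereal_inf_lbound; exists n.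
rewrite /g1_at (le_lt_trans h1 h2) andbT; case: eqP => //= Yn.
by exfalso; apply: Xt; rewrite (XY h1 h2).
Qed.

Lemma exc_g1_ge0 w : 0 <= exc_g1 X w.
Proof.
rewrite exc_g1E; apply: le_ereal_inf_tmp => _ [n _ <-]; rewrite /g1_at.
by case: ifP => // _; exact: leey.
Qed.

(** An interval of constancy at 0 is cut at [exc_g1], because only later times count for the end of
    the excursion; an empty remainder contributes [+oo]. In particular the initial stay at 0 drops
    out. *)
Definition d1_at n w : \bar R := let m := maxe (J n w) (exc_g1 X w) in
  if (Y n w == Some 0%N) && (m < J n.+1 w) then m else +oo.

Lemma exc_d1E w : exc_d1 X w = ereal_inf [set d1_at n w | n in setT].
Proof.
apply/eqP; rewrite eq_le; apply/andP; split.
  apply: le_ereal_inf_tmp => _ [n _ <-]; rewrite /d1_at; case: ifP => [/andP[/eqP Yn JJ]|_]; last exact: leey.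
  have m0 : 0 <= maxe (J n w) (exc_g1 X w) by rewrite le_max Jge.
  have [r r0 Jr] := fin_of_lt m0 JJ; rewrite Jr in JJ *.
  have : maxe (J n w) (exc_g1 X w) <= r%:E by rewrite Jr.
  rewrite ge_max => /andP[Jnr gr].
  apply: (le_of_right_dense JJ) => t rt tJ; apply: ereal_inf_lbound; exists t => //; split.
    exact: le_lt_trans rt.
  by rewrite (@XY w n)//; apply: le_trans (ltW rt).
apply: le_ereal_inf_tmp => _ [t [t0 Xt] <-].
have t00 : (0 <= t)%R by rewrite -lee_fin; apply: le_trans (exc_g1_ge0 w) (ltW t0).
have [n [h1 h2]] := jump_index J0 Jexp w t00.
apply: (@le_trans _ _ (d1_at n w)); first by apply: ereal_inf_lbound; exists n.
have mt : maxe (J n w) (exc_g1 X w) <= t%:E by rewrite ge_max h1 ltW.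
by rewrite /d1_at (le_lt_trans mt h2) -(XY h1 h2) Xt eqxx.
Qed.

Let measurable_inf (f : nat -> Omega -> \bar R) : (forall n, measurable_fun setT (f n)) ->
  measurable_fun setT (fun w => ereal_inf [set f n w | n in setT]).
Proof.
move=> mf; rewrite (_ : (fun w => _) = fun w => einfs (f ^~ w) 0%N).
  by apply: measurable_fun_einfs.
apply/funext => w; rewrite /einfs /sdrop.
by congr ereal_inf; apply/seteqP; split => x /= [n _ <-]; exists n.
Qed.

Let mYb n (z : state) : measurable_fun setT (fun w => Y n w == z).
Proof.
apply: (measurable_fun_bool true); rewrite setTI.
by rewrite (_ : _ @^-1` _ = Y n @^-1` [set z])//; apply/seteqP; split => w /= /eqP.
Qed.

Lemma measurable_exc_g1 : measurable_fun setT (exc_g1 X).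
Proof.
rewrite (_ : exc_g1 X = fun w => ereal_inf [set g1_at n w | n in setT]); last by apply/funext => w; exact: exc_g1E.
apply: measurable_inf => n.
apply: measurable_fun_ifT; [|exact: mJ|exact: measurable_cst].
apply: measurable_and; last exact: measurable_fun_lte.
exact: measurable_neg.
Qed.

Lemma measurable_exc_d1 : measurable_fun setT (exc_d1 X).
Proof.
rewrite (_ : exc_d1 X = fun w => ereal_inf [set d1_at n w | n in setT]); last by apply/funext => w; exact: exc_d1E.
have mm n : measurable_fun setT (fun w => maxe (J n w) (exc_g1 X w)).
  by apply: measurable_maxe => //; exact: measurable_exc_g1.
apply: measurable_inf => n.
apply: measurable_fun_ifT; [|exact: mm|exact: measurable_cst].
by apply: measurable_and => //; exact: measurable_fun_lte.
Qed.

Lemma measurable_exc_len : measurable_fun setT (exc_len X).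
Proof. by apply: emeasurable_funB; [exact: measurable_exc_d1|exact: measurable_exc_g1]. Qed.

Lemma measurable_exc_event v i : (0 <= v)%R -> measurable (exc_event X v i).
Proof.
move=> v0.
have mg := measurable_exc_g1; have ml := measurable_exc_len.
have mgv : measurable_fun setT (fun w => exc_g1 X w + v%:E) by exact: emeasurable_funD.
have ltm (f g : Omega -> \bar R) : measurable_fun setT f -> measurable_fun setT g ->
  measurable [set w | f w < g w] by exact: measurable_setlte.
have lem (f g : Omega -> \bar R) : measurable_fun setT f -> measurable_fun setT g ->
  measurable [set w | f w <= g w].
  by move=> mf mh; have := emeasurable_fun_le measurableT mf mh; rewrite setTI.
have mE : measurable [set w | exc_g1 X w < +oo /\ (exists n, Y n w = Some i /\
   (J n w <= exc_g1 X w + v%:E /\ exc_g1 X w + v%:E < J n.+1 w)) /\ v%:E < exc_len X w].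
  apply: measurable_conj; first exact: ltm.
  apply: measurable_conj; last exact: ltm.
  apply: measurable_exists => n; apply: measurable_conj; first exact: mY.
  by apply: measurable_conj; [exact: lem|exact: ltm].
congr measurable: mE; apply/seteqP; split => w /=.
  move=> [gf [[n [Yn [h1 h2]]] vl]].
  have [g _ gE] := fin_of_lt (exc_g1_ge0 w) gf.
  exists g; split => //; split => //; rewrite gE -EFinD in h1 h2.
  by rewrite (XY h1 h2).
move=> [g [gE [Xg vl]]]; rewrite gE; split; first exact: ltry.
split => //.
have gv0 : (0 <= g + v)%R.
  by rewrite addr_ge0// -lee_fin -gE exc_g1_ge0.
have [n [h1 h2]] := jump_index J0 Jexp w gv0.
by exists n; rewrite -(XY h1 h2) -EFinD.
Qed.

End excursion_paths.

(** * Law of the first excursion through the tabooed Green function *)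

Section excursion_law.
Local Open Scope ereal_scope.
Context d (Omega : measurableType d) (R : realType).
Variable P : probability Omega R.
Notation leb := (@lebesgue_measure R).
Variable Q : state -> state -> R.
Hypothesis HQ : is_Qmatrix Q.
Hypothesis QN : forall y, Q None y = 0%R.
Let Qb := Qbar Q.
Hypothesis qpos : forall k, (0 < qrate Qb (Some k))%R.
Hypothesis Qkill : forall i, (0 < i)%N -> Q (Some i) None = 0%R.
Variable X : R -> Omega -> state.
Variables (Y : nat -> Omega -> state) (J : nat -> Omega -> \bar R).
Hypothesis mY : forall n y, measurable (Y n @^-1` [set y]).
Hypothesis mJ : forall n, measurable_fun [set: Omega] (J n : Omega -> \bar R).
Hypothesis J0 : forall w, J 0%N w = 0%E.
Hypothesis Jmono : forall n w, J n w <= J n.+1 w.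
Hypothesis Jexp : forall w (t : R), exists n, t%:E < J n w.
Hypothesis XY : forall w n (t : R), J n w <= t%:E -> t%:E < J n.+1 w -> X t w = Y n w.
Hypothesis law : forall n (y : nat -> state) (s : nat -> R), (forall k, (0 <= s k)%R) ->
  P [set w | (forall k, (k <= n)%N -> Y k w = y k) /\
             (forall k, (k < n)%N -> ((s k)%:E < hold J k w)%E)]
         = ((y 0%N == Some 0%N)%:R *
            \prod_(k < n) (jprob Qb (y k) (y k.+1) *
                           expR (- qrate Qb (y k) * s k)))%:E.

Let HQb : is_Qmatrix Qb. Proof. exact: is_Qmatrix_Qbar. Qed.
Let QbN y : Qb None y = 0%R. Proof. exact: Qbar_None. Qed.
Let A := offdiag Q.
Let q k := qrate Q (Some k).
Let qb := qrate Qb (Some 0%N).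
Let D : pred nat := fun l => l != 0%N.
Let al := jprob Qb (Some 0%N).
Let Yc k := Y k.+1.
Let Sc k := rhold J k.+1.

Let mYc n z : measurable (Yc n @^-1` [set z]). Proof. exact: mY. Qed.
Let mSc n : measurable_fun setT (Sc n). Proof. exact: measurable_rhold. Qed.
Let Sc0 n w : (0 < Sc n w)%R. Proof. exact: rhold_gt0. Qed.
Let jp0 x y : (0 <= jprob Qb x y)%R. Proof. exact: jprob_ge0. Qed.
Let Dq x : inDs D x -> (0 < qrate Qb x)%R. Proof. by case: x. Qed.
Let jp1 l : D l -> (jprob Qb (Some l) None)%:E + \sum_(k <oo) (jprob Qb (Some l) (Some k))%:E = 1.
Proof. by move=> _; exact: jprob_sum. Qed.
Let A0 i j : (0 <= A i j)%R. Proof. exact: offdiag_ge0. Qed.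
Let t0A i j : (0 <= taboo A i j)%R. Proof. exact: taboo_ge0. Qed.
Let qbpos : (0 < qb)%R. Proof. exact: qpos. Qed.

Let jpE i j : (jprob Qb (Some i) (Some j) * qrate Qb (Some i))%R = A i j.
Proof. by rewrite jprob_Some// divfK ?lt0r_neq0// Qbar_offdiag. Qed.

Let jpN i : jprob Qb (Some i) None = 0%R.
Proof. by rewrite /jprob gt_eqF//= mul0r. Qed.

(* The excursion chain is the jump chain shifted by one step: the holding time
   at 0 is dropped, and the law of [Y 1] is the initial distribution. *)
Let lawc n (y : nat -> state) (s : nat -> R) : (forall k, (0 <= s k)%R) ->
  (forall k, (k < n)%N -> inDs D (y k)) ->
  P [set w | (forall k, (k <= n)%N -> Yc k w = y k) /\
             (forall k, (k < n)%N -> (s k < Sc k w)%R)] =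
  (al (y 0%N) * pweight (jprob Qb) (qrate Qb) n y s)%:E.
Proof.
move=> s0 yD.
have := @ctmc_law_rhold _ _ _ P Qb (Some 0%N) HQb QbN Y J mY mJ law n.+1 (scons (Some 0%N) y) (scons 0%R s).
rewrite pweight_scons /= mul1r mulr0 oppr0 expR0 mulr1 => <-; last 2 first.
- by case.
- by case => [|k] kn /=; [exact: qpos|apply: Dq; exact: yD].
have [N [mN N0 good]] := ctmc_good HQb QbN mY mJ law.
apply: (@prob_eq_ae _ _ _ _ _ _ N) => //.
- apply: measurable_conj.
    apply: (@measurable_forall_impl _ _ (fun k => (k <= n)%N)) => k; exact: mYc.
  apply: (@measurable_forall_impl _ _ (fun k => (k < n)%N)) => k.
  exact: measurable_setlt.
- apply: measurable_conj.
    apply: (@measurable_forall_impl _ _ (fun k => (k <= n.+1)%N)) => k; exact: mY.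
  apply: (@measurable_forall_impl _ _ (fun k => (k < n.+1)%N)) => k.
  by apply: measurable_setlt => //; exact: measurable_rhold.
move=> w nN; have [Y0 _ _ _] := good w nN; split=> [[h1 h2]|[h1 h2]].
  split; first by case => [_|k kn]; [exact: Y0|exact: h1].
  by case => [_|k kn]; [exact: rhold_gt0|exact: h2].
by split => k kn; [exact: (h1 k.+1)|exact: (h2 k.+1)].
Qed.

Let exc_good : exists N : set Omega, [/\ measurable N, P N = 0 &
  forall w, ~ N w -> [/\ Y 0 w = Some 0%N, forall n, Y n w <> None, Y 1 w <> Some 0%N,
    exists2 j1 : R, (0 < j1)%R & forall n, J n.+1 w = (j1 + jtime Sc n w)%:E
    & forall n, J n w < J n.+1 w]].
Proof.
have [N [mN N0 good]] := ctmc_good HQb QbN mY mJ law.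
exists N; split => // w nN; have [Y0 h0 jn hf] := good w nN.
have YN n : Y n w <> None.
  elim: n => [|n IH]; first by rewrite Y0.
  move=> Yn; have := jn n; case E : (Y n w) IH => [l|] // _.
  by rewrite Yn jpN.
have q0 n : (0 < qrate Qb (Y n w))%R by case E : (Y n w) (YN n) => [l|].
have HS n : (rhold J n w)%:E = hold J n w by apply: rholdE => //; exact: hf.
have Jt n : J n w = (jtime (rhold J) n w)%:E by apply: hold_jtime => // k _.
split => //.
- have := jn 0%N; rewrite Y0 => H Y1; apply: H.
  by rewrite Y1 jprob_Some// /offdiag eqxx mul0r.
- exists (rhold J 0 w); first exact: rhold_gt0.
  by move=> n; rewrite Jt /jtime big_ord_recl.
- by move=> n; rewrite !Jt lte_fin /jtime [X in (_ < X)%R]big_ord_recr/= ltrDl rhold_gt0.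
Qed.

Let g1_J w : Y 0 w = Some 0%N -> Y 1 w <> Some 0%N -> J 0 w < J 1 w -> J 1 w < J 2 w ->
  exc_g1 X w = J 1 w.
Proof.
move=> Y0 Y1 J01 J12; rewrite (exc_g1E J0 Jmono Jexp XY).
apply/eqP; rewrite eq_le; apply/andP; split.
  apply: (@le_trans _ _ (g1_at Y J 1 w)); first by apply: ereal_inf_lbound; exists 1%N.
  by rewrite /g1_at J12 andbT; case: eqP.
apply: le_ereal_inf_tmp => _ [n _ <-]; rewrite /g1_at; case: ifP => [/andP[Yn _]|_]; last exact: leey.
by case: n Yn => [|n _]; [rewrite Y0|exact: Jle].
Qed.

(* [m.+1] is the index of the first return of the jump chain to 0. *)
Let first_ret m := [set w | inD Yc D m w /\ Yc m w = Some 0%N].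

(** The excursion starts at [J 1] and ends at [J m.+1]; both contain the initial holding time [j1],
    which cancels in the length. *)
Let len_ret m w : Y 0 w = Some 0%N -> Y 1 w <> Some 0%N -> (forall n, J n w < J n.+1 w) ->
  (forall j1 : R, (forall n, J n.+1 w = (j1 + jtime Sc n w)%:E) ->
  first_ret m w -> exc_len X w = (jtime Sc m w)%:E).
Proof.
move=> Y0 Y1 JJ j1 Jt [im Ym].
have g1 := g1_J Y0 Y1 (JJ 0%N) (JJ 1%N).
have J1 : J 1 w = j1%:E by rewrite Jt /jtime big_ord0 addr0.
suff d1 : exc_d1 X w = J m.+1 w.
  by rewrite /exc_len d1 g1 J1 Jt -EFinB addrC addKr.
rewrite (exc_d1E J0 Jmono Jexp XY).
apply/eqP; rewrite eq_le; apply/andP; split.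
  apply: (@le_trans _ _ (d1_at X Y J m.+1 w)); first by apply: ereal_inf_lbound; exists m.+1.
  have -> : d1_at X Y J m.+1 w = J m.+1 w; last by [].
  have mE : maxe (J m.+1 w) (exc_g1 X w) = J m.+1 w by rewrite g1 max_l// Jle.
  by rewrite /d1_at mE JJ andbT; rewrite /Yc in Ym; rewrite Ym eqxx.
apply: le_ereal_inf_tmp => _ [n _ <-]; rewrite /d1_at; case: ifP => [/andP[/eqP Yn h]|_]; last exact: leey.
rewrite le_max; apply/orP; left; apply: Jle => //.
move: h; rewrite gt_max g1 => /andP[_ h].
have n1 : (1 <= n)%N.
  by case: n Yn h => // _; rewrite ltxx.
rewrite leqNgt; apply/negP => nm.
have := im n.-1; rewrite /Yc prednK// Yn /= => /(_ nm).
by [].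
Qed.

Let len_noret w : Y 0 w = Some 0%N -> Y 1 w <> Some 0%N -> (forall n, J n w < J n.+1 w) ->
  (forall n, (1 <= n)%N -> Y n w <> Some 0%N) -> exc_d1 X w = +oo.
Proof.
move=> Y0 Y1 JJ noret.
have g1 := g1_J Y0 Y1 (JJ 0%N) (JJ 1%N).
rewrite (exc_d1E J0 Jmono Jexp XY).
apply/eqP; rewrite -leye_eq; apply: le_ereal_inf_tmp => _ [n _ <-].
rewrite /d1_at; case: ifP => [/andP[/eqP Yn]|//].
rewrite gt_max g1 => /andP[_ h].
have n1 : (1 <= n)%N by case: n Yn h => // _; rewrite ltxx.
by exfalso; exact: noret n1 Yn.
Qed.

Let least_ret w n : (forall n, Y n w <> None) -> Yc n w = Some 0%N -> 
  exists2 m, (m <= n)%N & first_ret m w.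
Proof.
move=> YN /eqP Yn; have [m /eqP Ym minm] := @ex_minnP (fun n => Yc n w == Some 0%N) (ex_intro _ n Yn).
exists m; first exact: minm.
split => // k km; case E: (Yc k w) => [l|]; last by exfalso; exact: YN E.
rewrite /= /D; apply/eqP => l0; have := minm k; rewrite E l0 eqxx => /(_ isT).
by rewrite leqNgt km.
Qed.

(** The excursion enters by jump probabilities out of 0 and the tabooed kernel by jump rates; they
    differ by the factor [qb]. Off 0 nothing is killed, so both chains have the same holding
    rates. *)
Lemma jker_excursion n j t : qb%:E * jker (Aker (jprob Qb) (qrate Qb) D) (qker (qrate Qb)) (aker al D) n j t =
  jker (taboo A) q (EFin \o taboo A 0) n j t.
Proof.
have a0 k : 0 <= aker al D k by rewrite /aker; case: ifP => // _; rewrite lee_fin; exact: jp0.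
have K0 i k : (0 <= Aker (jprob Qb) (qrate Qb) D i k)%R by apply: Aker_ge0 => //; exact: Dq.
have off m x : jker (Aker (jprob Qb) (qrate Qb) D) (qker (qrate Qb)) (aker al D) m 0 x = 0.
  exact: jker_off.
have toff m x : jker (taboo A) q (EFin \o taboo A 0) m 0 x = 0.
  case: m => [|m] /=; first by rewrite /taboo mul0e.
  rewrite integral0_eq// => s _; rewrite /flux eseries0 ?mul0e// => k _ _.
  by rewrite /taboo mule0.
elim: n j t => [|n IH] j t.
  have [->|j0] := posnP j; first by rewrite off toff mule0.
  have qa : (qb * al (Some j))%R = A 0%N j by rewrite mulrC; exact: jpE.
  rewrite /= /aker /D -lt0n j0 /= muleA -EFinM qa /taboo gtn_eqF//.
  by rewrite /qker qrate_Qbar Qkill// subr0.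
have [->|j0] := posnP j; first by rewrite off toff mule0.
rewrite !jkerS -ge0_integralZl ?lee_fin ?(ltW qbpos)//; last 2 first.
- by apply: measurable_conv_fix; apply: measurable_flux_jker.
- by move=> s _; rewrite mule_ge0 ?expkE_ge0// flux_jker_ge0.
apply: eq_integral => s _; rewrite muleA; congr (_ * _).
  rewrite /flux -nneseriesZle ?lee_fin ?(ltW qbpos)//; last first.
    by move=> k; rewrite mule_ge0 ?jker_ge0// lee_fin.
  apply: eq_eseriesr => k _; rewrite muleA IH.
  have [->|k0] := posnP k; first by rewrite toff !mul0e.
  by rewrite /Aker /D -!lt0n k0 j0 /= jpE /taboo gtn_eqF.
by rewrite /qker qrate_Qbar Qkill// subr0.
Qed.

Let jk n j v := jker (Aker (jprob Qb) (qrate Qb) D) (qker (qrate Qb)) (aker al D) n j v.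

Let K0 i k : (0 <= Aker (jprob Qb) (qrate Qb) D i k)%R.
Proof. by apply: Aker_ge0 => //; exact: Dq. Qed.

Let a0 k : 0 <= aker al D k.
Proof. by rewrite /aker; case: ifP => // _; rewrite lee_fin; exact: jp0. Qed.

Let jk0 n j v : 0 <= jk n j v.
Proof. exact: jker_ge0. Qed.

Let mjk n j : measurable_fun setT (jk n j).
Proof. exact: measurable_jker. Qed.

Let jtime_step a b w : (a < b)%N -> (jtime Sc a w + Sc a w <= jtime Sc b w)%R.
Proof.
have E c : jtime Sc c.+1 w = (jtime Sc c w + Sc c w)%R by rewrite /jtime big_ord_recr.
elim: b => // b IH; rewrite ltnS leq_eqVlt => /predU1P[->|ab]; first by rewrite E.
by rewrite E; apply: le_trans (IH ab) _; rewrite lerDl ltW.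
Qed.

Let measurable_first_ret m : measurable (first_ret m).
Proof. by apply: measurable_at. Qed.

(** Off a null set, being at [i] at excursion time [v] means that [v] lies in the [n]-th holding
    interval after departure, for a unique [n], with no visit to 0 before. The condition
    [v < exc_len] is what excludes earlier returns. *)
Lemma prob_exc_event v i : (0 <= v)%R -> (0 < i)%N ->
  P (exc_event X v i) = \sum_(n <oo) jk n i v.
Proof.
move=> v0 i0; have [N [mN N0 good]] := exc_good.
pose E n := [set w | at_ Yc D n i w /\ (jtime Sc n w <= v < jtime Sc n w + Sc n w)%R].
have mE n : measurable (E n).
  apply: measurable_conj; first exact: measurable_at.
  have mjt : measurable_fun setT (jtime Sc n) by exact: measurable_jtime.
  have mm : measurable [set w | (jtime Sc n w <= v)%R /\ (v < jtime Sc n w + Sc n w)%R].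
    apply: measurable_conj; first exact: measurable_setle.
    by apply: measurable_setlt => //; exact: measurable_funD.
  by congr measurable: mm; apply/seteqP; split => w /=; [move=> h; exact/andP|move/andP].
have Di : D i by rewrite /D -lt0n.
transitivity (\sum_(n <oo) P (E n)); last first.
  apply: eq_eseriesr => n _; rewrite /E (hold_atE mYc mSc Sc0 jp0 Dq jp1 lawc)//.
  by rewrite (hold_at_jker mYc mSc Sc0 jp0 Dq lawc).
rewrite (eq_eseriesl (Q := fun n => n \in [set: nat])); last by move=> k; apply/esym; exact: mem_set.
rewrite -measure_bigcup//; last first.
  apply/trivIsetP => a b _ _ ab; apply/seteqP; split => w //= [[_ /andP[a1 a2]] [_ /andP[b1 b2]]].
  have [h|h|h] := ltngtP a b.
  - by have := le_lt_trans (le_trans (jtime_step w h) b1) a2; rewrite ltxx.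
  - by have := le_lt_trans (le_trans (jtime_step w h) a1) b2; rewrite ltxx.
  - by rewrite h eqxx in ab.
apply: (@prob_eq_ae _ _ _ _ _ _ N) => //.
- exact: (measurable_exc_event mY mJ J0 Jmono Jexp XY).
- exact: bigcupT_measurable.
move=> w nN; have [Y0 YN Y1 [j1 j10 Jt] JJ] := good w nN.
have g1 : exc_g1 X w = j1%:E by rewrite g1_J// Jt /jtime big_ord0 addr0.
have Jc n : (J n.+1 w <= (j1 + v)%:E) = (jtime Sc n w <= v)%R by rewrite Jt lee_fin lerD2l.
have Jd n : ((j1 + v)%:E < J n.+2 w) = (v < jtime Sc n w + Sc n w)%R.
  by rewrite Jt lte_fin ltrD2l /jtime big_ord_recr.
have jv0 : (0 <= j1 + v)%R by rewrite addr_ge0// ltW.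
split.
  move=> [g [gE [Xg vL]]]; move: gE; rewrite g1 => -[] gE; rewrite -{}gE in Xg.
  have [[|n] [h1 h2]] := jump_index J0 Jexp w jv0.
    by move: h2; rewrite Jt lte_fin /jtime big_ord0 addr0 ltNge lerDl v0.
  exists n => //; split; last by apply/andP; rewrite -Jc -Jd.
  have Yn : Yc n w = Some i by rewrite -Xg; apply/esym; exact: XY.
  split => // k kn; case Ek : (Yc k w) => [l|]; last by exfalso; exact: YN Ek.
  rewrite /= /D; apply/eqP => l0; rewrite l0 in Ek.
  have [m mk rm] := least_ret YN Ek.
  move: vL; rewrite (len_ret Y0 Y1 JJ Jt rm) lte_fin ltNge => /negP; apply.
  rewrite Jc in h1; apply: le_trans h1.
  have := jtime_step w (leq_ltn_trans mk kn); apply: le_trans.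
  by rewrite lerDl ltW.
move=> [n _ [[im Yn] /andP[h1 h2]]].
exists j1; split => //; split.
  by rewrite -Yn; apply: XY; rewrite ?Jc ?Jd.
have [[m Ym]|noret] := pselect (exists m, Yc m w = Some 0%N); last first.
  have -> : exc_len X w = +oo; last exact: ltry.
  rewrite /exc_len g1 len_noret// => -[//|m _] Ym; apply: noret; by exists m.
have [m' m'm rm] := least_ret YN Ym.
rewrite (len_ret Y0 Y1 JJ Jt rm) lte_fin.
apply: (lt_le_trans h2); apply: jtime_step; rewrite ltnNge; apply/negP => m'n.
case: rm => _ Ym'; move: m'n; rewrite leq_eqVlt => /predU1P[e|m'n].
  by move: Ym'; rewrite e Yn => -[] e'; rewrite e' in i0.
by have := im m' m'n; rewrite Ym'.
Qed.

Let mexpM (th : R) : measurable_fun setT (fun v : measurableTypeR R => (expR (th * v))%:E : \bar R).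
Proof. by apply/measurable_EFinP; apply: measurableT_comp => //; exact: measurable_funM. Qed.

Let gsum_jk th n j : \int[leb]_v ((expR (th * v))%:E * (qb%:E * jk n j v)) = green A q th n j.
Proof.
apply: eq_integral => v _; rewrite jker_excursion jker_tilt// => k.
by rewrite lee_fin t0A.
Qed.

Lemma exc_int_gsum th i : (0 < i)%N -> qb%:E * exc_int P X th i = gsum A q th i.
Proof.
move=> i0.
have -> : exc_int P X th i = \int[leb]_v \sum_(n <oo) ((expR (th * v))%:E * jk n i v).
  rewrite /exc_int integral_mkcond; apply: eq_integral => v _.
  rewrite nneseriesZle ?lee_fin ?expR_ge0//.
  rewrite patchE mem_setE in_itv/= andbT; case: (leP 0%R v) => v0.
    by rewrite prob_exc_event// muleC.
  rewrite eseries0 ?mule0// => n _ _; exact: jker_lt0.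
have me n : measurable_fun setT (fun v : measurableTypeR R => (expR (th * v))%:E * jk n i v).
  exact: (emeasurable_funM (mexpM th) (mjk n i)).
have e0 n v : 0 <= (expR (th * v))%:E * jk n i v by rewrite mule_ge0// lee_fin expR_ge0.
rewrite integral_seriesT// -nneseriesZle ?lee_fin ?(ltW qbpos)//; last by move=> n; exact: integral_ge0.
rewrite /gsum; apply: eq_eseriesr => n _.
rewrite -ge0_integralZl ?lee_fin ?(ltW qbpos)// -gsum_jk.
by apply: eq_integral => v _; rewrite muleCA.
Qed.

(** The truncation makes the length nonnegative on every path, as the moment lemmas require; off the
    null set it changes nothing. *)
Definition exc_time w : \bar R := maxe 0 (exc_len X w).

Lemma exc_time_ge0 w : 0 <= exc_time w.
Proof. by rewrite le_max lexx. Qed.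

Lemma measurable_exc_time : measurable_fun setT exc_time.
Proof.
by apply: measurable_maxe => //; exact: (measurable_exc_len mY mJ J0 Jmono Jexp XY).
Qed.

Let exc_timeE w : Y 0 w = Some 0%N -> (forall n, Y n w <> None) -> Y 1 w <> Some 0%N -> 
  (forall j1 : R, (forall n, J n.+1 w = (j1 + jtime Sc n w)%:E) -> (forall n, J n w < J n.+1 w) ->
  exc_time w = exc_len X w /\ (exc_time w < +oo -> exists m, first_ret m.+1 w /\ exc_time w = (jtime Sc m.+1 w)%:E)).
Proof.
move=> Y0 YN Y1 j1 Jt JJ.
have g1 : exc_g1 X w = j1%:E by rewrite g1_J// Jt /jtime big_ord0 addr0.
have [[m Ym]|noret] := pselect (exists m, Yc m w = Some 0%N); last first.
  have L : exc_len X w = +oo.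
    by rewrite /exc_len g1 len_noret// => -[//|m _] Ym; apply: noret; exists m.
  by rewrite /exc_time L maxey.
have [[|m'] m'm rm] := least_ret YN Ym; first by case: rm => _ Y1'.
have E : exc_time w = (jtime Sc m'.+1 w)%:E.
  rewrite /exc_time (len_ret Y0 Y1 JJ Jt rm) max_r// lee_fin.
  by apply: sumr_ge0 => k _; exact: ltW.
split; first by rewrite E (len_ret Y0 Y1 JJ Jt rm).
by move=> _; exists m'.
Qed.

Lemma Psi_eta_mgf th : Psi_eta P X th = mgf P exc_time th.
Proof.
have [N [mN N0 good]] := exc_good.
apply: ae_eq_integral => //.
- apply: measurable_expeRM; exact: (measurable_exc_len mY mJ J0 Jmono Jexp XY).
- by apply: measurable_expeRM; exact: measurable_exc_time.
exists N; split => // w /= H; apply: contrapT => nN; apply: H => _.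
have [Y0 YN Y1 [j1 j10 Jt] JJ] := good w nN.
by rewrite (exc_timeE Y0 YN Y1 Jt JJ).1.
Qed.

(** A finite moment makes the excursion almost surely finite, so the events [first_ret m.+1]
    partition the space up to a null set; the index starts at 1 because [Y 1] is not 0. On each, the
    return from [l] has intensity [A l 0] times the jump kernel. *)
Lemma Psi_eta_green th : (0 < th)%R -> Psi_eta P X th < +oo ->
  qb%:E * Psi_eta P X th = green_return A q th.
Proof.
rewrite Psi_eta_mgf => th0 fin.
have mT := measurable_exc_time.
have [N [mN N0 good]] := exc_good.
have mjt m : measurable_fun setT (jtime Sc m) by exact: measurable_jtime.
have mI m : measurable_fun setT (fun w => (\1_(first_ret m.+1) w)%:E * (expR (th * jtime Sc m.+1 w))%:E : \bar R).
  apply: emeasurable_funM; first by apply/measurable_EFinP; exact: measurable_indic.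
  by apply/measurable_EFinP; apply: measurableT_comp => //; exact: measurable_funM.
have I0 m w : 0 <= (\1_(first_ret m.+1) w)%:E * (expR (th * jtime Sc m.+1 w))%:E :> \bar R.
  by rewrite mule_ge0 ?lee_fin ?expR_ge0.
have E1 : mgf P exc_time th = \int[P]_w \sum_(m <oo) ((\1_(first_ret m.+1) w)%:E * (expR (th * jtime Sc m.+1 w))%:E).
  rewrite (mgf_fineE mT exc_time_ge0 th0 fin); apply: ae_eq_integral => //.
  - apply/measurable_EFinP; apply: measurableT_comp => //; apply: measurable_funM => //.
    exact: measurableT_comp.
  - exact: measurable_seriesT.
  exists (N `|` [set w | exc_time w = +oo]).
  have mi : measurable [set w | exc_time w = +oo].
    by have := mT measurableT _ (emeasurable_set1 +oo); rewrite setTI.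
  split; [exact: measurableU| |].
  - exact: etrans (measureU0 mN mi (mgf_ltyE mT th0 fin)) N0.
  move=> w /= H; apply: contrapT => /not_orP[nN Tf]; apply: H => _.
  have [Y0 YN Y1 [j1 j10 Jt] JJ] := good w nN.
  have [_ /(_ _)[]] := exc_timeE Y0 YN Y1 Jt JJ; first by rewrite ltey; exact/eqP.
  move=> m [[im Ym] ->] /=.
  rewrite (@nneseriesD1 _ (fun k => (\1_(first_ret k.+1) w)%:E * (expR (th * jtime Sc k.+1 w))%:E) m)//.
  rewrite indicE mem_set// mul1e eseries0 ?adde0// => k _ km.
  rewrite indicE memNset ?mul0e// => -[ik Yk].
  have [h|h|h] := ltngtP k m.
  - by have := im k.+1 h; rewrite Yk.
  - by have := ik m.+1 h; rewrite Ym.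
  - by rewrite h eqxx in km.
rewrite E1 integral_seriesT// -nneseriesZle ?lee_fin ?(ltW qbpos)//; last by move=> n; exact: integral_ge0.
apply: eq_eseriesr => m _.
have md : measurable_fun setT (dens P Yc Sc (jprob Qb) (qrate Qb) D m (Some 0%N)).
  exact: (measurable_dens P mYc mSc jp0 Dq).
have d0 u : 0 <= dens P Yc Sc (jprob Qb) (qrate Qb) D m (Some 0%N) u by exact: (dens_ge0 P _ _ jp0 Dq).
rewrite (@density_transfer _ Omega R P (first_ret m.+1) (jtime Sc m.+1) (dens P Yc Sc (jprob Qb) (qrate Qb) D m (Some 0%N)) (fun u => expR (th * u))%R)//; last 2 first.
- move=> B mB; rewrite -(kapS mYc mSc Sc0 jp0 Dq lawc)// /kap; congr (P _).
  by apply/seteqP; split => w /=; [move=> [[? ?] ?]|move=> [? [? ?]]].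
- by apply: measurableT_comp => //; exact: measurable_funM.
rewrite -ge0_integralZl ?lee_fin ?(ltW qbpos)//; last 2 first.
- exact: (emeasurable_funM md (mexpM th)).
- by move=> u _; rewrite mule_ge0 ?lee_fin ?expR_ge0.
transitivity (\int[leb]_u \sum_(l <oo) ((expR (th * u))%:E * (qb%:E * jk m l u) * (A l 0)%:E)).
  apply: eq_integral => u _.
  rewrite (densE mYc mSc Sc0 jp0 Dq lawc) -/(jk m).
  rewrite -nneseriesZre ?lee_fin ?expR_ge0//; last first.
    by move=> l; rewrite mule_ge0// jpE lee_fin.
  rewrite -nneseriesZle ?lee_fin ?(ltW qbpos)//; last first.
    by move=> l; rewrite !mule_ge0 ?lee_fin ?expR_ge0// jpE.
  apply: eq_eseriesr => l _; rewrite jpE.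
  by rewrite muleA muleC [qb%:E * (_ * _)]muleA muleA.
have me l : measurable_fun setT (fun u : measurableTypeR R => (expR (th * u))%:E * (qb%:E * jk m l u)).
  apply: (emeasurable_funM (mexpM th)).
  by apply: emeasurable_funM; [exact: measurable_cst|exact: mjk].
have e0 l u : 0 <= (expR (th * u))%:E * (qb%:E * jk m l u).
  by rewrite !mule_ge0 ?lee_fin ?expR_ge0// ltW.
rewrite integral_seriesT; last 2 first.
- by move=> l; exact: emeasurable_funM.
- by move=> l u; rewrite mule_ge0// lee_fin.
apply: eq_eseriesr => l _; rewrite ge0_integralZr// ?lee_fin//.
by rewrite gsum_jk.
Qed.

End excursion_law.

(** * The Malthusian parameter and the theorem *)

Section abscissa.
Local Open Scope ereal_scope.
Context d (Omega : measurableType d) (R : realType).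
Variable P : probability Omega R.
Variable T : Omega -> \bar R.
Hypothesis mT : measurable_fun setT T.
Hypothesis T0 : forall w, 0 <= T w.

(** Below [a] the tail bound makes the moment finite. Above [a] a finite moment would, by Chernoff,
    make the tail decay faster than its exact order [C * exp(- a t)]. *)
Lemma mgf_abscissa (a C M : R) : (0 < a)%R -> (0 < C)%R -> (0 <= M)%R ->
  (forall t : R, (0 <= t)%R -> P [set w | t%:E < T w] <= (M * expR (- (a * t)))%:E) ->
  (expR (a * t) * fine (P [set w | (t%:E < T w)%E]))%R @[t --> +oo%R] --> C ->
  ereal_sup [set g%:E | g in [set g : R | (0 < g)%R /\ mgf P T g < +oo]] = a%:E.
Proof.
move=> a0 C0 M0 tail cvC; set s := ereal_sup _.
have below g : (0 < g)%R -> (g < a)%R -> g%:E <= s.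
  move=> g0 ga; apply: ereal_sup_ubound; exists g => //; split => //.
  exact: (mgf_lty_of_tail mT T0 g0 ga M0).
apply/eqP; rewrite eq_le; apply/andP; split; last first.
  rewrite leNgt; apply/negP => sa.
  (* Any exponent in ]0, a[ would serve: it shows that the supremum is positive, so a supremum below
     [a] is a real number and the midpoint can be taken. *)
  have a2 : (a / 2 < a)%R by rewrite ltr_pdivrMr// ltr_pMr// ltr1n.
  have h2 : (a / 2)%:E <= s by apply: below => //; rewrite divr_gt0.
  move: sa h2 below; case: s => [s| |] //.
  rewrite lte_fin lee_fin => sa h2 below.
  have h0 : (0 < (s + a) / 2)%R by rewrite divr_gt0// addr_gt0// (lt_le_trans _ h2)// divr_gt0.
  have := below _ h0 (midf_lt sa).2; rewrite lee_fin leNgt => /negP; apply.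
  exact: (midf_lt sa).1.
apply: ge_ereal_sup => _ [g [g0 gfin] <-]; rewrite lee_fin leNgt; apply/negP => ag.
have mf : mgf P T g \is a fin_num.
  by rewrite ge0_fin_numE//; apply: integral_ge0 => w _; exact: expeR_ge0.
set K := fine (mgf P T g).
have K1 : (0 <= K)%R by apply: fine_ge0; apply: integral_ge0 => w _; exact: expeR_ge0.
have C2 : (C / 2 < C)%R by rewrite ltr_pdivrMr// ltr_pMr// ltr1n.
have ev : \forall t \near +oo%R, (C / 2 < expR (a * t) * fine (P [set w | (t%:E < T w)%E]))%R.
  exact: (cvgr_gt C).
(* Beyond this time exp((g - a) t) exceeds [2 * K / C]; multiplied by the lower bound [C / 2] of
   [ev] it exceeds the Chernoff bound [K]. *)
have ev2 : \forall t \near +oo%R, (2 * K / C / (g - a) < t)%R.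
  by exists (2 * K / C / (g - a))%R; rewrite num_real.
have ev3 : \forall t \near +oo%R, (0 < (t : R))%R by exists 0%R; rewrite num_real.
have [t [[h1 h3] h2]] := filter_ex (filterI (filterI ev ev3) ev2).
have := mgf_chernoff P mT (ltW g0) (ltW h3).
set S := P _ in h1 *.
have Sf : S \is a fin_num.
  apply: prob_fin; have := emeasurable_fun_lt measurableT (measurable_cst t%:E) mT; by rewrite setTI.
rewrite -(fineK mf) -/K -(fineK Sf) -EFinM lee_fin leNgt => /negP; apply.
have -> : (g * t = (g - a) * t + a * t)%R by rewrite -mulrDl subrK.
rewrite expRD -mulrA.
have e1 : (2 * K / C < expR ((g - a) * t))%R.
  rewrite ltr_pdivrMr ?subr_gt0// [X in (_ < X)%R]mulrC in h2; apply: (lt_le_trans h2).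
  by apply: le_trans (expR_ge1Dx _); rewrite lerDr.
have e2 : (K = 2 * K / C * (C / 2))%R by field; rewrite lt0r_neq0.
rewrite {1}e2; apply: (@le_lt_trans _ _ (2 * K / C * (expR (a * t) * fine S))%R).
  by rewrite ler_wpM2l ?(ltW h1)// divr_ge0 ?mulr_ge0// ltW.
rewrite ltr_pM2r//; apply: lt_trans h1; by rewrite divr_gt0.
Qed.

End abscissa.

Section irreducibility.
Variable R : realType.
Variable Q : state -> state -> R.
Hypothesis HQ : is_Qmatrix Q.
Hypothesis irr : irreducible_on_N Q.

(** Irreducibility as an induction principle, by induction along the connecting path. All positivity
    and finiteness arguments use it in this form. *)
Lemma offdiag_ind i (H : nat -> Prop) : H i ->
  (forall k j, H k -> 0 < offdiag Q k j -> H j) -> forall j, H j.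
Proof.
move=> Hi step j; have [s /andP[ps /eqP <-]] := irr i j.
elim: s i Hi ps => [//|a s IH] i Hi /= /andP[/andP[ia qia] ps].
by apply: IH ps; apply: (step i) => //; rewrite /offdiag (negbTE ia).
Qed.

Lemma offdiag_out i : exists j, 0 < offdiag Q i j.
Proof.
have [[|a s] /andP[]] := irr i i.+1; first by move=> _ /= /eqP /n_Sn.
by move=> /= /andP[/andP[ia qia] _] _; exists a; rewrite /offdiag (negbTE ia).
Qed.

Lemma qrate_gt_kill i : Q (Some i) None < qrate Q (Some i).
Proof.
have [j qj] := offdiag_out i.
rewrite -subr_gt0 -lte_fin -(offdiag_sum HQ).
apply: (@lt_le_trans _ _ (offdiag Q i j)%:E); first by rewrite lte_fin.
by apply: (@nneseries_term _ (fun j => (offdiag Q i j)%:E)) => k; rewrite lee_fin offdiag_ge0.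
Qed.

End irreducibility.

Lemma Pmix_delta d (Omega : measurableType d) (R : realType) (P : nat -> probability Omega R)
  (i : nat) (B : nat -> set Omega) :
  is_prob_vector (fun k => (k == i)%:R : R) /\ Pmix P (fun k => (k == i)%:R) B = P i (B i).
Proof.
split; last by rewrite /Pmix (nneseries_delta (f := fun k => P k (B k))).
split=> [k|]; first by rewrite ler0n.
apply: cvg_near_cst; exists i.+1 => // n /= ni; rewrite /series/=.
rewrite (big_rem i) ?mem_index_iota//= eqxx big1_seq ?addr0// => k /andP[_].
by rewrite mem_rem_uniq ?iota_uniq// inE => /andP[/negbTE ->].
Qed.

Section psi_root.
Context d (Omega : measurableType d) (R : realType).
Variable P : probability Omega R.
Variable Q : state -> state -> R.
Variable X : R -> Omega -> state.
Variable T : Omega -> \bar R.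
Hypothesis mT : measurable_fun setT T.
Hypothesis T0 : forall w, (0 <= T w)%E.
Hypothesis PsiE : forall th, Psi_eta P X th = mgf P T th.
Hypothesis qb0 : qbar00 Q < 0.

Lemma Psi_eta_fin th : (th%:E < theta_plus P X)%E -> (mgf P T th < +oo)%E.
Proof.
move=> /ereal_sup_gt[_ [g [g0 gfin] <-]]; rewrite lte_fin => thg.
rewrite PsiE in gfin; apply: le_lt_trans gfin.
exact: (mgf_le P mT T0 (ltW thg)).
Qed.

Let finmgf th : (mgf P T th < +oo)%E -> mgf P T th \is a fin_num.
Proof.
by move=> H; rewrite ge0_fin_numE//; apply: integral_ge0 => w _; exact: expeR_ge0.
Qed.

Lemma psi_strict x y : x < y -> (y%:E < theta_plus P X)%E -> psi Q P X x < psi Q P X y.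
Proof.
move=> xy yp; rewrite /psi !PsiE.
have mxy := mgf_le P mT T0 (ltW xy).
have fy := Psi_eta_fin yp; have fx := le_lt_trans mxy fy.
apply: ltr_leD => //; rewrite lerN2 ler_nM2l// lerD2r.
by apply: fine_le => //; exact: finmgf.
Qed.

(** Both cases of [is_lambda_c] exclude the value -oo of an empty supremum, so some positive
    exponent has a finite moment. *)
Lemma theta_plus_gt0 l : is_lambda_c Q P X l -> (0 < theta_plus P X)%E.
Proof.
case=> [[-> _]|[tp [tpE _]]]; first exact: ltry.
have : (tp%:E - 1 < theta_plus P X)%E by rewrite tpE lte_fin ltrBlDr ltrDl.
move=> /ereal_sup_gt[_ [g [g0 gfin] <-] _].
apply: (@lt_le_trans _ _ g%:E); first by rewrite lte_fin.
by apply: ereal_sup_ubound; exists g.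
Qed.

Lemma psi_large l lam : is_lambda_c Q P X l -> (lam%:E < l)%E ->
  exists x : R, [/\ 0 < x, (x%:E < theta_plus P X)%E & lam < psi Q P X x].
Proof.
move=> Hl ll; have tp0 := theta_plus_gt0 Hl.
have op : nbhs l [set y | (lam%:E < y)%E].
  by apply: open_nbhs_nbhs; split => //; exact: open_ereal_gt_ereal.
case: Hl => [[tpE cv]|[tp [tpE cv]]].
  have h1 : \forall x \near +oo, (lam%:E < (psi Q P X x)%:E)%E by exact: (cv _ op).
  have h2 : \forall x \near +oo, (0 : R) < x by exists 0; rewrite num_real.
  have [x [hx x0]] := filter_ex (filterI h1 h2).
  by exists x; split => //; rewrite tpE ltry.
have h1 : \forall x \near tp^'-, (lam%:E < (psi Q P X x)%:E)%E by exact: (cv _ op).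
have h2 : \forall x \near tp^'-, (0 : R) < x by apply: nbhs_left_gt; rewrite -lte_fin -tpE.
have h3 : \forall x \near tp^'-, x < tp by exact: nbhs_left_lt.
have [x [[hx x0] xtp]] : exists x : R,
    ((lam%:E < (psi Q P X x)%:E)%E /\ 0 < x) /\ x < tp.
  by apply: (@filter_ex _ (tp^'-) _); apply: filterI => //; exact: filterI.
by exists x; split => //; rewrite tpE lte_fin.
Qed.

(** Intermediate value theorem on [0, x], where [psi] is 0 at 0 and above [lam] at [x]. The point
    [x] also provides the larger tilt with a finite moment on which positive recurrence rests. *)
Lemma psi_root l lam : is_lambda_c Q P X l -> 0 < lam -> (lam%:E < l)%E ->
  exists ts th' : R, [/\ 0 < ts, ts < th', (th'%:E < theta_plus P X)%E & psi Q P X ts = lam].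
Proof.
move=> Hl lam0 ll; have [x [x0 xp lx]] := psi_large Hl ll.
have xfin := Psi_eta_fin xp.
have psi0 : psi Q P X 0 = 0 by rewrite /psi PsiE mgf0 subrr mulr0 subr0.
have cp : {within `[0, x], continuous (psi Q P X)}.
  (* Continuity up to the right end [x] needs a dominating exponent strictly beyond it. *)
  have [z xz zp] : exists2 z, x < z & (z%:E < theta_plus P X)%E.
    move: xp => /ereal_sup_gt[_ [g [g0 gfin] <-]]; rewrite lte_fin => xg.
    exists ((x + g) / 2); first exact: (midf_lt xg).1.
    apply: (@lt_le_trans _ _ g%:E); first by rewrite lte_fin (midf_lt xg).2.
    by apply: ereal_sup_ubound; exists g.
  apply: continuous_in_subspaceT => y; rewrite inE /= in_itv/= => /andP[y0 yx].
  have yz := le_lt_trans yx xz; have z0 := lt_trans x0 xz.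
  have cm : {for y, continuous (fun g => fine (mgf P T g))}.
    apply: (mgf_continuous mT T0 z0 (Psi_eta_fin zp) _ yz).
    by rewrite (lt_le_trans _ y0)// ltrN10.
  rewrite (_ : psi Q P X = fun th => th - qbar00 Q * (fine (mgf P T th) - 1)); last first.
    by apply/funext => th; rewrite /psi PsiE.
  apply: cvgB; first exact: cvg_id.
  by apply: cvgM; [exact: cvg_cst|apply: cvgB; [exact: cm|exact: cvg_cst]].
have h0 : Num.min (psi Q P X 0) (psi Q P X x) <= lam <= Num.max (psi Q P X 0) (psi Q P X x).
  by rewrite psi0 ge_min le_max (ltW lam0) (ltW lx) orbT.
have [c] := IVT (ltW x0) cp h0.
rewrite in_itv/= => /andP[c0 cx] pc; exists c, x; split => //.
  rewrite lt_neqAle c0 andbT; apply: contraTneq lam0 => c0'.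
  by rewrite -pc -c0' psi0 ltxx.
rewrite lt_neqAle cx andbT; apply: contraTneq lx => cx'.
by rewrite -cx' pc ltxx.
Qed.

End psi_root.

Lemma series_cvg_EFin (R : realType) (f : nat -> R) (l : R) : (forall k, 0 <= f k) ->
  (\sum_(k <oo) (f k)%:E = l%:E)%E -> series f @ \oo --> l.
Proof.
move=> f0 fl.
have cv : (fun n : nat => (\sum_(0 <= k < n) (f k)%:E)%E) @ \oo --> l%:E.
  rewrite -fl; apply: is_cvg_nneseries => n _ _; by rewrite lee_fin.
have E : (fun n : nat => (\sum_(0 <= k < n) (f k)%:E)%E) = EFin \o series f.
  by apply/funext => n; rewrite sumEFin.
by rewrite E in cv; exact: (fine_cvg cv).
Qed.

Unset Implicit Arguments. Set Strict Implicit. Set Printing Implicit Defensive.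

Theorem mainTheorem1 (R : realType) (d d' : measure_display)
  (Omega : measurableType d) (Omega' : measurableType d')
  (Q : state -> state -> R) (lam : R)
  (P : nat -> probability Omega R) (X : nat -> R -> Omega -> state)
  (Pbar : probability Omega' R) (Xbar : R -> Omega' -> state) :
  is_Qmatrix Q ->
  (forall y, Q None y = 0) ->
  irreducible_on_N Q ->
  0 < lam ->
  (forall i : nat, Q (Some i) None = (if i == 0%N then lam else 0)) ->
  (forall i : nat, is_ctmc (P i) Q (Some i) (X i)) ->
  is_ctmc Pbar (Qbar Q) (Some 0%N) Xbar ->
  (forall mu : nat -> R, is_prob_vector mu ->
     Pmix P mu (fun j => [set w | (Tdelta (X j) w < +oo)%E]) = 1%E) ->
  (0 < gamma_star P X)%E ->
  (exists l : \bar R, is_lambda_c Q Pbar Xbar l /\ (lam%:E < l)%E) ->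
  exists ts : R,
    [/\ theta_star P X = ts%:E,
        0 < ts /\ (ts%:E < theta_plus Pbar Xbar)%E,
        psi Q Pbar Xbar ts = lam,
        (forall th : R, 0 < th -> (th%:E < theta_plus Pbar Xbar)%E ->
            psi Q Pbar Xbar th = lam -> th = ts) &
        exists nu : nat -> R,
          [/\ (forall i j : nat,
                 cond_prob (P j) (X j) t i @[t --> +oo] --> nu i),
              is_prob_vector nu,
              (forall t : R, 0 <= t -> forall i : nat,
                 cond_mix P X nu t i = nu i),
              nu 0%N = ts / lam &
              (forall i : nat, (0 < i)%N ->
                 (nu i)%:E = ((- qbar00 Q) * ts / lam)%:E
                             * exc_int Pbar Xbar ts i)%E]].
Proof.
move=> HQ QN irr lam0 Qkill HX HXb Habs _ [l [Hl lamlt]].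
pose A := offdiag Q; pose q k := qrate Q (Some k).
have A0 i j : 0 <= A i j by exact: offdiag_ge0.
have A00 : A 0 0 = 0 by rewrite /A /offdiag eqxx.
have irrA := offdiag_ind irr.
have Qk0 i : (0 < i)%N -> Q (Some i) None = 0 by move=> i0; rewrite Qkill gtn_eqF.
have qpos k : 0 < qrate Q (Some k).
  apply: le_lt_trans (qrate_gt_kill HQ irr k); rewrite Qkill; case: ifP => // _; exact: ltW.
have qbpos k : 0 < qrate (Qbar Q) (Some k).
  by rewrite qrate_Qbar subr_gt0; exact: qrate_gt_kill.
have qbE : - qbar00 Q = q 0%N - lam.
  by have := qrate_Qbar Q 0; rewrite Qkill eqxx.
have qb0 : qbar00 Q < 0 by rewrite -oppr_gt0; exact: (qbpos 0%N).
have [Yb [Jb [[mYb mJb] [J0b Jmb] Jeb XYb lawb]]] := HXb.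
have mT := measurable_exc_time mYb mJb J0b Jmb Jeb XYb.
have T0 := @exc_time_ge0 _ Omega' R Xbar.
have PsiE := Psi_eta_mgf HQ QN qbpos mYb mJb J0b Jmb Jeb XYb lawb.
have [ts [th' [ts0 tsth' th'p pts]]] := psi_root mT T0 PsiE Hl lam0 lamlt.
have tsp : (ts%:E < theta_plus Pbar Xbar)%E by apply: lt_trans th'p; rewrite lte_fin.
have th'0 : 0 < th' by exact: lt_trans tsth'.
have Pfin := Psi_eta_fin mT T0 PsiE tsp.
have Pfin' := Psi_eta_fin mT T0 PsiE th'p.
have green := Psi_eta_green HQ QN qbpos Qk0 mYb mJb J0b Jmb Jeb XYb lawb.
have ret : green_return A q ts = (q 0%N - ts)%:E.
  rewrite -green ?PsiE//.
  have mf : mgf Pbar (exc_time Xbar) ts \is a fin_num.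
    by rewrite ge0_fin_numE//; apply: integral_ge0 => w _; exact: expeR_ge0.
  move: pts; rewrite /psi PsiE -(fineK mf) -EFinM => pts; congr (_%:E).
  have -> : qrate (Qbar Q) (Some 0%N) = - qbar00 Q by [].
  move: pts; have -> : qbar00 Q = - (q 0%N - lam) by rewrite -qbE opprK.
  by move=> pts; lra.
have ret' : (green_return A q th' < +oo)%E.
  by rewrite -green ?PsiE//; apply: lte_mul_pinfty => //; rewrite ?lee_fin ?ltW//; exact: qbpos.
have rows i : (0 < i)%N -> (\sum_(j <oo) (A i j)%:E = (q i)%:E)%E.
  by move=> i0; rewrite /A (offdiag_sum HQ) Qk0// subr0.
have row0 : (\sum_(j <oo) (A 0 j)%:E = (q 0%N - lam)%:E)%E.
  by rewrite /A (offdiag_sum HQ) Qkill eqxx.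
have Pabs i : P i [set w | (Tdelta (X i) w < +oo)%E] = 1%E.
  have [H1 H2] := Pmix_delta P i (fun j => [set w | (Tdelta (X j) w < +oo)%E]).
  by rewrite -H2; exact: Habs.
pose p i j t := tker A q (delta R i) j t.
have mass i t : 0 <= t -> (\sum_(j <oo) p i j t + lam%:E * occup (p i 0%N) t = 1)%E.
  have [Y [J [[mY mJ] [J0 Jm] Je XY law]]] := HX i.
  exact: (X_mass HQ QN qpos lam0 Qkill mY mJ J0 Jm Je XY law).
have killed i : (lam%:E * \int[@lebesgue_measure R]_s p i 0%N s = 1)%E.
  have [Y [J [[mY mJ] [J0 Jm] Je XY law]]] := HX i.
  exact: (X_absorbed HQ QN qpos lam0 Qkill mY mJ J0 Jm Je XY law).
have alive i j t : 0 <= t -> P i [set w | X i t w = Some j /\ (t%:E < Tdelta (X i) w)%E] = p i j t.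
  have [Y [J [[mY mJ] [J0 Jm] Je XY law]]] := HX i.
  exact: (X_alive HQ QN qpos mY mJ J0 Jm Je XY law).
have surv i t : 0 <= t -> P i [set w | (t%:E < Tdelta (X i) w)%E] = (\sum_(j <oo) p i j t)%E.
  have [Y [J [[mY mJ] [J0 Jm] Je XY law]]] := HX i.
  exact: (X_survival HQ QN qpos mY mJ J0 Jm Je XY law).
have mTd i : measurable_fun setT (Tdelta (X i)).
  have [Y [J [[mY mJ] [J0 Jm] Je XY law]]] := HX i.
  exact: (measurable_Tdelta mY mJ J0 Jm Je XY).
have Td0 i w : (0 <= Tdelta (X i) w)%E.
  by apply: le_ereal_inf_tmp => _ [t [t0 _] <-]; rewrite lee_fin.
have p0 i j t : (0 <= p i j t)%E by apply: tker_ge0 => // k; exact: delta_ge0.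
have slr := qsd_survival_le A0 A00 irrA lam0 ts0 tsth' rows row0 mass killed ret ret'.
have inv := qsd_invariant A0 A00 irrA lam0 ts0 tsth' rows row0 mass killed ret ret'.
have msum := qsd_m_sum A0 A00 irrA lam0 ts0 tsth' rows row0 killed ret ret'.
pose m := qsd_m A q ts.
have m0 j : 0 < m j by exact: (qsd_m_gt0 A0 irrA ret).
have lts : 0 < lam / ts by rewrite divr_gt0.
have tsl : 0 < ts / lam by rewrite divr_gt0.
exists ts; split => //.
- have h0 : 0 <= qsd_h A q ts 0 * (lam / ts).
    by rewrite mulr_ge0 ?(ltW lts)// (le_trans (ltW tsl))// (qsd_h_lower A0 A00 irrA lam0 ts0 killed ret).
  have Z0 := qsd_Z_gt0 A0 A00 irrA lam0 ts0 tsth' killed ret ret'.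
  have hpos : 0 < qsd_h A q ts 0.
    exact: lt_le_trans tsl (qsd_h_lower A0 A00 irrA lam0 ts0 killed ret 0%N).
  (* The limit constant is that of [qsd_cvg_mass], the exact order of the survival probability from
     0; the uniform constant is that of [qsd_survival_le]. *)
  apply: (@mgf_abscissa _ _ _ (P 0%N) (Tdelta (X 0%N)) (mTd 0%N) (Td0 0%N) ts
    (qsd_h A q ts 0 / qsd_Z A q ts * (lam / ts)) (qsd_h A q ts 0 * (lam / ts))) => //.
  + by rewrite mulr_gt0// divr_gt0.
  + by move=> t t0; rewrite surv//; exact: slr.
  apply: cvg_trans (qsd_cvg_mass A0 A00 irrA lam0 ts0 tsth' rows row0 mass killed ret ret' (i := 0%N)).
  apply: near_eq_cvg; near=> t.
  have t0 : 0 <= t by near: t; exists 0; split; [exact: num_real|move=> x; exact: ltW].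
  rewrite surv// (_ : (\sum_(j <oo) tker A (fun j => q j - ts)%R (delta R 0) j t)%E =
    ((expR (ts * t))%:E * \sum_(j <oo) p 0%N j t)%E); last first.
    rewrite -nneseriesZle ?lee_fin ?expR_ge0//; apply: eq_eseriesr => j _.
    by rewrite phE.
  rewrite fineM// ge0_fin_numE; first by apply: le_lt_trans (slr 0%N _ t0) _; exact: ltry.
  exact: nneseries_ge0T.
- move=> th th0 thp pth; have [h|h|//] := ltgtP th ts.
    by have := psi_strict mT T0 PsiE qb0 h tsp; rewrite pth pts ltxx.
  by have := psi_strict mT T0 PsiE qb0 h thp; rewrite pth pts ltxx.
pose nu i := ts / lam * m i.
have nu0 i : 0 <= nu i by rewrite mulr_ge0// ltW.
have nusum : (\sum_(k <oo) (nu k)%:E = 1%:E)%E.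
  rewrite (eq_eseriesr (fun k _ => EFinM _ _)) nneseriesZle ?lee_fin ?(ltW tsl)//; last first.
    by move=> k; rewrite lee_fin ltW.
  by rewrite msum -EFinM; congr (_%:E); field; rewrite !lt0r_neq0.
have nuinv t i : 0 <= t -> (\sum_(j <oo) ((nu j)%:E * p j i t) = (nu i * expR (- (ts * t)))%:E)%E.
  move=> t0; transitivity ((ts / lam)%:E * \sum_(j <oo) ((m j)%:E * p j i t))%E.
    rewrite -nneseriesZle ?lee_fin ?(ltW tsl)//; last by move=> j; rewrite mule_ge0// lee_fin ltW.
    by apply: eq_eseriesr => j _; rewrite EFinM muleA.
  by rewrite inv// -EFinM /nu; congr (_%:E); rewrite -mulrA; congr (_ * _); rewrite mulrC.
exists nu; split.
- move=> i j.
  apply: cvg_trans (qsd_cvg_ratio A0 A00 irrA lam0 ts0 tsth' rows row0 mass killed ret ret' j (j := i)).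
  apply: near_eq_cvg; near=> t.
  have t0 : 0 <= t by near: t; exists 0; split; [exact: num_real|move=> x; exact: ltW].
  by rewrite /cond_prob alive// surv.
- by split => //; exact: series_cvg_EFin.
- move=> t t0 i; rewrite /cond_mix /Pmix.
  rewrite (eq_eseriesr (fun j _ => congr1 (mule (nu j)%:E) (alive j i t t0))) nuinv//.
  rewrite (eq_eseriesr (fun j _ => congr1 (mule (nu j)%:E) (surv j t t0))).
  (* Summing the invariance identity over all states: from [nu] the survival probability is exactly
     exponential of rate [ts], and it cancels against the same factor in the numerator. *)
  have -> : (\sum_(j <oo) ((nu j)%:E * \sum_(k <oo) p j k t) = (expR (- (ts * t)))%:E)%E.
    under eq_eseriesr => j _ do rewrite -nneseriesZle ?lee_fin//.
    rewrite nneseries_interchangeT; last by move=> j k; rewrite mule_ge0// lee_fin.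
    rewrite (eq_eseriesr (fun k _ => nuinv t k t0)).
    rewrite (eq_eseriesr (fun k _ => EFinM _ _)) nneseriesZre ?lee_fin ?expR_ge0//.
    by rewrite nusum mul1e.
  by rewrite /= mulfK// gt_eqF// expR_gt0.
- by rewrite /nu /m /qsd_m eqxx mulr1.
move=> i i0.
(* [- qbar00 Q] is the rate [qb] of leaving 0, the factor by which the unnormalised Green function
   exceeds the excursion integral. *)
have -> : ((- qbar00 Q * ts / lam)%:E = (ts / lam)%:E * (qrate (Qbar Q) (Some 0%N))%:E)%E.
  by rewrite -EFinM; congr (_%:E); rewrite -mulrA mulrC.
rewrite -muleA (exc_int_gsum HQ QN qbpos Qk0 mYb mJb J0b Jmb Jeb XYb lawb)//.
rewrite /nu /m /qsd_m gtn_eqF// EFinM fineK// ge0_fin_numE; last exact: gsum_ge0.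
by apply: (gsum_fin A0 irrA); rewrite ret ltry.
Unshelve. all: by end_near.
Qed.
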